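(* Let $\pi\colon(T,X)\to(T,Y)$ be a non-PI extension of minimal compact metric flows. Then there is a residual set $Y_{\mathrm{LY}}\subseteq Y$ such that for every $y\in Y_{\mathrm{LY}}$ there is a residual subset $G_y$ of $\pi^{-1}y$ such that for every $x\in G_y$ there is a residual subset $S[x]$ of $\mathtt M_\infty[x]=\{x':(x,x')\in\mathtt M_\infty\}$ with the property that $(x,x')$ is a Li-Yorke pair for $\pi$ relative to $\mathtt M_\infty$ for each $x'\in S[x]$.
   Context: $T$ is a group acting continuously (regarded as discrete for the Ellis machinery). $\mathtt R_\pi=\{(x_1,x_2):\pi x_1=\pi x_2\}$, $\Delta_X$ the diagonal. For a closed $L$ with $\Delta_X\subsetneq L\subseteq\mathtt R_\pi$, a pair $(x,x')$ is a Li-Yorke pair for $\pi$ rel. $L$ if $(x,x')\in\mathtt R_\pi$ and $L\subseteq\overline{T(x,x')}$. $\pi$ is proximal if $\overline{Tz}\cap\Delta_X\ne\emptyset$ for all $z\in\mathtt R_\pi$; a.p. if there is no $(x,x')\in\mathtt R_\pi\setminus\Delta_X$ with $\overline{T((U\times V)\cap\mathtt R_\pi)}\cap\Delta_X\ne\emptyset$ for all neighborhoods $U\ni x$, $V\ni x'$. $\pi$ is PI if there are a minimal compact flow $X'$ and a proximal extension $\rho\colon X'\to X$ such that $\pi\circ\rho$ admits a PI-tower: an ordinal $\vartheta$, minimal compact flows $Y_\gamma$ ($\gamma\le\vartheta$), $Y_0=Y$, compatible extensions $\pi'_\gamma\colon X'\to Y_\gamma$ ($\pi'_0=\pi\circ\rho$)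 and $\psi_\gamma^{\gamma+1}\colon Y_{\gamma+1}\to Y_\gamma$ each proximal or a.p., inverse limits at limit ordinals, and $\pi'_\vartheta$ an isomorphism. Ellis machinery: $\mathbb I$ a minimal left ideal of $\beta T$, $\mathrm{Aut}(\mathbb I)$ the automorphisms of $(T,\mathbb I)$, $\Gamma[\alpha]=\{(m,\alpha m):m\in\mathbb I\}$; $\alpha_i\to_\tau\alpha$ iff for every $m$ there is a net $m_i\to m$ with $\alpha_im_i\to\alpha m$. For a $\tau$-closed subgroup $\mathbb F$, $\mathbb F'=\{\alpha\in\mathbb F:\exists\delta_i\in\mathbb F,\ \delta_i\to_\tau\alpha,\ \delta_i\to_\tau\mathrm{id}_{\mathbb I}\}$. Fix an extension $\pi_X\colon\mathbb I\to X$, $\pi_Y=\pi\circ\pi_X$, $\mathbb F=\{\alpha:\pi_Y\circ\alpha=\pi_Y\}$; $\mathbb F_0=\mathbb F$, $\mathbb F_{o+1}=\mathbb F_o'$, intersections at limit ordinals; $\mathbb F_\infty$ is the stable value. $\mathtt M_\infty=(\pi_X\times\pi_X)\big(\overline{\bigcup_{\alpha\in\mathbb F_\infty}\Gamma[\alpha]}\big)$. *)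

(* Defs.v *)
From HB Require Import structures.
From mathcomp Require Import all_boot all_algebra all_classical reals topology.

Set Implicit Arguments.
Unset Strict Implicit.
Unset Printing Implicit Defensive.

Local Open Scope classical_set_scope.

Record group_law (G : Type) := GroupLaw {
  gmul : G -> G -> G;
  gone : G;
  ginv : G -> G;
  gmulA : forall a b c, gmul a (gmul b c) = gmul (gmul a b) c;
  gmul1 : forall a, gmul gone a = a;
  gmulV : forall a, gmul (ginv a) a = gone }.

Definition topgroup (T : topologicalType) (g : group_law T) : Prop :=
  continuous (fun p : T * T => gmul g p.1 p.2) /\ continuous (ginv g).

Definition is_flow (T : topologicalType) (g : group_law T)
    (Z : topologicalType) (act : T -> Z -> Z) : Prop :=
  (forall z, act (gone g) z = z) /\
  (forall s t z, act (gmul g s t) z = act s (act t z)) /\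
  continuous (fun p : T * Z => act p.1 p.2).

Definition invariant (T Z : Type) (act : T -> Z -> Z) (A : set Z) : Prop :=
  forall t z, A z -> A (act t z).

Definition minimal_act (T : Type) (Z : topologicalType) (act : T -> Z -> Z) : Prop :=
  forall A : set Z, closed A -> A !=set0 -> invariant act A -> A = setT.

Definition cflow (T : topologicalType) (g : group_law T)
    (Z : topologicalType) (act : T -> Z -> Z) : Prop :=
  is_flow g act /\ compact [set: Z] /\ hausdorff_space Z.

Definition min_cflow (T : topologicalType) (g : group_law T)
    (Z : topologicalType) (act : T -> Z -> Z) : Prop :=
  cflow g act /\ minimal_act act.

Definition ext (T : Type) (Z W : topologicalType)
    (actZ : T -> Z -> Z) (actW : T -> W -> W) (f : Z -> W) : Prop :=
  continuous f /\ (forall w, exists z, f z = w) /\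
  (forall t z, f (actZ t z) = actW t (f z)).

Definition flow_iso (T : Type) (Z W : topologicalType)
    (actZ : T -> Z -> Z) (actW : T -> W -> W) (f : Z -> W) : Prop :=
  ext actZ actW f /\
  exists h : W -> Z, continuous h /\ cancel f h /\ cancel h f.

Definition Rpi (Z W : Type) (f : Z -> W) : set (Z * Z) :=
  [set p | f p.1 = f p.2].

Definition diagonal (Z : Type) : set (Z * Z) := [set p | p.1 = p.2].

Definition act2 (T Z : Type) (act : T -> Z -> Z) (t : T) (p : Z * Z) : Z * Z :=
  (act t p.1, act t p.2).

Definition Tset (T Z : Type) (act : T -> Z -> Z) (A : set (Z * Z)) : set (Z * Z) :=
  [set q | exists t p, A p /\ q = act2 act t p].

Definition orbit2 (T Z : Type) (act : T -> Z -> Z) (p : Z * Z) : set (Z * Z) :=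
  [set act2 act t p | t in [set: T]].

Definition proximal_ext (T : Type) (Z W : topologicalType)
    (actZ : T -> Z -> Z) (f : Z -> W) : Prop :=
  forall z, Rpi f z -> closure (orbit2 actZ z) `&` @diagonal Z !=set0.

Definition ap_ext (T : Type) (Z W : topologicalType)
    (actZ : T -> Z -> Z) (f : Z -> W) : Prop :=
  ~ exists x x' : Z, Rpi f (x, x') /\ x <> x' /\
      forall U V : set Z, nbhs x U -> nbhs x' V ->
        closure (Tset actZ ((U `*` V) `&` Rpi f)) `&` @diagonal Z !=set0.

(* a strict well-order on O (ordinals <= theta are modelled by such an O
   with a greatest element) *)
Definition wf_order (O : Type) (lt : O -> O -> Prop) : Prop :=
  (forall a b c, lt a b -> lt b c -> lt a c) /\ (forall a, ~ lt a a) /\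
  (forall a b, a = b \/ lt a b \/ lt b a) /\ well_founded lt.

Definition succ_of (O : Type) (lt : O -> O -> Prop) (a b : O) : Prop :=
  lt a b /\ forall c, lt a c -> c = b \/ lt b c.

Definition limit_of (O : Type) (lt : O -> O -> Prop) (o0 l : O) : Prop :=
  l <> o0 /\ ~ exists a, succ_of lt a l.

Definition PI_tower (T : topologicalType) (g : group_law T)
    (X' : topologicalType) (actX' : T -> X' -> X')
    (Y : topologicalType) (actY : T -> Y -> Y) (p : X' -> Y) : Prop :=
  exists (O : Type) (lt : O -> O -> Prop) (o0 th : O),
    wf_order lt /\ (forall a, ~ lt a o0) /\ (forall a, a = th \/ lt a th) /\
    exists (Yg : O -> topologicalType) (actYg : forall a, T -> Yg a -> Yg a)
           (pi' : forall a, X' -> Yg a) (psi : forall a b, Yg b -> Yg a)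
           (phi0 : Yg o0 -> Y),
      (forall a, min_cflow g (actYg a) /\ ext actX' (actYg a) (pi' a)) /\
      (forall a b, lt a b ->
         ext (actYg b) (actYg a) (psi a b) /\
         forall x, psi a b (pi' b x) = pi' a x) /\
      flow_iso (actYg o0) actY phi0 /\ (forall x, phi0 (pi' o0 x) = p x) /\
      (forall a b, succ_of lt a b ->
         proximal_ext (actYg b) (psi a b) \/ ap_ext (actYg b) (psi a b)) /\
      (* inverse limits at limit ordinals *)
      (forall l, limit_of lt o0 l ->
         (forall y y' : Yg l,
            (forall a, lt a l -> psi a l y = psi a l y') -> y = y') /\
         (forall th' : forall a, Yg a,
            (forall a b, lt a b -> lt b l -> psi a b (th' b) = th' a) ->
            exists y : Yg l, forall a, lt a l -> psi a l y = th' a)) /\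
      flow_iso actX' (actYg th) (pi' th).

Definition is_PI (T : topologicalType) (g : group_law T)
    (X Y : topologicalType) (actX : T -> X -> X) (actY : T -> Y -> Y)
    (pi : X -> Y) : Prop :=
  exists (X' : topologicalType) (actX' : T -> X' -> X') (rho : X' -> X),
    min_cflow g actX' /\ ext actX' actX rho /\ proximal_ext actX' rho /\
    PI_tower g actX' actY (pi \o rho).

(* beta T is modelled inside the type of all set systems on T; its
   topology is generated by the sets [p | A \in p]; on ultrafilters this
   is exactly the Stone topology of beta T. *)
Definition betaT (T : Type) := set (set T).
HB.instance Definition _ T := Choice.copy (betaT T) (set (set T)).
HB.instance Definition _ T := @isSubBaseTopological.Build (betaT T)
  (set T) setT (fun A => [set p : betaT T | p A]).

Definition is_ultra (T : Type) (p : betaT T) : Prop :=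
  p setT /\ ~ p set0 /\ (forall A B, p A -> p B -> p (A `&` B)) /\
  (forall A B, A `<=` B -> p A -> p B) /\ (forall A, p A \/ p (~` A)).

Definition bmul (T : Type) (g : group_law T) (p q : betaT T) : betaT T :=
  [set A | p [set t | q [set s | A (gmul g t s)]]].

Definition bact (T : Type) (g : group_law T) (t : T) (p : betaT T) : betaT T :=
  [set A | p [set s | A (gmul g t s)]].

Definition left_ideal (T : Type) (g : group_law T) (L : set (betaT T)) : Prop :=
  L `<=` @is_ultra T /\ forall p m, is_ultra p -> L m -> L (bmul g p m).

Definition min_left_ideal (T : Type) (g : group_law T) (I : set (betaT T)) : Prop :=
  left_ideal g I /\ I !=set0 /\
  forall L, left_ideal g L -> L !=set0 -> L `<=` I -> L = I.

Definition is_aut (T : Type) (g : group_law T) (I : set (betaT T))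
    (a : betaT T -> betaT T) : Prop :=
  (forall m, I m -> I (a m)) /\ {within I, continuous a} /\
  (forall t m, I m -> a (bact g t m) = bact g t (a m)) /\
  exists b : betaT T -> betaT T,
    (forall m, I m -> I (b m)) /\ {within I, continuous b} /\
    (forall m, I m -> b (a m) = m /\ a (b m) = m).

Definition ext_I (T : Type) (g : group_law T) (I : set (betaT T))
    (X : topologicalType) (actX : T -> X -> X) (f : betaT T -> X) : Prop :=
  {within I, continuous f} /\ (forall x, exists m, I m /\ f m = x) /\
  (forall t m, I m -> f (bact g t m) = actX t (f m)).

Definition directed (D : Type) (le : D -> D -> Prop) : Prop :=
  (exists i : D, True) /\ (forall i, le i i) /\
  (forall i j k, le i j -> le j k -> le i k) /\
  (forall i j, exists k, le i k /\ le j k).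

Definition net_cvg (D : Type) (le : D -> D -> Prop) (Z : topologicalType)
    (z : D -> Z) (l : Z) : Prop :=
  forall U, nbhs l U -> exists i0, forall i, le i0 i -> U (z i).

Definition tau_cvg (T : Type) (I : set (betaT T)) (D : Type) (le : D -> D -> Prop)
    (al : D -> betaT T -> betaT T) (a : betaT T -> betaT T) : Prop :=
  forall m, I m -> exists mn : D -> betaT T,
    (forall i, I (mn i)) /\ net_cvg le mn m /\
    net_cvg le (fun i => al i (mn i)) (a m).

Definition derived (T : Type) (I : set (betaT T))
    (F : set (betaT T -> betaT T)) : set (betaT T -> betaT T) :=
  [set a | F a /\ exists (D : Type) (le : D -> D -> Prop)
                         (d : D -> betaT T -> betaT T),
     directed le /\ (forall i, F (d i)) /\ tau_cvg I le d a /\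
     tau_cvg I le d id].

(* the stages F_o of the transfinite sequence F_0 = F, F_{o+1} = F_o',
   F_lambda = intersection: the smallest family containing F, closed
   under ' and under intersections of nonempty subfamilies *)
Inductive stage (T : Type) (I : set (betaT T)) (F0 : set (betaT T -> betaT T))
  : set (betaT T -> betaT T) -> Prop :=
| stage0 : stage I F0 F0
| stageS S : stage I F0 S -> stage I F0 (derived I S)
| stageI (Fam : set (set (betaT T -> betaT T))) :
    Fam !=set0 -> (forall S, Fam S -> stage I F0 S) ->
    stage I F0 (\bigcap_(S in Fam) S).

(* stable value F_infinity (= the smallest stage) *)
Definition Finf (T : Type) (I : set (betaT T)) (F0 : set (betaT T -> betaT T))
  : set (betaT T -> betaT T) :=
  \bigcap_(S in stage I F0) S.

Definition FY (T : Type) (g : group_law T) (I : set (betaT T))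
    (Y : Type) (piY : betaT T -> Y) : set (betaT T -> betaT T) :=
  [set a | is_aut g I a /\ forall m, I m -> piY (a m) = piY m].

Definition Gamma (T : Type) (I : set (betaT T)) (a : betaT T -> betaT T)
  : set (betaT T * betaT T) :=
  [set (m, a m) | m in I].

Definition Minf (T : Type) (g : group_law T) (I : set (betaT T))
    (X Y : Type) (piX : betaT T -> X) (pi : X -> Y) : set (X * X) :=
  [set q | exists m m' : betaT T, I m /\ I m' /\
     closure (\bigcup_(a in Finf I (FY g I (pi \o piX))) Gamma I a) (m, m') /\
     q = (piX m, piX m')].

Definition LY_pair (T : Type) (X Y : topologicalType) (actX : T -> X -> X)
    (pi : X -> Y) (L : set (X * X)) (x x' : X) : Prop :=
  closed L /\ @diagonal X `<=` L /\ L <> @diagonal X /\ L `<=` Rpi pi /\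
  Rpi pi (x, x') /\ L `<=` closure (orbit2 actX (x, x')).

Definition residual_in (Z : topologicalType) (A S : set Z) : Prop :=
  S `<=` A /\
  exists V : nat -> set Z, (forall n, open (V n)) /\
    (forall n, A `<=` closure (V n `&` A)) /\
    A `&` \bigcap_(n in [set: nat]) V n `<=` S.

(* Main.v *)
Require Import Defs.
From HB Require Import structures.
From mathcomp Require Import all_boot all_algebra all_classical reals topology.
Local Open Scope classical_set_scope.

(* The set M_infinity is the closure of the images of the graphs of the
   automorphisms in F_infinity.  As F_infinity is a group equal to its own
   derived group, a single graph comes close to any two of them; graphs are
   minimal, so M_infinity is topologically transitive, and it has a dense set of
   almost periodic points.  Hence M_infinity -> X and X -> Y are semi-open, and
   two Kuratowski-Ulam arguments distribute the residual set of transitive points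
   of M_infinity over the fibres.

   What is left is that M_infinity differs from the diagonal, that is, that pi is
   PI as soon as F_infinity fixes piX.  All flows of the tower are quotients of
   the minimal ideal I.  For a tau-closed group G of automorphisms, the limits of
   graphs of elements of G form a closed invariant equivalence relation, because I
   is extremally disconnected (disjoint open sets have disjoint closures).  Given
   a quotient strictly above the one of the group H of X, with group G, either
   the smallest such relation with the same group is strictly smaller, which gives
   a proximal step, or the limits of graphs of nets in G converging to elements of
   G'H give an almost periodic step.  The latter is proper unless G = G'H, and then
   a minimal closed S <= G with G = SH satisfies S = S', so that S <= F_infinity
   <= H and G = H. *)
Set Implicit Arguments.
Unset Strict Implicit.
Unset Printing Implicit Defensive.

(** * Ultrafilters and limits *)

(** Two obstacles shape the proof. The Ellis machinery regards T as discrete, while every flow of a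
    PI-tower must be jointly continuous for the topology of T. So each relation on the ideal has to
    absorb the pairs (lim u, lim v u) with v tending to the unit; this is the origin of the extra
    factor v in all nets below. Secondly, tau is compact, but it is not assumed Hausdorff and
    multiplication is only known to be separately continuous. The remedy is that a net c with n -> p
    and c n -> q tau-converges to every automorphism whose graph meets the orbit closure of (p, q).
    This selects limits of the factors of a product which multiply exactly to a given limit of the
    product; any other limits differ from these by elements of the derived group. The tower does not
    end at X but at X' = I / [rel_K] H, with H the group of X, which is proximal over X. Both
    transfinite sequences, that of groups and that of relations, are handled without ordinals, as
    least families closed under a step and under nonempty intersections. *)

Lemma filter_setC_false (K : Type) (F : set_system K) (A : set K) :
  ProperFilter F -> F A -> F (~` A) -> False.
Proof.
move=> PF FA FnA; apply: (@filter_not_empty _ F).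
by rewrite -(setICr A); exact: filterI.
Qed.

Lemma ultra_fmap (K Z : Type) (f : K -> Z) (F : set_system K) :
  UltraFilter F -> UltraFilter (f @ F).
Proof.
move=> UF; split; first exact: fmap_proper_filter.
move=> G PG sFG; apply/seteqP; split => // A GA.
have [//|FnA] := in_ultra_setVsetC (f @^-1` A) UF.
by have /(filter_setC_false _ GA) : G (~` A) by apply: sFG.
Qed.

Lemma filter_meet (K : Type) (F : set_system K) (A B : set K) :
  ProperFilter F -> F A -> F B -> exists k, A k /\ B k.
Proof.
move=> PF FA FB.
have /filter_ex [k [Ak Bk]] : F (A `&` B) by exact: filterI.
by exists k.
Qed.

Lemma filter_meet3 (K : Type) (F : set_system K) (A B C : set K) :
  ProperFilter F -> F A -> F B -> F C -> exists k, [/\ A k, B k & C k].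
Proof.
move=> PF FA FB FC.
have FAB : F (A `&` B) by exact: filterI.
by have [k [[Ak Bk] Ck]] := filter_meet PF FAB FC; exists k.
Qed.

(** Used with [G] a product of neighbourhood filters: one ultrafilter of parameters then makes all
    coordinates of [f] converge at once. *)
Lemma ultra_lift (K Z : Type) (f : K -> Z) (G : set_system Z) :
  Filter G -> (forall A, G A -> exists k, A (f k)) ->
  exists F, UltraFilter F /\ G `<=` f @ F.
Proof.
move=> FG ex.
have PF : ProperFilter (filter_from G (fun A => f @^-1` A)).
  apply: filter_from_proper; last by move=> A /ex [k Ak]; exists k.
  apply: filter_from_filter; first by exists setT; exact: filterT.
  by move=> A B GA GB; exists (A `&` B) => //; exact: filterI.
have [F [UF sF]] := ultraFilterLemma PF.
by exists F; split => // A GA; apply: sF; exists A.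
Qed.

Lemma ultra_cvg (K : Type) (Z : topologicalType) (f : K -> Z)
    (F : set_system K) : compact [set: Z] -> UltraFilter F ->
  exists z : Z, f @ F --> z.
Proof.
rewrite compact_ultra => cZ UF.
have [z [_ zP]] := cZ (f @ F) (ultra_fmap f UF) filterT.
by exists z.
Qed.

Lemma ultra_continuous (S Z : topologicalType) (f : S -> Z) (x : S) :
  (forall F, UltraFilter F -> F --> x -> f @ F --> f x) -> {for x, continuous f}.
Proof.
move=> H B nB; apply: contrapT => nfB.
have [F [UF sF]] : exists F, UltraFilter F /\
    within (~` (f @^-1` B)) (nbhs x) `<=` (@id S) @ F.
  apply: ultra_lift => A; rewrite /within /= => wA.
  apply: contrapT => nA; apply: nfB; apply: filterS wA => s sA.
  by apply: contrapT => nB'; apply: nA; exists s; apply: sA.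
have Fx : F --> x by move=> A nA; apply: sF; apply: filterS nA => s As _.
have FB : F (f @^-1` B) by exact: (H F UF Fx B nB).
have FnB : F (~` (f @^-1` B)) by exact: (sF _ (withinT _ _)).
exact: filter_setC_false FB FnB.
Qed.

Lemma cvg_pair2 (K : Type) (U V : topologicalType) (f : K -> U) (h : K -> V)
    (F : set_system K) (u : U) (v : V) :
  Filter F -> f @ F --> u -> h @ F --> v ->
  (fun k => (f k, h k)) @ F --> ((u, v) : U * V).
Proof. by move=> FF fu hv; exact: cvg_pair. Qed.

Lemma closure_near (K : Type) (Z : topologicalType) (f : K -> Z)
   (F : set_system K) (A : set Z) (z : Z) :
  ProperFilter F -> f @ F --> z -> F (f @^-1` A) -> closure A z.
Proof.
move=> PF fz FA B nB.
have /filter_ex [k [Ak Bk]] : F (f @^-1` A `&` f @^-1` B).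
  by apply: filterI => //; exact: fz.
by exists (f k).
Qed.

Lemma subbase_cvg (Z : topologicalType) (I : choiceType) (D : set I)
    (b : I -> set Z) (F : set_system Z) (z : Z) :
  @open Z = [set \bigcup_(A in D') A | D' in subset^~ (finI_from D b)] ->
  Filter F -> (forall i, D i -> b i z -> F (b i)) -> F --> z.
Proof.
move=> openZ FF H A; rewrite nbhsE => -[B [oB Bz] sBA].
apply: filterS sBA _.
move: oB Bz; rewrite openZ => -[D' sD' <-] [C D'C Cz].
apply: (@filterS _ _ _ C); first by move=> x Cx; exists C.
have [E sE IE] := sD' C D'C; rewrite -IE.
apply: filter_bigI => i iE; apply: H; first by have := sE i iE; rewrite inE.
by move: Cz; rewrite -IE; apply.
Qed.

Lemma subbase_open (Z : topologicalType) (I : choiceType) (D : set I)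
    (b : I -> set Z) (i : I) :
  @open Z = [set \bigcup_(A in D') A | D' in subset^~ (finI_from D b)] ->
  D i -> open (b i).
Proof.
move=> -> Di; exists [set b i]; last by rewrite bigcup_set1.
by move=> _ ->; apply: finI_from1.
Qed.

Lemma betaT_openE (T : Type) : @open (betaT T) =
  [set \bigcup_(A in D') A | D' in subset^~
    (finI_from setT (fun A => [set p : betaT T | p A]))].
Proof. by []. Qed.

Lemma cvg_to_prod (K U V : Type) (F : set_system K) (f : K -> U * V)
    (G : set_system U) (H : set_system V) :
  Filter G -> Filter H -> filter_prod G H `<=` f @ F ->
  G `<=` (fun k => (f k).1) @ F /\ H `<=` (fun k => (f k).2) @ F.
Proof.
move=> FG FH sF; split.
  exact: (cvg_comp _ _ sF cvg_fst).
exact: (cvg_comp _ _ sF cvg_snd).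
Qed.

Lemma closed_cvg_mem K (Z : topologicalType) (F : set_system K) (c : K -> Z)
    (A : set Z) z : ProperFilter F -> closed A -> F [set k | A (c k)] ->
  c @ F --> z -> A z.
Proof. by move=> PF cA FA cz; apply: cA; exact: closure_near PF cz FA. Qed.

Lemma pair_continuous (S U V : topologicalType) (f : S -> U) (h : S -> V) :
  continuous f -> continuous h -> continuous (fun x => (f x, h x)).
Proof. by move=> cf ch x; apply: cvg_pair2; [exact: cf|exact: ch]. Qed.

Lemma cst_cont (S U : topologicalType) (u : U) : continuous (fun _ : S => u).
Proof. by move=> x; exact: cvg_cst. Qed.

Lemma id_cont (S : topologicalType) : continuous (fun x : S => x).
Proof. by move=> x; exact: cvg_id. Qed.

Lemma comp_cont (S U V : topologicalType) (f : S -> U) (h : U -> V) :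
  continuous f -> continuous h -> continuous (h \o f).
Proof. by move=> cf ch x; apply: continuous_comp; [exact: cf|exact: ch]. Qed.

Lemma fst_cont (S U : topologicalType) : continuous (fun p : S * U => p.1).
Proof. by move=> p; exact: cvg_fst. Qed.

Lemma snd_cont (S U : topologicalType) : continuous (fun p : S * U => p.2).
Proof. by move=> p; exact: cvg_snd. Qed.

Lemma lim_unique (K : Type) (Z : topologicalType) (f : K -> Z)
    (F : set_system K) (a b : Z) : hausdorff_space Z -> ProperFilter F ->
  f @ F --> a -> f @ F --> b -> a = b.
Proof.
move=> hZ PF fa fb; apply: hZ => A B nA nB.
have FA : F (f @^-1` A) by exact: fa.
have FB : F (f @^-1` B) by exact: fb.
by have [k [Ak Bk]] := filter_meet PF FA FB; exists (f k).
Qed.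

(** * Automorphisms of a flow and the topology tau *)

Section GroupLaw.
Variables (T : Type) (g : group_law T).

(** [group_law] has only left axioms. The product of [a] and its inverse is idempotent, hence the
    unit, and this yields the right-hand axioms. *)
Lemma gmul_idem (a : T) : gmul g a a = a -> a = gone g.
Proof.
by move=> aa; rewrite -(gmulV g a) -{3}aa gmulA gmulV gmul1.
Qed.

Lemma gmulVr (a : T) : gmul g a (ginv g a) = gone g.
Proof.
apply: gmul_idem.
by rewrite -gmulA (gmulA _ (ginv g a)) gmulV gmul1.
Qed.

Lemma gmulr1 (a : T) : gmul g a (gone g) = a.
Proof. by rewrite -(gmulV g a) gmulA gmulVr gmul1. Qed.

Lemma ginv1 : ginv g (gone g) = gone g.
Proof. by rewrite -{2}(gmulV g (gone g)) gmulr1. Qed.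

End GroupLaw.

Lemma hausdorff_prod (U V : topologicalType) :
  hausdorff_space U -> hausdorff_space V -> hausdorff_space (U * V)%type.
Proof.
move=> hU hV [a b] [c d] cl; congr pair.
  apply: hU => A B nA nB.
  have [||z [[Az _] [Bz _]]] := cl (A `*` setT) (B `*` setT).
  + by exists (A, setT) => //; split => //; exact: filterT.
  + by exists (B, setT) => //; split => //; exact: filterT.
  by exists z.1.
apply: hV => A B nA nB.
have [||z [[_ Az] [_ Bz]]] := cl (setT `*` A) (setT `*` B).
+ by exists (setT, A) => //; split => //; exact: filterT.
+ by exists (setT, B) => //; split => //; exact: filterT.
by exists z.2.
Qed.

Lemma closed_preimage (S Z : topologicalType) (f : S -> Z) (D : set Z) :
  continuous f -> closed D -> closed (f @^-1` D).
Proof. by move=> /continuous_closedP; apply. Qed.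

Lemma closed_equalizer (S Z : topologicalType) (f h : S -> Z) :
  hausdorff_space Z -> continuous f -> continuous h ->
  closed [set x | f x = h x].
Proof.
move=> hZ cf ch x clx; apply: hZ => A B nA nB.
have nA' : nbhs x (f @^-1` A) by exact: cf.
have nB' : nbhs x (h @^-1` B) by exact: ch.
have [y [/= fh [Ay By]]] := clx _ (filterI nA' nB').
by exists (f y); split => //; rewrite fh.
Qed.

(** * Orbits in minimal flows *)

Section Orbits.
Variables (T : Type) (g : group_law T) (Z : topologicalType) (act : T -> Z -> Z).
Hypothesis act1 : forall z, act (gone g) z = z.
Hypothesis actM : forall s t z, act (gmul g s t) z = act s (act t z).
Hypothesis actc : forall t, continuous (act t).
Hypothesis minZ : minimal_act act.

Lemma actVK t z : act (ginv g t) (act t z) = z.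
Proof. by rewrite -actM gmulV. Qed.

Lemma actKV t z : act t (act (ginv g t) z) = z.
Proof. by rewrite -actM gmulVr. Qed.

Lemma invariant_closure (A : set Z) :
  Defs.invariant act A -> Defs.invariant act (closure A).
Proof.
move=> iA t z clz B nB.
have nB' : nbhs z (act t @^-1` B) by exact: actc.
have [y [Ay By]] := clz _ nB'.
by exists (act t y); split => //; apply: iA.
Qed.

Lemma dense_orbit z (O : set Z) : open O -> O !=set0 -> exists t, O (act t z).
Proof.
move=> oO [w Ow].
have clT : closure [set act t z | t in [set: T]] = setT.
  apply: minZ; first exact: closed_closure.
    by exists z; apply: subset_closure; exists (gone g).
  apply: invariant_closure => s _ [t _ <-]; exists (gmul g s t) => //.
have : closure [set act t z | t in [set: T]] w by rewrite clT.
move=> /(_ O (open_nbhs_nbhs (conj oO Ow))) [_ [[t _ <-] Ot]].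
by exists t.
Qed.

Lemma minimal_eq (W : topologicalType) (actW : T -> W -> W) (f h : Z -> W) z :
  hausdorff_space W -> continuous f -> continuous h ->
  (forall t x, f (act t x) = actW t (f x)) ->
  (forall t x, h (act t x) = actW t (h x)) ->
  f z = h z -> f = h.
Proof.
move=> hW cf ch ef eh fz.
have E : [set x | f x = h x] = setT.
  apply: minZ; first exact: closed_equalizer.
    by exists z.
  by move=> t x /= fx; rewrite ef eh fx.
by apply/funext => x; have : [set x | f x = h x] x by rewrite E.
Qed.

End Orbits.

Section AutDef.
Variables (T : Type) (M : topologicalType) (act : T -> M -> M).

Definition is_autM (a : M -> M) : Prop :=
  continuous a /\ (forall t m, a (act t m) = act t (a m)) /\
  exists b : M -> M, continuous b /\ (forall t m, b (act t m) = act t (b m)) /\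
    cancel a b /\ cancel b a.

Definition Aut := {a : M -> M | is_autM a}.
Definition aut_fun (a : Aut) : M -> M := sval a.

HB.instance Definition _ := gen_eqMixin Aut.
HB.instance Definition _ := gen_choiceMixin Aut.
(* The topology tau: [a] is near the automorphisms whose graphs meet every
   open box met by the graph of [a]. *)
HB.instance Definition _ := @isSubBaseTopological.Build Aut
  (set M * set M)%type setT
  (fun p => [set a : Aut | exists u, p.1° u /\ p.2° (aut_fun a u)]).

End AutDef.
Coercion aut_fun : Aut >-> Funclass.

Section AutOps.
Variables (T : Type) (M : topologicalType) (act : T -> M -> M).
Local Notation Aut := (Aut act).

Lemma aut_cont (a : Aut) : continuous a.
Proof. by case: a => a [] . Qed.

Lemma aut_act (a : Aut) t m : a (act t m) = act t (a m).
Proof. by case: a => a [] ? []. Qed.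

Lemma is_autM_id : is_autM act id.
Proof.
have cid : continuous (@id M) by move=> x; exact: cvg_id.
by split => //; split => //; exists id.
Qed.

Definition aone : Aut := exist _ _ is_autM_id.

Lemma is_autM_comp (a b : Aut) : is_autM act (a \o b).
Proof.
case: a b => [a [ca [ea [a' [ca' [ea' [aK aK']]]]]]].
case=> [b [cb [eb [b' [cb' [eb' [bK bK']]]]]]] /=; split.
  by move=> x; apply: continuous_comp; [exact: cb|exact: ca].
split; first by move=> t m /=; rewrite eb ea.
exists (b' \o a'); split.
  by move=> x; apply: continuous_comp; [exact: ca'|exact: cb'].
split; first by move=> t m /=; rewrite ea' eb'.
by split => x /=; rewrite ?aK ?bK ?bK' ?aK'.
Qed.

Definition amul (a b : Aut) : Aut := exist _ _ (is_autM_comp a b).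

Lemma ainv_ex (a : Aut) : exists b : Aut, cancel a b /\ cancel b a.
Proof.
case: a => [a [ca [ea [b [cb [eb [aK bK]]]]]]].
have ib : is_autM act b by split => //; split => //; exists a.
by exists (exist _ b ib).
Qed.

Definition ainv (a : Aut) : Aut := sval (cid (ainv_ex a)).

Lemma ainvK (a : Aut) : cancel a (ainv a).
Proof. by rewrite /ainv; case: cid => b []. Qed.

Lemma ainvKV (a : Aut) : cancel (ainv a) a.
Proof. by rewrite /ainv; case: cid => b []. Qed.

Lemma aut_ext (a b : Aut) : (forall m, a m = b m) -> a = b.
Proof. by case: a b => [a pa] [b pb] /= ab; apply: eq_exist; apply/funext. Qed.

Lemma amulA (a b c : Aut) : amul a (amul b c) = amul (amul a b) c.
Proof. exact: aut_ext. Qed.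
Lemma amul1 (a : Aut) : amul aone a = a.
Proof. exact: aut_ext. Qed.
Lemma amulr1 (a : Aut) : amul a aone = a.
Proof. exact: aut_ext. Qed.
Lemma amulV (a : Aut) : amul (ainv a) a = aone.
Proof. by apply: aut_ext => m /=; rewrite ainvK. Qed.
Lemma amulrV (a : Aut) : amul a (ainv a) = aone.
Proof. by apply: aut_ext => m /=; rewrite ainvKV. Qed.
Lemma amulK (a b : Aut) : amul (amul a b) (ainv b) = a.
Proof. by rewrite -amulA amulrV amulr1. Qed.
Lemma amulVK (a b : Aut) : amul (amul a (ainv b)) b = a.
Proof. by rewrite -amulA amulV amulr1. Qed.
Lemma amulKl (a b : Aut) : amul (ainv a) (amul a b) = b.
Proof. by rewrite amulA amulV amul1. Qed.
Lemma amulVKl (a b : Aut) : amul a (amul (ainv a) b) = b.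
Proof. by rewrite amulA amulrV amul1. Qed.
Lemma ainvM (a b : Aut) : ainv (amul a b) = amul (ainv b) (ainv a).
Proof.
apply: aut_ext => m.
by rewrite -{1}[m](ainvKV a) -{1}(ainvKV b (ainv a m)) (ainvK (amul a b)).
Qed.
Lemma ainvI (a : Aut) : ainv (ainv a) = a.
Proof. by apply: aut_ext => m; rewrite -{1}[m](ainvK a) ainvK. Qed.
Lemma ainv1 : ainv aone = aone.
Proof. by rewrite -[LHS]amulr1 amulV. Qed.

Definition box (U W : set M) : set Aut := [set a : Aut | exists u, U u /\ W (a u)].

Lemma box_open U W : open U -> open W -> open (box U W).
Proof.
move=> /interior_id oU /interior_id oW.
have := @subbase_open Aut _ setT
  (fun p => [set a : Aut | exists u, p.1° u /\ p.2° (a u)]) (U, W) erefl I.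
by rewrite /= oU oW.
Qed.

Lemma tau_cvgP (F : set_system Aut) (a : Aut) {FF : Filter F} :
  (forall U W, open U -> open W -> box U W a -> F (box U W)) -> F --> a.
Proof.
move=> H; apply: (@subbase_cvg Aut _ setT
  (fun p => [set a : Aut | exists u, p.1° u /\ p.2° (a u)])) => //.
by move=> [U W] _ /=; apply: H; exact: open_interior.
Qed.

Lemma tau_cvg_box K (F : set_system K) (c : K -> Aut) (a : Aut) U W {FF : Filter F} :
  c @ F --> a -> open U -> open W -> box U W a -> F [set k | box U W (c k)].
Proof.
by move=> ca oU oW aUW; apply: ca; apply: open_nbhs_nbhs; split => //; apply: box_open.
Qed.

Lemma open_aut_preimage (a : Aut) U : open U -> open (a @^-1` U).
Proof. by move=> oU; apply: open_comp => // x _; exact: aut_cont. Qed.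

Lemma tau_continuous (Z : topologicalType) (f : Z -> Aut) :
  (forall z U W, open U -> open W -> box U W (f z) ->
     nbhs z (f @^-1` (box U W))) -> continuous f.
Proof.
move=> H z; have FF : Filter (f x @[x --> z]) by exact: fmap_filter.
by apply: (tau_cvgP (FF := FF)) => U W oU oW /(H z U W oU oW).
Qed.

(** Only separate continuity of multiplication is available for tau; [der_joint] recovers joint
    continuity modulo the derived group. *)
Lemma amulL_continuous (a : Aut) : continuous (amul a).
Proof.
apply: tau_continuous => b U W oU oW [u [Uu Wu]].
have : nbhs b (box U (a @^-1` W)).
  apply: open_nbhs_nbhs; split; last by exists u.
  by apply: box_open => //; exact: open_aut_preimage.
by apply: filterS => c [v [Uv Wv]]; exists v.
Qed.

Lemma amulR_continuous (b : Aut) : continuous (amul^~ b).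
Proof.
apply: tau_continuous => a U W oU oW [u [Uu Wu]].
have : nbhs a (box (ainv b @^-1` U) W).
  apply: open_nbhs_nbhs; split.
    by apply: box_open => //; exact: open_aut_preimage.
  by exists (b u); rewrite /preimage /= ainvK.
apply: filterS => c [v [Uv Wv]]; exists (ainv b v); split => //=.
by rewrite ainvKV.
Qed.

Lemma ainv_continuous : continuous ainv.
Proof.
apply: tau_continuous => a U W oU oW [u [Uu Wu]].
have : nbhs a (box W U).
  apply: open_nbhs_nbhs; split; first exact: box_open.
  by exists (ainv a u); rewrite ainvKV.
by apply: filterS => c [v [Wv Uv]]; exists (c v); rewrite ainvK.
Qed.

Definition subgroup (G : set Aut) : Prop :=
  G aone /\ (forall a b, G a -> G b -> G (amul a b)) /\
  (forall a, G a -> G (ainv a)).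

(** Neighbourhood form of the derived group: a net in [G] tends both to [a] and to the unit exactly
    when all their neighbourhoods meet within [G]. It measures how far [G] is from being
    Hausdorff. *)
Definition der (G : set Aut) : set Aut :=
  [set a | G a /\ forall A B, nbhs a A -> nbhs aone B -> (A `&` B `&` G) !=set0].

Lemma der_sub G : der G `<=` G.
Proof. by move=> a []. Qed.

Lemma der_mono (G H : set Aut) : G `<=` H -> der G `<=` der H.
Proof.
move=> GH a [Ga aP]; split; first exact: GH.
by move=> A B nA nB; have [c [cAB /GH Hc]] := aP A B nA nB; exists c.
Qed.

Lemma der_closed G : closed G -> closed (der G).
Proof.
move=> cG a cla; split.
  by apply: cG; apply: closureS cla; exact: der_sub.
move=> A B; rewrite nbhsE => -[A' [oA' A'a] sA] nB.
have [b [[_ bP] A'b]] := cla A' (open_nbhs_nbhs (conj oA' A'a)).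
have [c [[A'c Bc] Gc]] := bP A' B (open_nbhs_nbhs (conj oA' A'b)) nB.
by exists c; do 2 split => //; exact: sA.
Qed.

Lemma der_normal G a b : subgroup G -> G a -> der G b ->
  der G (amul (amul a b) (ainv a)).
Proof.
move=> [G1 [GM GV]] Ga [Gb bP]; split; first by apply/(GM _ _ (GM _ _ Ga Gb))/GV.
move=> A B nA nB.
pose f c := amul (amul a c) (ainv a).
have cf : continuous f.
  move=> c; apply: (@continuous_comp _ _ _ (amul a) (amul^~ (ainv a))).
    exact: amulL_continuous.
  exact: amulR_continuous.
have nB' : nbhs aone (f @^-1` B).
  by apply: cf; rewrite /f amulr1 amulrV.
have [c [[Ac Bc] Gc]] := bP _ _ (cf b A nA) nB'.
exists (f c); split; first by split.
by rewrite /f; apply/(GM _ _ (GM _ _ Ga Gc))/GV.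
Qed.

Lemma der_subgroup G : subgroup G -> subgroup (der G).
Proof.
move=> sG; have [G1 [GM GV]] := sG; split; [|split].
- split => // A B nA nB; exists aone; split => //; split; exact: nbhs_singleton.
- move=> a b [Ga aP] [Gb bP]; split; first exact: GM.
  (* Separate continuity suffices: [c] is taken near [b] and the unit with [amul a c] in [A'], and
     then [d] so near [a] and the unit that [amul d c] stays in both targets. *)
  move=> A B; rewrite nbhsE => -[A' [oA' A'ab] sA] /nbhs_interior nB.
  have nA' : nbhs b (amul a @^-1` A').
    by apply: amulL_continuous; exact: open_nbhs_nbhs.
  have [c [[A'c Bc] Gc]] := bP _ _ nA' nB.
  have nA'c : nbhs a (amul^~ c @^-1` A').
    by apply: amulR_continuous; exact: open_nbhs_nbhs.
  have nBc : nbhs aone (amul^~ c @^-1` B).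
    by apply: amulR_continuous; rewrite amul1.
  have [d [[A'd Bd] Gd]] := aP _ _ nA'c nBc.
  by exists (amul d c); split; [split => //; exact: sA|exact: GM].
- move=> a [Ga aP]; split; first exact: GV.
  move=> A B nA nB.
  have nA' : nbhs a (ainv @^-1` A) by exact: ainv_continuous.
  have nB' : nbhs aone (ainv @^-1` B) by apply: ainv_continuous; rewrite ainv1.
  have [c [[Ac Bc] Gc]] := aP _ _ nA' nB'.
  by exists (ainv c); split; [split|exact: GV].
Qed.

(** Right translation by [ainv b] turns the two limits into [amul a (ainv b)] and the unit. *)
Lemma der_of_cvg2 K (F : set_system K) (G : set Aut) (c : K -> Aut) (a b : Aut) :
  ProperFilter F -> subgroup G -> F [set k | G (c k)] -> G a -> G b ->
  c @ F --> a -> c @ F --> b -> der G (amul a (ainv b)).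
Proof.
move=> PF [G1 [GM GV]] Fc Ga Gb ca cb; split; first by apply: GM => //; exact: GV.
move=> A B nA nB.
have nA' : nbhs a (amul^~ (ainv b) @^-1` A) by exact: amulR_continuous.
have nB' : nbhs b (amul^~ (ainv b) @^-1` B).
  by apply: amulR_continuous; rewrite amulrV.
have FA : F (c @^-1` (amul^~ (ainv b) @^-1` A)) by exact: ca.
have FB : F (c @^-1` (amul^~ (ainv b) @^-1` B)) by exact: cb.
have [k [Ak Bk Gk]] := filter_meet3 PF FA FB Fc.
by exists (amul (c k) (ainv b)); split; [split|apply: GM => //; exact: GV].
Qed.

End AutOps.
Arguments aone {T M act}.

(* The properties of a minimal left ideal of beta T on which the construction of
   the tower rests; [uf_pair] comes from its idempotents. *)
Record universal_flow (T : Type) (g : group_law T) (M : topologicalType)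
    (act : T -> M -> M) : Prop := UniversalFlow {
  uf_inh : exists m : M, True;
  uf_compact : compact [set: M];
  uf_hausdorff : hausdorff_space M;
  uf_act1 : forall m, act (gone g) m = m;
  uf_actM : forall s t m, act (gmul g s t) m = act s (act t m);
  uf_cont : forall t, continuous (act t);
  uf_min : minimal_act act;
  uf_ed : forall A B : set M, open A -> open B -> A `&` B = set0 ->
    closure A `&` closure B = set0;
  uf_pair : forall n n' : M, exists x (r : Aut act),
    closure (orbit2 act (n, n')) (x, r x) }.

Section Universal.
Variables (T : Type) (g : group_law T) (M : topologicalType) (act : T -> M -> M).
Hypothesis hM : universal_flow g act.
Local Notation Aut := (Aut act).

(* Automorphisms commute with T and orbits are dense, so convergence of the
   graphs at one point of M already gives tau-convergence. *)
Lemma tau_cvg_pair K (F : set_system K) (c : K -> Aut) (n : K -> M) p q x (r : Aut) :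
  Filter F -> n @ F --> p -> (fun k => c k (n k)) @ F --> q ->
  closure (orbit2 act (p, q)) (x, r x) -> c @ F --> r.
Proof.
move=> FF np cq clr.
have FcF : Filter (c @ F) by exact: fmap_filter.
apply: (tau_cvgP (FF := FcF)) => U W oU oW [u [Uu Wu]].
have oUW : open (U `&` (r @^-1` W)).
  by apply: openI => //; exact: open_aut_preimage.
have [t [Ut Wt]] : exists t, (U `&` (r @^-1` W)) (act t x).
  apply: (dense_orbit (uf_act1 hM) (uf_actM hM) (uf_cont hM) (uf_min hM) x oUW).
  by exists u.
have nU s y (A : set M) : open A -> A (act s y) -> nbhs y (act s @^-1` A).
  by move=> oA As; apply: (uf_cont hM); exact: open_nbhs_nbhs.
have nx : nbhs (x, r x) ((act t @^-1` U) `*` (act t @^-1` W)).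
  exists (act t @^-1` U, act t @^-1` W) => //=; split; apply: nU => //.
  by rewrite -aut_act.
have [_ [[s _ <-] /= [Us Ws]]] := clr _ nx.
have Fn : F (n @^-1` (act (gmul g t s) @^-1` U)).
  by apply: np; apply: nU => //; rewrite (uf_actM hM).
have Fcn : F ((fun k => c k (n k)) @^-1` (act (gmul g t s) @^-1` W)).
  by apply: cq; apply: nU => //; rewrite (uf_actM hM).
apply: filterS2 Fn Fcn => k /= Uk Wk.
by exists (act (gmul g t s) (n k)); rewrite aut_act.
Qed.

(** The values at one point [m] tend to some [q]. The pair [(m, q)] need not lie on the graph of an
    automorphism, but its orbit closure meets one, and by [tau_cvg_pair] that automorphism is a
    limit. *)
Lemma aut_compact : compact [set: Aut].
Proof.
rewrite compact_ultra => F UF _.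
have [m _] := uf_inh hM.
have [q Fq] := ultra_cvg (fun a : Aut => a m) (uf_compact hM) UF.
have [x [r clr]] := uf_pair hM m q.
exists r; split => //.
have PF : Filter F by exact: filter_filter.
apply: (tau_cvg_pair (F := F) (c := id) (n := fun=> m) PF _ Fq clr).
exact: cvg_cst.
Qed.

Lemma aut_ultra_cvg K (F : set_system K) (c : K -> Aut) :
  UltraFilter F -> exists r : Aut, c @ F --> r.
Proof. by move=> UF; exact: ultra_cvg aut_compact UF. Qed.

(* Refines an ultrafilter so that tau-convergence at one point of M is
   realized by points indexed by the same filter. *)
Lemma refine_cvg K (F : set_system K) (c : K -> Aut) (b : Aut) (m : M) :
  UltraFilter F -> c @ F --> b ->
  exists F' : set_system (K * M), [/\ UltraFilter F', F `<=` fst @ F',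
    snd @ F' --> m & (fun k => c k.1 k.2) @ F' --> b m].
Proof.
move=> UF cb; have PF : Filter F by exact: filter_filter.
pose f (k : K * M) : K * (M * M) := (k.1, (k.2, c k.1 k.2)).
have FG : Filter (filter_prod F (filter_prod (nbhs m) (nbhs (b m)))).
  exact: filter_prod_filter.
have [|F' [UF' sF']] := @ultra_lift _ _ f _ FG.
  move=> A [[A1 A2] /= [FA1 [[U W] /= [nU nW] sA2]] sA].
  have bUW : F [set k | box U° W° (c k)].
    apply: tau_cvg_box cb _ _ _; [exact: open_interior|exact: open_interior|].
    by exists m.
  have [k [A1k [u [Uu Wu]]]] := filter_meet _ FA1 bUW.
  exists (k, u); apply: sA; split => //=; apply: sA2.
  by split => /=; exact: interior_subset.
exists F'; split => //.
- exact: (cvg_comp _ _ sF' cvg_fst).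
- exact: (cvg_comp _ _ sF' (cvg_comp _ _ cvg_snd cvg_fst)).
- exact: (cvg_comp _ _ sF' (cvg_comp _ _ cvg_snd cvg_snd)).
Qed.

End Universal.

(** * Derived groups *)

Lemma closure_map (S Z : topologicalType) (f : S -> Z) (A : set S) (B : set Z) x :
  continuous f -> (forall s, A s -> B (f s)) -> closure A x -> closure B (f x).
Proof.
move=> cf AB clx V nV; have nV' : nbhs x (f @^-1` V) by exact: cf.
by have [y [/AB By Vy]] := clx _ nV'; exists (f y).
Qed.

Lemma closure_orbit_map (T : Type) (Z W : topologicalType) (actZ : T -> Z -> Z)
    (actW : T -> W -> W) (f h : Z * Z -> W) p q :
  continuous f -> continuous h ->
  (forall t z, f (act2 actZ t z) = actW t (f z)) ->
  (forall t z, h (act2 actZ t z) = actW t (h z)) ->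
  closure (orbit2 actZ p) q -> closure (orbit2 actW (f p, h p)) (f q, h q).
Proof.
move=> cf ch ef eh; apply: (@closure_map _ _ (fun z => (f z, h z))).
  move=> z; apply: cvg_pair; [exact: cf|exact: ch].
by move=> _ [t _ <-]; exists t => //; rewrite /act2 /= ef eh.
Qed.

(** In the applications [y] is [r x], so the new pair lies on the graph of [amul e (ainv r)]. This
    identifies the limit of the left factor of a product tending to [e] whose right factor tends to
    [r]. *)
Lemma closure_orbit_swap (T : Type) (M : topologicalType) (act : T -> M -> M)
    (e : Aut act) (p q x y : M) :
  closure (orbit2 act (p, q)) (x, y) -> closure (orbit2 act (q, e p)) (y, e x).
Proof.
apply: (closure_orbit_map (f := snd) (h := e \o fst)) => //.
- by move=> z; exact: cvg_snd.
- by move=> z; apply: continuous_comp; [exact: cvg_fst|exact: aut_cont].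
- by move=> t [u v] /=; rewrite aut_act.
Qed.

Section Universal.
Variables (T : Type) (g : group_law T) (M : topologicalType) (act : T -> M -> M).
Hypothesis hM : universal_flow g act.
Local Notation Aut := (Aut act).

(* Multiplication on [G] is jointly continuous modulo [der G]; this takes the
   place of Ellis' theorem on the compact Hausdorff group [G / der G]. *)
Lemma der_joint K (F : set_system K) (G : set Aut) (c d : K -> Aut) (a b e : Aut) :
  UltraFilter F -> subgroup G -> closed G ->
  (forall k, G (c k)) -> (forall k, G (d k)) ->
  c @ F --> a -> d @ F --> b -> (fun k => amul (d k) (c k)) @ F --> e ->
  der G (amul e (ainv (amul b a))).
Proof.
move=> UF sG cG Gc Gd ca db dce; have [G1 [GM GV]] := sG.
have [m _] := uf_inh hM.
have [F' [UF' sF' nm dcn]] := refine_cvg m UF dce.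
have PF' : ProperFilter F' by exact: ultra_proper.
have FF' : Filter F' by exact: filter_filter.
have ca' : (c \o fst) @ F' --> a := cvg_comp _ _ sF' ca.
have db' : (d \o fst) @ F' --> b := cvg_comp _ _ sF' db.
have [q cnq] := ultra_cvg (fun k : K * M => c k.1 k.2) (uf_compact hM) UF'.
have [x [r clr]] := uf_pair hM m q.
have cr : (c \o fst) @ F' --> r := tau_cvg_pair hM FF' nm cnq clr.
have dr : (d \o fst) @ F' --> amul e (ainv r).
  apply: (tau_cvg_pair hM FF' cnq dcn (x := r x)).
  rewrite /= ainvK.
  exact: (closure_orbit_swap (e := e) clr).
have inG (f : K * M -> Aut) z : (forall k, G (f k)) -> f @ F' --> z -> G z.
  by move=> Gf; apply: (closed_cvg_mem PF' cG); apply: filterE.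
have Ga : G a by apply: inG ca' => k; exact: Gc.
have Gb : G b by apply: inG db' => k; exact: Gd.
have Gr : G r by apply: inG cr => k; exact: Gc.
have Ger : G (amul e (ainv r)) by apply: inG dr => k; exact: Gd.
have [_ [derM _]] := der_subgroup sG.
(* [r] and [a] are two limits of [c], while [amul e (ainv r)] and [b] are two limits of [d]. Both
   discrepancies lie in [der G], and normality combines them. *)
have d1 : der G (amul r (ainv a)).
  by apply: (der_of_cvg2 PF' sG _ _ _ cr ca') => //; apply: filterE => k; exact: Gc.
have d2 : der G (amul (amul e (ainv r)) (ainv b)).
  by apply: (der_of_cvg2 PF' sG _ _ _ dr db') => //; apply: filterE => k; exact: Gd.
have := derM _ _ d2 (der_normal sG Gb d1).
by rewrite ainvM !amulA !amulVK.
Qed.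

(* The [s]-factors of a convergent net [s h] with [h] in a closed set [H]
   determine the limit up to [der S] and [H]. *)
Lemma der_split K (F : set_system K) (S H : set Aut) (s h : K -> Aut) (a s0 : Aut) :
  UltraFilter F -> subgroup S -> closed S -> closed H ->
  (forall k, S (s k)) -> (forall k, H (h k)) ->
  s @ F --> s0 -> (fun k => amul (s k) (h k)) @ F --> a ->
  exists2 r, H r & der S (amul (amul a (ainv r)) (ainv s0)).
Proof.
move=> UF sS cS cH Ss Hh ss0 sha.
have [m _] := uf_inh hM.
have [F' [UF' sF' nm shn]] := refine_cvg m UF sha.
have PF' : ProperFilter F' by exact: ultra_proper.
have FF' : Filter F' by exact: filter_filter.
have ss' : (s \o fst) @ F' --> s0 := cvg_comp _ _ sF' ss0.
have [q hnq] := ultra_cvg (fun k : K * M => h k.1 k.2) (uf_compact hM) UF'.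
have [x [r clr]] := uf_pair hM m q.
have hr : (h \o fst) @ F' --> r := tau_cvg_pair hM FF' nm hnq clr.
have sr : (s \o fst) @ F' --> amul a (ainv r).
  apply: (tau_cvg_pair hM FF' hnq shn (x := r x)).
  rewrite /= ainvK.
  exact: (closure_orbit_swap (e := a) clr).
have inS (f : K * M -> Aut) z (A : set Aut) :
    closed A -> (forall k, A (f k)) -> f @ F' --> z -> A z.
  by move=> cA Af; apply: (closed_cvg_mem PF' cA); apply: filterE.
exists r; first by apply: inS hr => // k; exact: Hh.
apply: (der_of_cvg2 PF' sS _ _ _ sr ss').
- by apply: filterE => k; exact: Ss.
- by apply: inS sr => // k; exact: Ss.
- by apply: inS ss' => // k; exact: Ss.
Qed.

Lemma der_cvg (G : set Aut) a : der G a ->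
  exists F : set_system {x : Aut | G x}, [/\ UltraFilter F, sval @ F --> a & sval @ F --> aone].
Proof.
move=> [Ga aP].
have FG : Filter (filter_prod (nbhs a) (nbhs (@aone _ _ act))) by exact: filter_prod_filter.
have [|F [UF sF]] := @ultra_lift _ _ (fun x : {x : Aut | G x} => (sval x, sval x)) _ FG.
  move=> A [[B C] /= [nB nC] sA].
  have [x [[Bx Cx] Gx]] := aP _ _ nB nC.
  by exists (exist _ x Gx); apply: sA.
exists F; split => //; first exact: (cvg_comp _ _ sF cvg_fst).
exact: (cvg_comp _ _ sF cvg_snd).
Qed.

Definition factors (G S H : set Aut) := 
  forall a, G a -> exists s h, [/\ S s, H h & a = amul s h].

(** A net in [G] tends both to [a] and to the unit. Its [S]-factors tend to one [s0]; splitting both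
    limits against this same [s0] and dividing cancels it. *)
Lemma der_prod_sub (G S H : set Aut) a : subgroup S -> closed S -> closed H ->
  subgroup H -> factors G S H -> der G a ->
  exists s h, [/\ der S s, H h & a = amul s h].
Proof.
move=> sS cS cH sH GSH /der_cvg [F [UF Fa F1]].
have [f fE] : {f : {x : Aut | G x} -> Aut * Aut & forall x,
    [/\ S (f x).1, H (f x).2 & sval x = amul (f x).1 (f x).2]}.
  apply: (choice (P := fun (x : {x : Aut | G x}) (z : Aut * Aut) =>
    [/\ S z.1, H z.2 & sval x = amul z.1 z.2])) => x.
  have [s [h ?]] := GSH _ (svalP x).
  by exists (s, h).
pose s x := (f x).1; pose h x := (f x).2.
have shE x : [/\ S (s x), H (h x) & sval x = amul (s x) (h x)] := fE x.
have [s0 ss0] := aut_ultra_cvg hM s UF.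
have E : sval = (fun x => amul (s x) (h x)) by apply/funext => x; case: (shE x).
have Ss k : S (s k) by case: (shE k).
have Hh k : H (h k) by case: (shE k).
rewrite E in Fa F1.
have [r Hr dr] := der_split UF sS cS cH Ss Hh ss0 Fa.
have [r1 Hr1 dr1] := der_split UF sS cS cH Ss Hh ss0 F1.
have [_ [HM HV]] := sH.
have [_ [derM derV]] := der_subgroup sS.
exists (amul (amul (amul a (ainv r)) (ainv s0))
         (ainv (amul (amul aone (ainv r1)) (ainv s0)))), (amul (ainv r1) r); split.
- by apply: derM => //; apply: derV.
- by apply: HM => //; apply: HV.
- by rewrite !ainvM !ainvI ainv1 amulr1 !amulA !(amulVK, amulK).
Qed.

Lemma perfect_factor (G H : set Aut) : subgroup G -> closed G ->
  subgroup H -> closed H -> factors G (der G) H ->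
  exists S, [/\ subgroup S, closed S, S `<=` G, S `<=` der S & factors G S H].
Proof.
move=> sG cG sH cH GDH.
pose P (S : set Aut) := [/\ subgroup S, closed S, S `<=` G & factors G S H].
have PG : P G.
  split => // a Ga; exists a, aone; split => //; first by case: sH.
  by rewrite amulr1.
pose R (A B : {S | P S}) := `[< sval B `<=` sval A >].
have [||||[S [sS cS SG GSH]] maxS] := @Zorn {S | P S} R.
- by move=> A; apply/asboolP.
- move=> A B C /asboolP AB /asboolP BC; apply/asboolP.
  exact: subset_trans BC AB.
- move=> [A PA] [B PB] /asboolP /= AB /asboolP /= BA.
  by apply: eq_exist; apply/seteqP.
- move=> C totC; have [[S0 CS0]|nC] := pselect (C !=set0); last first.
    by exists (exist _ G PG) => S CS; case: nC; exists S.
  pose I := [set a | forall S, C S -> sval S a].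
  suff PI : P I.
    by exists (exist _ I PI) => S CS; apply/asboolP => a /= Ia; exact: Ia.
  split.
  + split; [|split].
    * by move=> S CS; case: (svalP S) => -[].
    * move=> a b Ia Ib S CS; case: (svalP S) => -[_ [SM _]] _ _ _.
      by apply: SM; [exact: Ia|exact: Ib].
    * move=> a Ia S CS; case: (svalP S) => -[_ [_ SV]] _ _ _.
      by apply: SV; exact: Ia.
  + move=> a cla S CS; case: (svalP S) => _ cS _ _; apply: cS.
    by apply: closureS cla => b; apply.
  + by move=> a Ia; have [_ _ SG _] := svalP S0; apply: SG; exact: Ia.
  + move=> a Ga.
    (* Compactness keeps the factorisation of [a] in the intersection: the sets of admissible
       [S]-factors shrink along the chain, and a limit [r] of them lies in every member. *)
    pose Q (S : {S | P S}) := [set s | sval S s /\ H (amul (ainv s) a)].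
    have FQ : ProperFilter (filter_from C Q).
      apply: filter_from_proper; last first.
        move=> S _; case: (svalP S) => _ _ _ /(_ a Ga) [s [h [Ss Hh aE]]].
        by exists s; split => //; rewrite aE amulKl.
      apply: filter_from_filter; first by exists S0.
      move=> A B CA CB; case: (totC A B CA CB) => /asboolP AB.
        exists B => // s [Bs Hs]; split; split => //; exact: AB.
      exists A => // s [As Hs]; split; split => //; exact: AB.
    have [F [UF sF]] := ultraFilterLemma FQ.
    have PF : ProperFilter F by exact: ultra_proper.
    have [r Fr] := aut_ultra_cvg hM id UF.
    exists r, (amul (ainv r) a); split; last by rewrite amulVKl.
    * move=> S CS; case: (svalP S) => _ cS _ _.
      apply: (closed_cvg_mem PF cS _ Fr).
      by apply: sF; exists S => // s [].
    * apply: (closed_cvg_mem (c := fun s => amul (ainv s) a) PF cH).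
        by apply: sF; exists S0 => // s [].
      have cc : continuous ((fun x : Aut => amul x a) \o @ainv _ _ act).
        move=> s; apply: continuous_comp; first exact: ainv_continuous.
        exact: amulR_continuous.
      exact: (cvg_comp _ _ Fr (cc r)).
exists S; split => //.
(* [G] is [der G] times [H], and [der G] lies in [der S] times [H]; so [der S] competes with the
   minimal [S]. *)
have PD : P (der S).
  split; [exact: der_subgroup|exact: der_closed| |].
    by move=> a /der_sub /SG.
  move=> a Ga; have [d [h [Dd Hh ->]]] := GDH a Ga.
  have [s [h' [Ds Hh' ->]]] := der_prod_sub sS cS cH sH GSH Dd.
  exists s, (amul h' h); split => //; first by case: sH => _ [HM _]; exact: HM.
  by rewrite amulA.
have RD : R (exist _ S (And4 sS cS SG GSH)) (exist _ _ PD).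
  by apply/asboolP => /=; exact: der_sub.
have /(congr1 sval) /= -> // := maxS _ RD.
Qed.

(** The factors in [der G] are split off as elements of [G], so that the error supplied by
    [der_split] lies in [der G] again. *)
Lemma der_prod_closed (G H : set Aut) : subgroup G -> closed G -> closed H ->
  closed [set a | exists d h, [/\ der G d, H h & a = amul d h]].
Proof.
move=> sG cG cH a cla.
set L := (X in closure X) in cla *.
have [_ [derM _]] := der_subgroup sG.
have [|F [UF sF]] := @ultra_lift {x | L x} _ sval _ (within_filter L (nbhs_filter a)).
  by move=> B wB; have [b [Lb /(_ Lb) Bb]] := cla _ wB; exists (exist _ b Lb).
have Fa : sval @ F --> a.
  by move=> B nB; apply: sF; apply: filterS nB => b Bb _.
have [f fE] : {f : {x : Aut | L x} -> Aut * Aut & forall x,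
    [/\ der G (f x).1, H (f x).2 & sval x = amul (f x).1 (f x).2]}.
  apply: (choice (P := fun (x : {x : Aut | L x}) (z : Aut * Aut) =>
    [/\ der G z.1, H z.2 & sval x = amul z.1 z.2])) => x.
  have [s [h ?]] := svalP x.
  by exists (s, h).
pose s x := (f x).1; pose h x := (f x).2.
have shE x : [/\ der G (s x), H (h x) & sval x = amul (s x) (h x)] := fE x.
have E : sval = (fun x => amul (s x) (h x)) by apply/funext => x; case: (shE x).
have Ds k : der G (s k) by case: (shE k).
have Hh k : H (h k) by case: (shE k).
have [s0 ss0] := aut_ultra_cvg hM s UF.
rewrite E in Fa.
have PF : ProperFilter F by exact: ultra_proper.
have Ds0 : der G s0.
  by apply: (closed_cvg_mem PF (der_closed cG) _ ss0); exact: filterE.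
have Gs k : G (s k) by exact: der_sub.
have [r Hr dr] := der_split UF sG cG cH Gs Hh ss0 Fa.
exists (amul (amul (amul a (ainv r)) (ainv s0)) s0), r; split => //.
  exact: derM.
by rewrite !amulVK.
Qed.

Lemma der_prod_subgroup (G H : set Aut) : subgroup G -> subgroup H -> H `<=` G ->
  subgroup [set a | exists d h, [/\ der G d, H h & a = amul d h]].
Proof.
move=> sG sH HG; have [H1 [HM HV]] := sH.
have [D1 [DM DV]] := der_subgroup sG.
split; [|split].
- by exists aone, aone; split => //; rewrite amul1.
- move=> _ _ [d [h [Dd Hh ->]]] [d' [h' [Dd' Hh' ->]]].
  exists (amul d (amul (amul h d') (ainv h))), (amul h h'); split.
  + by apply: DM => //; apply: der_normal => //; exact: HG.
  + exact: HM.
  + by rewrite !amulA amulVK.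
- move=> _ [d [h [Dd Hh ->]]].
  exists (amul (amul (ainv h) (ainv d)) (ainv (ainv h))), (ainv h); split.
  + by apply: der_normal; [|apply/HG/HV|apply: DV].
  + exact: HV.
  + by rewrite amulVK ainvM.
Qed.

End Universal.

(** * Invariant closed equivalence relations *)

(** The open sets outside the ultrafilter are closed under finite unions and none contains [L]. By
    compactness their complements in [L] cluster at some [l], and no open neighbourhood of [l] is
    outside the ultrafilter. *)
Lemma compact_ultra_nbhs K (Z : topologicalType) (c : K -> Z) (F : set_system K)
    (L : set Z) : UltraFilter F -> compact L ->
  (forall O, open O -> L `<=` O -> F (c @^-1` O)) ->
  exists2 l, L l & c @ F --> l.
Proof.
move=> UF cL FL; pose D := [set O : set Z | open O /\ ~ F (c @^-1` O)].
have PF : ProperFilter (filter_from D (fun O => L `\` O)).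
  apply: filter_from_proper; last first.
    move=> O [oO nO]; apply: contrapT => nL; apply: nO; apply: FL => // x Lx.
    by apply: contrapT => nOx; apply: nL; exists x.
  apply: filter_from_filter.
    by exists set0; split; [exact: open0|rewrite preimage_set0; exact: filter_not_empty].
  move=> A B [oA nA] [oB nB]; exists (A `|` B); last first.
    by move=> x [Lx nAB]; split; split => // ?; apply: nAB; [left|right].
  split; first exact: openU.
  case: (in_ultra_setVsetC (c @^-1` A) UF) => // fA.
  case: (in_ultra_setVsetC (c @^-1` B) UF) => // fB FAB.
  have [k [[nAk nBk] [Ak|Bk]]] := filter_meet _ (filterI fA fB) FAB.
    exact: nAk.
  exact: nBk.
have [|l [Ll cl]] := cL _ PF.
  exists set0; last by move=> x [].
  by split; [exact: open0|rewrite preimage_set0; exact: filter_not_empty].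
exists l => // A; rewrite nbhsE => -[B [oB Bl] sB].
apply: contrapT => nA.
have DB : D B by split => // FB; apply: nA; apply: filterS FB => k /sB.
have [x [[_ nBx] Bx]] 
  := cl (L `\` B) B (ex_intro2 _ _ B DB (fun=> id)) (open_nbhs_nbhs (conj oB Bl)).
exact: nBx.
Qed.

Section Relations.
Variables (T : topologicalType) (g : group_law T) (M : topologicalType) (act : T -> M -> M).
Hypothesis hT : topgroup g.
Hypothesis hM : universal_flow g act.
Local Notation Aut := (Aut act).

(* A quotient of [M] is a flow of the topological group [T], and not only of the
   discrete one, exactly when its kernel contains [rel_J]. *)
Definition rel_J : set (M * M) := [set p | forall U W V,
  nbhs p.1 U -> nbhs p.2 W -> nbhs (gone g) V ->
  exists v u, [/\ V v, U u & W (act v u)]].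

(* Limits of points of graphs of nets in [G] that converge to elements of [L];
   the factor [act v] makes the relation contain [rel_J]. *)
Definition rel_N (G L : set Aut) : set (M * M) := [set p | forall U W V O,
  nbhs p.1 U -> nbhs p.2 W -> nbhs (gone g) V -> open O -> L `<=` O ->
  exists c v u, [/\ G c /\ O c, V v, U u & W (c (act v u))]].

(** Invariant closed equivalence relations whose quotients are flows of the topological group [T];
    see [quot_flow] and, conversely, [kernel_icer]. *)
Definition icer (R : set (M * M)) : Prop :=
  [/\ closed R, forall m, R (m, m), forall m m', R (m, m') -> R (m', m),
    forall m m' m'', R (m, m') -> R (m', m'') -> R (m, m'') &
    (forall t m m', R (m, m') -> R (act t m, act t m')) /\ rel_J `<=` R].

(** The Ellis group of the quotient by [R]; for an icer, [grp_one] decides membership at a single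
    point. *)
Definition grp (R : set (M * M)) : set Aut := [set a | forall m, R (m, a m)].

(** Translating a point [act v u] by [t] replaces [v] by its conjugate under [t]. *)
Lemma conj_nbhs t V : nbhs (gone g) V ->
  nbhs (gone g) ((fun v => gmul g (gmul g t v) (ginv g t)) @^-1` V).
Proof.
move=> nV; have [cmul _] := hT.
have cl (a : T) : continuous (fun v => gmul g a v).
  exact: (comp_cont (pair_continuous (@cst_cont T T a) (@id_cont T)) cmul).
have cr (a : T) : continuous (fun v => gmul g v a).
  exact: (comp_cont (pair_continuous (@id_cont T) (@cst_cont T T a)) cmul).
by apply: (comp_cont (cl t) (cr (ginv g t))); rewrite /= gmulr1 gmulVr.
Qed.

Lemma rel_J_intro K (F : set_system K) (v : K -> T) (u : K -> M) m m' :
  ProperFilter F -> v @ F --> gone g -> u @ F --> m ->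
  (fun k => act (v k) (u k)) @ F --> m' -> rel_J (m, m').
Proof.
move=> PF ve um vum U W V nU nW nV.
have [k [Vk Uk Wk]] := filter_meet3 PF (ve _ nV) (um _ nU) (vum _ nW).
by exists (v k), (u k).
Qed.

Lemma rel_N_intro K (F : set_system K) (G L : set Aut) (c : K -> Aut)
    (v : K -> T) (u : K -> M) l m m' :
  ProperFilter F -> (forall k, G (c k)) -> L l -> c @ F --> l ->
  v @ F --> gone g -> u @ F --> m ->
  (fun k => c k (act (v k) (u k))) @ F --> m' -> rel_N G L (m, m').
Proof.
move=> PF Gc Ll cl ve um cvum U W V O nU nW nV oO LO.
have FO : F (c @^-1` O) by apply: cl; apply: open_nbhs_nbhs; split => //; exact: LO.
have FV : F (v @^-1` V) by exact: ve.
have [k [[Ok Vk] Uk Wk]] := filter_meet3 PF (filterI FO FV) (um _ nU) (cvum _ nW).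
by exists (c k), (v k), (u k).
Qed.

(** The open sets around [L] only force the automorphisms towards [L] as a whole; compactness of [L]
    gives them one limit [l] in it. *)
Lemma rel_N_elim (G L : set Aut) m m' : closed L -> rel_N G L (m, m') ->
  exists (F : set_system ({x : Aut | G x} * (T * M))) (l : Aut),
  [/\ UltraFilter F /\ L l,
    (fun k : {x : Aut | G x} * (T * M) => sval k.1) @ F --> l,
    (fun k => k.2.1) @ F --> gone g, (fun k => k.2.2) @ F --> m &
    (fun k : {x : Aut | G x} * (T * M) =>
       sval k.1 (act k.2.1 k.2.2)) @ F --> m'].
Proof.
move=> cL Nm.
pose f (k : {x : Aut | G x} * (T * M)) :=
  (sval k.1, (k.2.1, (k.2.2, sval k.1 (act k.2.1 k.2.2)))).
have FL : Filter (set_nbhs L) by exact: set_nbhs_filter.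
have FG : Filter (filter_prod (set_nbhs L)
    (filter_prod (nbhs (gone g)) (filter_prod (nbhs m) (nbhs m')))).
  by apply: filter_prod_filter; apply: filter_prod_filter.
have [|F [UF sF]] := @ultra_lift _ _ f _ FG.
  move=> A [[O A1] /= [nO [[V A2] /= [nV [[U W] /= [nU nW] sA2]] sA1]] sA].
  move/set_nbhsP: nO => [O' [oO' LO' sO']].
  have [c [v [u [[Gc Oc] Vv Uu Wc]]]] := Nm U W V O' nU nW nV oO' LO'.
  exists (exist _ c Gc, (v, u)); apply: sA; split => //=; first exact: sO'.
  by apply: sA1; split => //=; apply: sA2.
have cLc : compact L by apply: (subclosed_compact cL (aut_compact hM)).
have [O oO LO|l Ll cl] := compact_ultra_nbhs
    (c := fun k : {x : Aut | G x} * (T * M) => sval k.1) UF cLc.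
  have : set_nbhs L `<=` fmap (fst \o f) F := cvg_comp _ _ sF cvg_fst.
  apply; apply/set_nbhsP; exists O; split => //.
exists F, l; split => //.
- exact: (cvg_comp _ _ sF (cvg_comp _ _ cvg_snd cvg_fst)).
- exact: (cvg_comp _ _ sF (cvg_comp _ _ cvg_snd (cvg_comp _ _ cvg_snd cvg_fst))).
- exact: (cvg_comp _ _ sF (cvg_comp _ _ cvg_snd (cvg_comp _ _ cvg_snd cvg_snd))).
Qed.

Lemma rel_J_N (G L : set Aut) : G aone -> L aone -> rel_J `<=` rel_N G L.
Proof.
move=> G1 L1 p Jp U W V O nU nW nV oO LO.
have [v [u [Vv Uu Wu]]] := Jp U W V nU nW nV.
by exists aone, v, u; split => //; split => //; exact: LO.
Qed.

Lemma rel_N_closed (G L : set Aut) : closed (rel_N G L).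
Proof.
move=> [m m'] clp U W V O /= nU nW nV oO LO.
have [|[p p'] [Np /= [Up Wp]]] := clp (U° `*` W°).
  by exists (U°, W°) => //; split; exact: nbhs_interior.
exact: Np.
Qed.

Lemma rel_N_act (G L : set Aut) t m m' :
  rel_N G L (m, m') -> rel_N G L (act t m, act t m').
Proof.
move=> Nm U W V O /= nU nW nV oO LO.
have nV' := conj_nbhs t nV.
have [c [v [u [Gc Vv Uu Wu]]]] := Nm _ _ _ O (uf_cont hM nU) (uf_cont hM nW) nV' oO LO.
exists c, (gmul g (gmul g t v) (ginv g t)), (act t u); split => //.
by rewrite !(uf_actM hM) (actVK (uf_act1 hM) (uf_actM hM)) aut_act.
Qed.

(** Composing the two nets requires a common middle point, whereas [m'] is only approached by each
    of them separately. *)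
Lemma rel_N_trans (G L : set Aut) m m' m'' :
  subgroup G -> closed G -> subgroup L -> closed L -> der G `<=` L ->
  rel_N G L (m, m') -> rel_N G L (m', m'') -> rel_N G L (m, m'').
Proof.
move=> sG cG sL cL DL N1 N2; have [_ [GM _]] := sG.
have [cmul _] := hT.
have [F1 [a [[UF1 La] ca1 v1 u1 w1]]] := rel_N_elim cL N1.
have [F2 [b [[UF2 Lb] cb2 v2 u2 w2]]] := rel_N_elim cL N2.
pose K := ({x : Aut | G x} * ({x : Aut | G x} * (T * (T * M))))%type.
pose f (k : K) := (sval k.1, (sval k.2.1, (k.2.2.1, (k.2.2.2.1, (k.2.2.2.2,
  sval k.2.1 (act k.2.2.2.1 (sval k.1 (act k.2.2.1 k.2.2.2.2)))))))).
have FG : Filter (filter_prod (nbhs a) (filter_prod (nbhs b)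
   (filter_prod (nbhs (gone g)) (filter_prod (nbhs (gone g))
     (filter_prod (nbhs m) (nbhs m'')))))).
  by do 4 (apply: filter_prod_filter).
have [|F [UF sF]] := @ultra_lift _ _ f _ FG.
  move=> A [[O1 A1] /= [nO1 [[O2 A2] /= [nO2 [[V1 A3] /= [nV1 [[V2 A4] /= [nV2
    [[U W] /= [nU nW] sA4]] sA3]] sA2]] sA1]] sA].
  (* [A'] consists of the points [c (act v u)] reached from [U], and [B'] of the points sent into
     [W] by the second net. Written as unions of preimages, both are visibly open. *)
  pose A' := \bigcup_(cv in [set cv : Aut * T | [/\ G cv.1, O1 cv.1 & V1 cv.2]])
    ((fun y => act (ginv g cv.2) (ainv cv.1 y)) @^-1` U°).
  pose B' := \bigcup_(dw in [set dw : Aut * T | [/\ G dw.1, O2 dw.1 & V2 dw.2]])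
    ((fun y => dw.1 (act dw.2 y)) @^-1` W°).
  have oA' : open A'.
    apply: bigcup_open => cv _; apply: open_comp; last exact: open_interior.
    by move=> y _; apply: continuous_comp; [exact: aut_cont|exact: (uf_cont hM)].
  have oB' : open B'.
    apply: bigcup_open => cv _; apply: open_comp; last exact: open_interior.
    by move=> y _; apply: continuous_comp; [exact: (uf_cont hM)|exact: aut_cont].
  have clA : closure A' m'.
    apply: (closure_near _ w1).
    have n1 : F1 [set k | O1 (sval k.1)] by exact: (ca1 _ nO1).
    have n2 : F1 [set k | V1 k.2.1] by exact: (v1 _ nV1).
    have n3 : nbhs m U° by exact: nbhs_interior.
    have n3' : F1 [set k | U° k.2.2] by exact: (u1 _ n3).
    move: n1 n2 n3'; apply: filterS3 => -[[c Gc] [v u]] /= O1c V1v Uu.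
    exists (c, v) => //=.
    by rewrite /preimage /= ainvK (actVK (uf_act1 hM) (uf_actM hM)).
  have clB : closure B' m'.
    apply: (closure_near _ u2).
    have n1 : F2 [set k | O2 (sval k.1)] by exact: (cb2 _ nO2).
    have n2 : F2 [set k | V2 k.2.1] by exact: (v2 _ nV2).
    have n3 : nbhs m'' W° by exact: nbhs_interior.
    have n3' : F2 ((fun k : {x : Aut | G x} * (T * M) => sval k.1 (act k.2.1 k.2.2)) @^-1` W°)
      by exact: (w2 _ n3).
    move: n1 n2 n3'; apply: filterS3 => -[[c Gc] [v u]] /= O1c V1v Uu.
    by exists (c, v).
  (* Two open sets with a common point in their closures meet. *)
  have [AB0|/set0P [y [[[c v] /= [Gc O1c V1v] Uy] [[d w] /= [Gd O2d V2w] Wy]]]] :=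
      eqVneq (A' `&` B') set0.
    have := uf_ed hM oA' oB' AB0.
    by move=> /seteqP [/(_ m' (conj clA clB))].
  exists (exist _ c Gc, (exist _ d Gd, (v, (w, act (ginv g v) (ainv c y))))).
  apply: sA; split => //=; apply: sA1; split => //=; apply: sA2; split => //=.
  apply: sA3; split => //=; apply: sA4; split => /=.
    exact: interior_subset Uy.
  rewrite (actKV (uf_act1 hM) (uf_actM hM)) ainvKV.
  exact: interior_subset Wy.
have PF : ProperFilter F by exact: ultra_proper.
have [Ca sF2] := cvg_to_prod _ _ sF.
have [Cb sF3] := cvg_to_prod _ _ sF2.
have [Cv sF4] := cvg_to_prod _ _ sF3.
have [Cw sF5] := cvg_to_prod _ _ sF4.
have [Cu Cz] := cvg_to_prod _ _ sF5.
have [e Ce] := aut_ultra_cvg hM (fun k : K => amul (sval k.2.1) (sval k.1)) UF.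
(* By [der_joint] the limit of the products differs from [amul b a] by an element of [der G], which
   lies in [L]. *)
have Le : L e.
  have Gk1 (k : K) : G (sval k.1) := svalP k.1.
  have Gk2 (k : K) : G (sval k.2.1) := svalP k.2.1.
  have := der_joint hM UF sG cG Gk1 Gk2 Ca Cb Ce.
  move=> /DL Ld; have [_ [LM _]] := sL.
  have := LM _ _ Ld (LM _ _ Lb La).
  by rewrite amulVK.
apply: (rel_N_intro (c := fun k : K => amul (sval k.2.1) (sval k.1))
   (v := fun k => gmul g k.2.2.2.1 k.2.2.1) (u := fun k => k.2.2.2.2) PF _ Le Ce _ Cu).
- by move=> k; apply: GM; exact: svalP.
- have cm : (fun k : K => gmul g k.2.2.2.1 k.2.2.1) @ F --> gmul g (gone g) (gone g).
    exact: (cvg_comp _ _ (cvg_pair2 _ Cw Cv) (cmul (gone g, gone g))).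
  by move: cm; rewrite gmul1.
- apply: cvg_trans Cz; apply: near_eq_cvg; apply: filterE => k /=.
  by rewrite (uf_actM hM) [aut_fun (sval k.1) (act k.2.2.2.1 _)]aut_act.
Qed.

Lemma rel_N_sym (G L : set Aut) m m' :
  subgroup G -> subgroup L -> closed L ->
  rel_N G L (m, m') -> rel_N G L (m', m).
Proof.
move=> [G1 [GM GV]] [L1 [LM LV]] cL N1.
have [cmul cinv] := hT.
have [F [a [[UF La] ca v u w]]] := rel_N_elim cL N1.
have PF : ProperFilter F by exact: ultra_proper.
apply: (rel_N_intro (F := F) (c := fun k => ainv (sval k.1)) (l := ainv a)
  (v := fun k => ginv g k.2.1) (u := fun k => sval k.1 (act k.2.1 k.2.2)) PF).
- by move=> k; apply: GV; exact: svalP.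
- exact: LV.
- exact: (cvg_comp _ _ ca (@ainv_continuous _ _ _ a)).
- by rewrite -{1}(ginv1 g); exact: (cvg_comp _ _ v (cinv (gone g))).
- exact: w.
- apply: cvg_trans u; apply: near_eq_cvg; apply: filterE => k /=.
  by rewrite -aut_act ainvK (actVK (uf_act1 hM) (uf_actM hM)).
Qed.

Lemma rel_N_icer (G L : set Aut) : subgroup G -> closed G -> subgroup L ->
  closed L -> der G `<=` L -> L `<=` G -> icer (rel_N G L).
Proof.
move=> sG cG sL cL DL LG; have [G1 _] := sG; have [L1 _] := sL; split.
- exact: rel_N_closed.
- move=> m; apply: rel_J_N => // U W V /= nU nW nV.
  exists (gone g), m; rewrite (uf_act1 hM); split; exact: nbhs_singleton.
- by move=> m m'; exact: rel_N_sym.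
- by move=> m m' m''; exact: rel_N_trans.
- by split; [move=> t m m'; exact: rel_N_act|exact: rel_J_N].
Qed.

Lemma icer_closure_orbit R m m' n n' : icer R -> R (m, m') ->
  closure (orbit2 act (m, m')) (n, n') -> R (n, n').
Proof.
move=> [cR _ _ _ [Ra _]] Rm; suff : closure (orbit2 act (m, m')) `<=` R by apply.
rewrite [X in _ `<=` X](closure_id _).1 //; apply: closureS.
by move=> _ [t _ <-]; exact: Ra.
Qed.

Lemma grp_one R (a : Aut) x : icer R -> R (x, a x) -> grp R a.
Proof.
move=> [cR _ _ _ [Ra _]] Rx.
have E : [set m | R (m, a m)] = setT.
  apply: (uf_min hM).
  - have cf : continuous (fun m => (m, a m)).
      by move=> m; apply: cvg_pair; [exact: cvg_id|exact: aut_cont].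
    exact: closed_preimage.
  - by exists x.
  - by move=> t m /= Rm; rewrite aut_act; exact: Ra.
by move=> m; have : [set m | R (m, a m)] m by rewrite E.
Qed.

Lemma grp_subgroup R : icer R -> subgroup (grp R).
Proof.
move=> iR; have [cR Rr Rs Rt [Ra _]] := iR; split; [|split].
- by move=> m; exact: Rr.
- by move=> a b Ga Gb m /=; exact: Rt (Gb m) (Ga (b m)).
- by move=> a Ga m; apply: Rs; have := Ga (ainv a m); rewrite ainvKV.
Qed.

(** Automorphisms tau-near [a] have graph points near [(m, a m)]; closedness of [R] gives the
    relation at [m], and [grp_one] spreads it. *)
Lemma grp_closed R : icer R -> closed (grp R).
Proof.
move=> iR; have [cR _ _ _ _] := iR => a cla.
have [m _] := uf_inh hM; apply: (grp_one (x := m) iR).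
apply: cR => B [[U W] /= [nU nW] sB].
have nb : nbhs a (box U° W°).
  apply: open_nbhs_nbhs; split; first by apply: box_open; exact: open_interior.
  by exists m.
have [b [Gb [u [Uu Wu]]]] := cla _ nb.
by exists (u, (b : Aut) u); split => //; apply: sB; split; exact: interior_subset.
Qed.

Lemma grp_mono (R R' : set (M * M)) : R `<=` R' -> grp R `<=` grp R'.
Proof. by move=> RR' a Ga m; exact: RR'. Qed.

(** For a closed subgroup [G] this is the smallest icer whose group contains [G], by [rel_K_icer],
    [rel_K_self] and [rel_K_sub]. *)
Definition rel_K (G : set Aut) := rel_N G G.

Lemma rel_K_icer G : subgroup G -> closed G -> icer (rel_K G).
Proof. by move=> sG cG; apply: rel_N_icer => //; exact: der_sub. Qed.

Lemma rel_K_self G (a : Aut) x : G a -> rel_K G (x, a x).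
Proof.
move=> Ga U W V O /= nU nW nV oO GO.
exists a, (gone g), x; rewrite (uf_act1 hM); split; try exact: nbhs_singleton.
by split => //; exact: GO.
Qed.

Lemma rel_K_sub G R : closed G -> icer R -> G `<=` grp R -> rel_K G `<=` R.
Proof.
move=> cG iR GR [m m'] Km; have [cR _ _ Rt [_ RJ]] := iR.
have [F [a [[UF La] ca v u w]]] := rel_N_elim cG Km.
have PF : ProperFilter F by exact: ultra_proper.
have [m1 vum] := ultra_cvg
  (fun k : {x : Aut | G x} * (T * M) => act k.2.1 k.2.2) (uf_compact hM) UF.
have J1 : rel_J (m, m1) by exact: rel_J_intro PF v u vum.
apply: Rt (RJ _ J1) _.
apply: (closed_cvg_mem PF cR _ (cvg_pair2 _ vum w)).
by apply: filterE => k; apply: GR; exact: svalP.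
Qed.

Lemma rel_N_sub_K G L L' : L `<=` L' -> rel_N G L `<=` rel_N G L'.
Proof.
move=> LL p Np U W V O nU nW nV oO LO; apply: Np => //.
exact: subset_trans LO.
Qed.

Lemma rel_N_mono (G G' L : set Aut) : G `<=` G' -> rel_N G L `<=` rel_N G' L.
Proof.
move=> GG p Np U W V O nU nW nV oO LO.
have [c [v [u [[Gc Oc] ? ? ?]]]] := Np U W V O nU nW nV oO LO.
by exists c, v, u; split => //; split => //; exact: GG.
Qed.

(** The net behind the pair tends to some [l] in [L]. Its factor [v] shifts the base point [x] to a
    [rel_J]-related [x1], and [R0] bounds this shift by an automorphism [j] in [L]. The net then
    also tends to [amul a (ainv j)], and its two limits differ by [der G], inside [L]. *)
Lemma rel_N_aut G L R0 (a : Aut) x : subgroup G -> closed G -> subgroup L ->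
  closed L -> der G `<=` L -> L `<=` G -> icer R0 -> grp R0 `<=` L ->
  rel_N G L (x, a x) -> L a.
Proof.
move=> sG cG sL cL DL LG iR0 R0L Nx; have [L1 [LM LV]] := sL.
have [cR0 _ _ _ [_ R0J]] := iR0.
have [F [l [[UF Ll] cl v u w]]] := rel_N_elim cL Nx.
have PF : ProperFilter F by exact: ultra_proper.
have [x1 vux] := ultra_cvg
  (fun k : {x : Aut | G x} * (T * M) => act k.2.1 k.2.2) (uf_compact hM) UF.
have J1 : rel_J (x, x1) by exact: rel_J_intro PF v u vux.
have [z [j clj]] := uf_pair hM x x1.
have Lj : L j.
  apply/R0L/(grp_one (x := z) iR0).
  exact: icer_closure_orbit iR0 (R0J _ J1) clj.
have cr : (fun k : {x : Aut | G x} * (T * M) => sval k.1) @ F --> amul a (ainv j).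
  apply: (tau_cvg_pair hM _ vux w (x := j z)).
  rewrite /= ainvK.
  exact: (closure_orbit_swap (e := a) clj).
have Gr : G (amul a (ainv j)).
  by apply: (closed_cvg_mem PF cG _ cr); apply: filterE => k; exact: svalP.
have : der G (amul (amul a (ainv j)) (ainv l)).
  apply: (der_of_cvg2 PF sG _ Gr (LG _ Ll) cr cl).
  by apply: filterE => k; exact: svalP.
move=> /DL Ld; have := LM _ _ (LM _ _ Ld Ll) Lj.
by rewrite !amulVK.
Qed.

(** Proximality of the extension from the quotient by [R'] to that by [R], read on [M]; see
    [qlift_proximal]. *)
Definition prox_rel (R' R : set (M * M)) : Prop := forall m m', R (m, m') ->
  exists n n', closure (orbit2 act (m, m')) (n, n') /\ R' (n, n').

(** Almost periodicity of the same extension, read on [M]: a diagonal limit in the quotient becomes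
    a pair [(n, n')] of [R']; see [qlift_ap]. *)
Definition ap_rel (R' R : set (M * M)) : Prop := forall m m' n n', R' (n, n') ->
  (forall U1 W1 U2 W2, nbhs m U1 -> nbhs m' W1 -> nbhs n U2 -> nbhs n' W2 ->
    exists p p' t, [/\ R (p, p'), U1 p, W1 p', U2 (act t p) & W2 (act t p')]) ->
  R' (m, m').

Lemma rel_K_prox R : icer R -> prox_rel (rel_K (grp R)) R.
Proof.
move=> iR m m' Rm; have [x [r clr]] := uf_pair hM m m'.
exists x, (r x); split => //; apply: rel_K_self.
by apply: (grp_one (x := x) iR); exact: icer_closure_orbit clr.
Qed.

(** Pairs of [rel_K G] near [(m, m')] are approximated by graph points of some [c] in [G], and
    translation by [t] keeps them on the graph of [c]. The translates tend to [(n, n')], which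
    forces [c] to converge into [L]. With such a limit, [(m, m')] is itself a pair of
    [rel_N G L]. *)
Lemma rel_N_ap G L R0 : subgroup G -> closed G -> subgroup L ->
  closed L -> der G `<=` L -> L `<=` G -> icer R0 -> grp R0 `<=` L ->
  ap_rel (rel_N G L) (rel_K G).
Proof.
move=> sG cG sL cL DL LG iR0 R0L m m' n n' Nn ex.
have iN : icer (rel_N G L) by exact: rel_N_icer.
have [_ _ Ns Nt [_ NJ]] := iN.
pose K := ({x : Aut | G x} * (T * (T * M)))%type.
pose c (k : K) := sval k.1.
pose t (k : K) := k.2.1.
pose v (k : K) := k.2.2.1.
pose u (k : K) := k.2.2.2.
(* The translate of [act v u] by [t] is this conjugate acting on [act t u]; [v] and the conjugate
   must both tend to the unit. *)
pose cj (k : K) := gmul g (gmul g (t k) (v k)) (ginv g (t k)).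
pose f k := (v k, (cj k, (u k, (c k (act (v k) (u k)), (act (t k) (u k),
  act (t k) (c k (act (v k) (u k)))))))).
have FG : Filter (filter_prod (nbhs (gone g)) (filter_prod (nbhs (gone g))
   (filter_prod (nbhs m) (filter_prod (nbhs m')
     (filter_prod (nbhs n) (nbhs n')))))).
  by do 4 (apply: filter_prod_filter).
have [|F [UF sF]] := @ultra_lift _ _ f _ FG.
  move=> A [[V1 A1] /= [nV1 [[V2 A2] /= [nV2 [[U1 A3] /= [nU1 [[W1 A4] /= [nW1
    [[U2 W2] /= [nU2 nW2] sA4]] sA3]] sA2]] sA1]] sA].
  have [p [p' [s [Kp U1p W1p U2p W2p]]]] := ex _ _ _ _
    (nbhs_interior nU1) (nbhs_interior nW1) (nbhs_interior nU2) (nbhs_interior nW2).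
  have nU : nbhs p (U1 `&` (act s @^-1` U2)).
    by apply: filterI => //; apply: (uf_cont hM).
  have nW : nbhs p' (W1 `&` (act s @^-1` W2)).
    by apply: filterI => //; apply: (uf_cont hM).
  have nV' := conj_nbhs s nV2.
  have [c0 [v0 [u0 [[Gc0 _] [V1v V2v] [U1u U2u] [W1u W2u]]]]] :=
    Kp _ _ _ setT nU nW (filterI nV1 nV') openT (@subsetT _ _).
  exists (exist _ c0 Gc0, (s, (v0, u0))).
  apply: sA; split => //=; apply: sA1; split => //=; apply: sA2; split => //=.
  by apply: sA3; split => //=; apply: sA4; split => /=.
have PF : ProperFilter F by exact: ultra_proper.
have FF : Filter F by exact: filter_filter.
have [Cv sF2] := cvg_to_prod _ _ sF.
have [Cj sF3] := cvg_to_prod _ _ sF2.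
have [Cu sF4] := cvg_to_prod _ _ sF3.
have [Cw sF5] := cvg_to_prod _ _ sF4.
have [Ctu Ctw] := cvg_to_prod _ _ sF5.
have [n1 Cn1] := ultra_cvg (fun k => act (t k) (act (v k) (u k))) (uf_compact hM) UF.
have J1 : rel_J (n, n1).
  apply: (rel_J_intro PF Cj Ctu).
  apply: cvg_trans Cn1; apply: near_eq_cvg; apply: filterE => k /=.
  by rewrite /cj !(uf_actM hM) (actVK (uf_act1 hM) (uf_actM hM)).
have Nn1 : rel_N G L (n1, n') by apply: Nt (Ns _ _ (NJ _ J1)) Nn.
have [x [r clr]] := uf_pair hM n1 n'.
have Lr : L r.
  apply: (rel_N_aut (x := x) sG cG sL cL DL LG iR0 R0L).
  exact: icer_closure_orbit iN Nn1 clr.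
have Cc : c @ F --> r.
  apply: (tau_cvg_pair hM FF Cn1 _ clr).
  apply: cvg_trans Ctw; apply: near_eq_cvg; apply: filterE => k /=.
  by rewrite /c [aut_fun (sval k.1) (act (t k) _)]aut_act.
apply: (rel_N_intro PF _ Lr Cc Cv Cu Cw).
by move=> k; exact: svalP.
Qed.

(** * One step of the tower *)

Section Step.
Variables RX RY : set (M * M).
Hypothesis iX : icer RX.
Hypothesis perfX : forall S : set Aut, subgroup S -> closed S -> S `<=` grp RY ->
  S `<=` der S -> S `<=` grp RX.
Local Notation H := (grp RX).

(* If [R = rel_K G] and [G = der G * H], a minimal closed [S] with [G = S * H] is
   perfect, so [G = H]. *)
Lemma icer_step R : icer R -> rel_K H `<=` R -> R `<=` RY -> R <> rel_K H ->
  exists R', [/\ icer R', rel_K H `<=` R', R' `<=` R, R' <> R &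
    prox_rel R' R \/ ap_rel R' R].
Proof.
move=> iR KR RRY RK; pose G := grp R.
have sG : subgroup G by exact: grp_subgroup.
have cG : closed G by exact: grp_closed.
have sH : subgroup H by exact: grp_subgroup.
have cH : closed H by exact: grp_closed.
have HG : H `<=` G by move=> a Ha m; apply: KR; exact: rel_K_self.
have KHG : rel_K H `<=` rel_K G.
  by move=> p /(rel_N_mono HG) /(rel_N_sub_K HG).
have KGR : rel_K G `<=` R by exact: rel_K_sub.
have [E|NE] := pselect (rel_K G = R); last first.
  exists (rel_K G); split => //; first exact: rel_K_icer.
  by left; exact: rel_K_prox.
pose L := [set a | exists d h, [/\ der G d, H h & a = amul d h]].
have sL : subgroup L by exact: der_prod_subgroup.
have cL : closed L by exact: (der_prod_closed hM).
have DL : der G `<=` L.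
  by move=> d Dd; exists d, aone; split => //; [case: sH|rewrite amulr1].
have HL : H `<=` L.
  move=> h Hh; exists aone, h; split => //; last by rewrite amul1.
  by case: (der_subgroup sG).
have LG : L `<=` G.
  move=> _ [d [h [/der_sub Gd Hh ->]]]; have [_ [GM _]] := sG.
  by apply: GM => //; exact: HG.
have [GL|nGL] := pselect (G `<=` L).
  have [S [sS cS SG SD GSH]] := perfect_factor hM sG cG sH cH GL.
  have SH : S `<=` H.
    apply: perfX => //; apply: subset_trans SG _; exact: grp_mono.
  case: RK; rewrite -E; congr rel_K; apply/seteqP; split => // a Ga.
  have [s [h [Ss Hh ->]]] := GSH a Ga.
  by case: sH => _ [HM _]; apply: HM => //; exact: SH.
have [a [Ga nLa]] : exists a, G a /\ ~ L a.
  by apply: contrapT => ne; apply: nGL => a Ga; apply: contrapT => nL; apply: ne; exists a.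
have iN : icer (rel_N G L) by exact: rel_N_icer.
exists (rel_N G L); split => //.
- by move=> p /(rel_N_mono HG) /(rel_N_sub_K HL).
- by rewrite -E; exact: rel_N_sub_K.
- move=> NR; apply: nLa; have [m _] := uf_inh hM.
  apply: (rel_N_aut (x := m) sG cG sL cL DL LG iX HL).
  by rewrite NR; exact: Ga.
- by right; rewrite -E; exact: rel_N_ap iX HL.
Qed.

End Step.
End Relations.

Lemma bigcap_member (A : Type) (Fam : set (set A)) C :
  Fam C -> \bigcap_(B in Fam) B `<=` C.
Proof. by move=> FC x; apply. Qed.

(** * Transfinite descending towers of sets *)

Lemma eq_exist_val (A : Type) (P : A -> Prop) (a b : {x | P x}) :
  sval a = sval b -> a = b.
Proof. by case: a b => [a pa] [b pb] /= ab; exact: eq_exist. Qed.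

Section Tower.
Variables (A : Type) (f : set A -> set A) (top : set A).
Hypothesis f_sub : forall B, f B `<=` B.

(** Transfinite iteration of [f] without ordinals, as in [stage]: intersections stand for limit
    steps. The Bourbaki-Witt argument below shows that reverse inclusion well-orders the family. *)
Inductive tower : set A -> Prop :=
| tower0 : tower top
| towerS B : tower B -> tower (f B)
| towerI (Fam : set (set A)) : Fam !=set0 -> (forall B, Fam B -> tower B) ->
    tower (\bigcap_(B in Fam) B).

Lemma tower_top B : tower B -> B `<=` top.
Proof.
elim=> [|C _ sC|Fam [C FC] _ sF]; first exact: subset_refl.
  by move=> x /f_sub /sC.
by move=> x /(_ C FC) /(sF C FC).
Qed.

(** The extreme elements of the Bourbaki-Witt argument: on the way down, [f] never jumps past
    [B]. *)
Let extreme B := forall C, tower C -> B `<=` C -> B <> C -> B `<=` f C.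

Lemma extreme_dichotomy B C : tower B -> extreme B -> tower C ->
  C `<=` f B \/ B `<=` C.
Proof.
move=> tB eB; elim=> [|D tD [Df|BD]|Fam nF tF IH].
- by right; exact: tower_top.
- by left; exact: (subset_trans (@f_sub _) Df).
- have [->|/eqP nBD] := eqVneq B D; first by left.
  by right; exact: eB.
- have [[D [FD Df]]|nF'] := pselect (exists D, Fam D /\ D `<=` f B).
    by left; apply: subset_trans Df; exact: bigcap_member.
  right; apply: sub_bigcap => D FD.
  by case: (IH D FD) => // Df; case: nF'; exists D.
Qed.

Lemma tower_extreme B : tower B -> extreme B.
Proof.
elim=> [|C tC eC|Fam nF tF IH] D tD.
- by move=> sD []; apply/seteqP; split => //; exact: tower_top.
- move=> fCD nCD; have [DfC|CD] := extreme_dichotomy tC eC tD.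
    by case: nCD; apply/seteqP.
  have [->//|/eqP nCD'] := eqVneq C D.
  exact: (subset_trans (@f_sub _) (eC _ tD CD nCD')).
- move=> FD nFD.
  have [C [FC nDC]] : exists C, Fam C /\ ~ D `<=` C.
    apply: contrapT => nC; apply: nFD; apply/seteqP; split => //.
    apply: sub_bigcap => C FC; apply: contrapT => nDC.
    by apply: nC; exists C.
  have [DC|CD] := extreme_dichotomy (tF _ FC) (IH _ FC) tD.
    by case: nDC; exact: (subset_trans DC (@f_sub _)).
  apply: subset_trans (bigcap_member FC) _; apply: (IH _ FC _ tD CD) => CDE.
  by apply: nDC; rewrite CDE.
Qed.

Lemma tower_dichotomy B C : tower B -> tower C -> C `<=` f B \/ B `<=` C.
Proof. by move=> tB tC; exact: extreme_dichotomy tB (tower_extreme tB) tC. Qed.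

Lemma tower_total B C : tower B -> tower C -> B `<=` C \/ C `<=` B.
Proof.
move=> tB tC; case: (tower_dichotomy tB tC); last by left.
by move=> CB; right; exact: (subset_trans CB (@f_sub _)).
Qed.

Lemma tower_fixed B C : tower B -> f B = B -> tower C -> B `<=` C.
Proof.
move=> tB fB; elim=> [|D tD BD|Fam nF tF IH]; first exact: tower_top.
- have [<-|/eqP nBD] := eqVneq B D; first by rewrite fB.
  exact: tower_extreme.
- exact: sub_bigcap.
Qed.

Lemma tower_largest (P : set (set A)) : P !=set0 -> (forall B, P B -> tower B) ->
  exists B, P B /\ forall C, P C -> C `<=` B.
Proof.
move=> [B0 PB0] tP.
pose U := [set C | tower C /\ forall B, P B -> B `<=` C].
pose c := \bigcap_(C in U) C.
have tc : tower c.
  apply: towerI => [|C []//]; exists top; split; first exact: tower0.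
  by move=> B /tP; exact: tower_top.
have Pc B : P B -> B `<=` c by move=> PB; apply: sub_bigcap => C [_]; apply.
have [Pcc|nPc] := pselect (P c); first by exists c.
(* [c] is the least upper bound of [P] in the tower. If it is not in [P], all members of [P] are
   strictly below it, so [f c] is an upper bound too and equals [c]; but a fixed member lies below
   the whole tower, whence [B0 = c]. *)
have fc : f c = c.
  apply/seteqP; split; first exact: f_sub.
  apply: bigcap_member; split; first exact: towerS.
  move=> B PB; apply: (tower_extreme (tP _ PB) tc); first exact: Pc.
  by move=> Bc; apply: nPc; rewrite -Bc.
case: nPc; suff <- : B0 = c by [].
apply/seteqP; split; first exact: Pc.
exact: tower_fixed tc fc (tP _ PB0).
Qed.

Definition tower_lt (a b : {B | tower B}) :=
  sval b `<=` sval a /\ sval b <> sval a.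

Lemma tower_wf : wf_order tower_lt.
Proof.
split; [|split; [|split]].
- move=> a b c [ba nba] [cb ncb]; split; first exact: (subset_trans cb ba).
  by move=> ca; apply: nba; apply/seteqP; split => //; rewrite -ca.
- by move=> a [].
- move=> a b; have [ab|nab] := pselect (sval a = sval b).
    by left; exact: eq_exist_val ab.
  case: (tower_total (svalP a) (svalP b)) => H; right; [right|left]; split => //.
  by move=> ba; apply: nab.
- move=> [B0 tB0]; apply: contrapT => na.
  pose P := [set B | exists pB : tower B, ~ Acc tower_lt (exist _ B pB)].
  have [|B [pB _]//|B [[pB nB] maxB]] := @tower_largest P.
    by exists B0, tB0.
  apply: nB; constructor => -[C tC] [/= BC nBC].
  apply: contrapT => nC; apply: nBC; apply/seteqP; split => //.
  by apply: maxB; exists tC.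
Qed.

Lemma tower_succ (a b : {B | tower B}) : f (sval a) <> sval a ->
  succ_of tower_lt a b -> sval b = f (sval a).
Proof.
move=> nfa [[ba nba] least].
have [/(congr1 sval) <- //|[/= fb nfb]] :
    exist _ _ (towerS (svalP a)) = b \/ tower_lt b (exist _ _ (towerS (svalP a))).
  by apply: least; split => //=; exact: f_sub.
have [bf|ab] := tower_dichotomy (svalP a) (svalP b).
  by apply/seteqP.
by case: nba; apply/seteqP.
Qed.

(** The intersection of the earlier stages is a stage; were it strictly larger than [l], then [l]
    would be its successor. *)
Lemma tower_limit (o0 l : {B | tower B}) : sval o0 = top ->
  limit_of tower_lt o0 l ->
  sval l = \bigcap_(B in [set B | exists2 a, tower_lt a l & sval a = B]) B.
Proof.
move=> o0E [lo nl]; set Fam := [set B | _].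
have F0 : Fam !=set0.
  exists top; exists o0 => //; split; rewrite o0E; first exact: tower_top (svalP l).
  by move=> lE; apply: lo; apply: eq_exist_val; rewrite lE.
have tF B : Fam B -> tower B by move=> [a _ <-]; exact: svalP a.
have tI : tower (\bigcap_(B in Fam) B) by exact: towerI.
have lI : sval l `<=` \bigcap_(B in Fam) B.
  by apply: sub_bigcap => _ [a [la _] <-].
apply: contrapT => nE; apply: nl; exists (exist _ _ tI); split; first by split.
move=> c [/= cI ncI].
have [lc|nlc] := pselect (sval l = sval c).
  by left; apply: eq_exist_val.
have [cl|lc] := tower_total (svalP c) (svalP l).
  by right; split => // cE; apply: nlc.
case: ncI; apply/seteqP; split => //; apply: bigcap_member.
by exists c.
Qed.

Lemma tower_least : exists th : {B | tower B}, f (sval th) = sval th /\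
  forall a, a = th \/ tower_lt a th.
Proof.
pose c := \bigcap_(C in tower) C.
have tc : tower c by apply: towerI => //; exists top; exact: tower0.
exists (exist _ c tc); split => /=.
  apply/seteqP; split; first exact: f_sub.
  by apply: bigcap_member; exact: towerS.
move=> a; have [ac|ac] := pselect (sval a = c).
  by left; apply: eq_exist_val.
right; split => /=; first by apply: bigcap_member; exact: svalP a.
by move=> ca; apply: ac.
Qed.

End Tower.


(** * Quotient flows *)

Lemma compact_closed_nbhs (Z : topologicalType) (x : Z) (O : set Z) :
  hausdorff_space Z -> compact [set: Z] -> nbhs x O ->
  exists2 B, nbhs x B & closure B `<=` O.
Proof.
move=> hZ cZ nO.
by have [B nB BO] := compact_regular hZ cZ (@filterT _ _ _) nO; exists B.
Qed.

Lemma compact_to_hausdorff_closed (S Z : topologicalType) (f : S -> Z) (C : set S) :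
  compact [set: S] -> hausdorff_space Z -> continuous f -> closed C ->
  closed (f @` C).
Proof.
move=> cS hZ cf cC; apply: compact_closed => //; apply: continuous_compact.
  exact: continuous_subspaceT.
by apply: subclosed_compact cC cS _.
Qed.

Section Quot.
Local Open Scope quotient_scope.
Variables (M : topologicalType) (R : set (M * M)).

(* Points are identified when their [R]-classes agree, which is an equivalence
   for every [R] and coincides with [R] when [R] is one. *)
Definition qrel : rel M := fun x y => `[< forall z, R (x, z) <-> R (y, z) >].

Lemma qrel_refl : reflexive qrel.
Proof. by move=> x; apply/asboolP. Qed.
Lemma qrel_sym : symmetric qrel.
Proof.
by move=> x y; apply/asboolP/asboolP => H z; split => /H.
Qed.
Lemma qrel_trans : transitive qrel.
Proof.
move=> y x z /asboolP xy /asboolP yz; apply/asboolP => w.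
by split => [/xy/yz|/yz/xy].
Qed.
Definition qequiv := EquivRel qrel qrel_refl qrel_sym qrel_trans.
Definition quot : topologicalType := quotient_topology {eq_quot qequiv}.
Definition qpi (m : M) : quot := \pi_{eq_quot qequiv} m.
Definition qrepr (q : quot) : M := repr (q : {eq_quot qequiv}).

Lemma qreprK : cancel qrepr qpi.
Proof. by move=> q; exact: reprK. Qed.

Lemma qpi_cont : continuous qpi.
Proof. exact: (@pi_continuous M {eq_quot qequiv}). Qed.

Lemma quot_cont (Z : topologicalType) (f : quot -> Z) :
  continuous (f \o qpi) -> continuous f.
Proof. by move=> cf; apply/(@quotient_continuous M {eq_quot qequiv}). Qed.

Lemma quot_open (U : set quot) : open (qpi @^-1` U) -> open U.
Proof. by []. Qed.

Hypothesis R_refl : forall m, R (m, m).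
Hypothesis R_sym : forall m m', R (m, m') -> R (m', m).
Hypothesis R_trans : forall m m' m'', R (m, m') -> R (m', m'') -> R (m, m'').

Lemma qpiP x y : qpi x = qpi y <-> R (x, y).
Proof.
split => [/eqmodP /asboolP H|Rxy]; first by apply: R_sym; apply/H.
apply/eqmodP/asboolP => z; split => H; last exact: R_trans H.
by apply: R_trans H; exact: R_sym.
Qed.

Lemma qrepr_rel m : R (qrepr (qpi m), m).
Proof. by apply/qpiP; rewrite qreprK. Qed.

Hypothesis cM : compact [set: M].
Hypothesis hM : hausdorff_space M.
Hypothesis cR : closed R.

Lemma quot_compact : compact [set: quot].
Proof.
have -> : [set: quot] = qpi @` setT.
  by apply/seteqP; split => // q _; exists (qrepr q) => //; exact: qreprK.
by apply: continuous_compact => //; apply: continuous_subspaceT; exact: qpi_cont.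
Qed.

Lemma saturation_closed (C : set M) : closed C ->
  closed [set x | exists2 c, C c & R (x, c)].
Proof.
move=> cC.
have -> : [set x | exists2 c, C c & R (x, c)] = fst @` (R `&` (snd @^-1` C)).
  apply/seteqP; split => [x [c Cc Rc]|_ [[x c] [Rc Cc] <-]]; last by exists c.
  by exists (x, c).
apply: compact_to_hausdorff_closed => //.
- by rewrite -setXTT; apply: compact_setX.
- by move=> z; exact: cvg_fst.
- by apply: closedI => //; apply: closed_preimage => // z; exact: cvg_snd.
Qed.

(** Otherwise some closed neighbourhood of [m] misses the class of [q]. Its saturation is closed, so
    the complement gives a neighbourhood of [q] whose representatives stay away from [m]. *)
Lemma quot_lim (F : set_system quot) q m : UltraFilter F -> F --> q ->
  qrepr @ F --> m -> q = qpi m.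
Proof.
move=> UF Fq Fm; apply: contrapT => nq.
have PF : ProperFilter F by exact: ultra_proper.
have nR : ~ R (qrepr q, m) by move=> /qpiP; rewrite qreprK.
have cls : closed [set x | R (qrepr q, x)].
  have cf : continuous (fun x : M => (qrepr q, x)).
    by apply: pair_continuous; [exact: cst_cont|exact: id_cont].
  exact: (closed_preimage cf cR).
have [B nB BO] := compact_closed_nbhs hM cM (open_nbhs_nbhs (conj (closed_openC cls) nR)).
pose S := [set x | exists2 c, closure B c & R (x, c)].
have cS : closed S by apply: saturation_closed; exact: closed_closure.
have nSq : nbhs q (qrepr @^-1` (~` S)).
  apply: open_nbhs_nbhs; split.
    apply: quot_open.
    have -> : qpi @^-1` (qrepr @^-1` (~` S)) = ~` S.
      apply/seteqP; split => x nS [c Bc Rc]; apply: nS; exists c => //.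
        by apply: R_trans Rc; exact: qrepr_rel.
      by apply: R_trans Rc; apply: R_sym; exact: qrepr_rel.
    exact: closed_openC.
  by move=> [c /BO].
have F1 : F (qrepr @^-1` (~` S)) by exact: Fq.
have F2 : F (qrepr @^-1` B) by exact: Fm.
have [k [nS Bk]] := filter_meet PF F1 F2.
by apply: nS; exists (qrepr k); [exact: subset_closure|exact: R_refl].
Qed.

Lemma quot_hausdorff : hausdorff_space quot.
Proof.
move=> q1 q2 cl.
have FG : Filter (filter_prod (nbhs q1) (nbhs q2)) by exact: filter_prod_filter.
have [|F [UF sF]] := @ultra_lift _ _ (fun q : quot => (q, q)) _ FG.
  move=> A [[B1 B2] /= [nB1 nB2] sA].
  by have [q [B1q B2q]] := cl _ _ nB1 nB2; exists q; apply: sA.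
have [F1 F2] := cvg_to_prod _ _ sF.
have [m Fm] := ultra_cvg qrepr cM UF.
by rewrite (quot_lim UF F1 Fm) (quot_lim UF F2 Fm).
Qed.

End Quot.

Section QuotFlow.
Variables (T : topologicalType) (g : group_law T) (M : topologicalType) (act : T -> M -> M).
Hypothesis hT : topgroup g.
Hypothesis hM : universal_flow g act.

Definition qact (R : set (M * M)) (t : T) (q : quot R) : quot R :=
  qpi R (act t (qrepr q)).

Section One.
Variable R : set (M * M).
Hypothesis iR : icer g act R.

Lemma icer_qpiP x y : qpi R x = qpi R y <-> R (x, y).
Proof. by have [_ rR sR tR _] := iR; exact: qpiP. Qed.

Lemma qact_pi t m : qact t (qpi R m) = qpi R (act t m).
Proof.
have [_ rR sR tR [aR _]] := iR; apply/icer_qpiP; apply: aR.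
exact: qrepr_rel.
Qed.

Lemma icer_quot_hausdorff : hausdorff_space (quot R).
Proof.
have [cR rR sR tR _] := iR.
exact: quot_hausdorff rR sR tR (uf_compact hM) (uf_hausdorff hM) cR.
Qed.

Lemma quot_flow : is_flow g (@qact R).
Proof.
have [cR rR sR tR [aR JR]] := iR; have [cmul cinv] := hT.
split; first by move=> q; rewrite /qact (uf_act1 hM) qreprK.
split.
  move=> s t q; rewrite -[q]qreprK !qact_pi; congr qpi; exact: (uf_actM hM).
move=> [t0 q0]; apply: ultra_continuous => F UF Fq /=.
have F1 : fst @ F --> t0 := cvg_comp _ _ Fq (@fst_cont _ _ (t0, q0)).
have F2 : snd @ F --> q0 := cvg_comp _ _ Fq (@snd_cont _ _ (t0, q0)).
have PF : ProperFilter F by exact: ultra_proper.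
have [m Fm] := ultra_cvg (fun p : T * quot R => qrepr p.2) (uf_compact hM) UF.
have [m' Fm'] := ultra_cvg (fun p : T * quot R => act p.1 (qrepr p.2)) (uf_compact hM) UF.
have Fm1 : (fun p : T * quot R => qpi R (qrepr p.2)) @ F --> qpi R m.
  exact: (cvg_comp _ _ Fm (@qpi_cont _ R m)).
have q0E : q0 = qpi R m.
  have E : (fun p : T * quot R => qpi R (qrepr p.2)) = snd.
    by apply: funext => p; exact: qreprK.
  rewrite E in Fm1.
  exact: (lim_unique icer_quot_hausdorff PF F2 Fm1).
(* As this product tends to the unit, [m] and [act (ginv g t0) m'] are [rel_J]-related and hence
   [R]-related; this is where joint continuity for the topology of [T] is gained. *)
have v1 : (fun p : T * quot R => gmul g (ginv g t0) p.1) @ F --> gone g.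
  rewrite -(gmulV g t0).
  exact: (cvg_comp _ _ (cvg_pair2 _ (cvg_cst (ginv g t0)) F1) (cmul (ginv g t0, t0))).
have w1 : (fun p : T * quot R => act (gmul g (ginv g t0) p.1) (qrepr p.2)) @ F
    --> act (ginv g t0) m'.
  have -> : (fun p : T * quot R => act (gmul g (ginv g t0) p.1) (qrepr p.2)) =
      act (ginv g t0) \o (fun p => act p.1 (qrepr p.2)).
    by apply: funext => p /=; rewrite (uf_actM hM).
  exact: (cvg_comp _ _ Fm' (uf_cont hM (t := ginv g t0) (x := m'))).
have Rm : R (m, act (ginv g t0) m').
  by apply: JR; exact: rel_J_intro PF v1 Fm w1.
have -> : qact t0 q0 = qpi R m'.
  rewrite q0E qact_pi; apply/icer_qpiP.
  by have := aR t0 _ _ Rm; rewrite (actKV (uf_act1 hM) (uf_actM hM)).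
exact: (cvg_comp _ _ Fm' (@qpi_cont _ R m')).
Qed.

Lemma quot_min_cflow : min_cflow g (@qact R).
Proof.
have [cR rR sR tR [aR JR]] := iR.
split.
  split; first exact: quot_flow.
  split; last exact: icer_quot_hausdorff.
  exact: quot_compact (uf_compact hM).
move=> A cA [q Aq] iA.
have E : qpi R @^-1` A = setT.
  apply: (uf_min hM).
  - by apply: closed_preimage cA; exact: qpi_cont.
  - by exists (qrepr q); rewrite /preimage /= qreprK.
  - by move=> t m /= Am; rewrite -qact_pi; exact: iA.
apply/seteqP; split => // p _; rewrite -[p]qreprK.
by have : (qpi R @^-1` A) (qrepr p) by rewrite E.
Qed.

Section Map.
Variables (Z : topologicalType) (actZ : T -> Z -> Z) (f : M -> Z).
Hypothesis cf : continuous f.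
Hypothesis sf : forall z, exists m, f m = z.
Hypothesis ef : forall t m, f (act t m) = actZ t (f m).
Hypothesis Rf : forall m m', R (m, m') -> f m = f m'.

Definition qlift (q : quot R) : Z := f (qrepr q).

Lemma qlift_pi m : qlift (qpi R m) = f m.
Proof. by have [_ rR sR tR _] := iR; apply: Rf; exact: qrepr_rel. Qed.

Lemma qlift_ext : ext (@qact R) actZ qlift.
Proof.
split.
  apply: quot_cont.
  have -> // : qlift \o qpi R = f by apply/funext => m; exact: qlift_pi.
split; first by move=> z; have [m <-] := sf z; exists (qpi R m); exact: qlift_pi.
by move=> t q; rewrite -[q]qreprK qact_pi !qlift_pi ef.
Qed.

Lemma qlift_proximal : prox_rel act R [set p | f p.1 = f p.2] ->
  proximal_ext (@qact R) qlift.
Proof.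
move=> pr [q q']; rewrite /Rpi /= -[q]qreprK -[q']qreprK !qlift_pi => fq.
have [n [n' [cl Rn]]] := pr _ _ fq.
exists (qpi R n, qpi R n'); split; last exact/icer_qpiP.
apply: (closure_map (f := fun p : M * M => (qpi R p.1, qpi R p.2)) _ _ cl).
  apply: pair_continuous; apply: (comp_cont _ (@qpi_cont _ R)).
    exact: fst_cont.
  exact: snd_cont.
by move=> _ [t _ <-]; exists t => //; rewrite /act2 /= !qact_pi.
Qed.

Lemma qlift_ap : ap_rel act R [set p | f p.1 = f p.2] ->
  ap_ext (@qact R) qlift.
Proof.
move=> ap [x [x' [fx [nx near]]]]; apply: nx.
have [cR rR sR tR [aR JR]] := iR.
(* The diagonal limit given by [near] depends on [U] and [V]; compactness of the quotient supplies
   one [w] for all of them. *)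
pose Fam := [set UV : set (quot R) * set (quot R) | nbhs x UV.1 /\ nbhs x' UV.2].
pose Cl (UV : set (quot R) * set (quot R)) :=
  [set w : quot R | closure (Tset (@qact R) ((UV.1 `*` UV.2) `&` Rpi qlift)) (w, w)].
have PF : ProperFilter (filter_from Fam Cl).
  apply: filter_from_proper; last first.
    move=> [U V] [/= nU nV]; have [[w w'] [cl ww]] := near U V nU nV.
    by exists w; move: cl; rewrite -[w']/((w, w').2) -ww.
  apply: filter_from_filter; first by exists (setT, setT); split; exact: filterT.
  move=> [U V] [U' V'] [/= nU nV] [/= nU' nV']; exists (U `&` U', V `&` V').
    by split; exact: filterI.
  move=> w cl; split; apply: closureS cl => _ [t [p [[[Up Vp] fp] ->]]].
    by exists t, p; split => //; split => //; case: Up; case: Vp.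
  by exists t, p; split => //; split => //; case: Up; case: Vp.
have [F0 [UF0 sF0]] := ultraFilterLemma PF.
have PF0 : ProperFilter F0 by exact: ultra_proper.
have [w F0w] := ultra_cvg id (@quot_compact _ R (uf_compact hM)) UF0.
have clw U V : nbhs x U -> nbhs x' V -> Cl (U, V) w.
  move=> nU nV.
  have cw : closed (Cl (U, V)).
    have cf2 : continuous (fun w : quot R => (w, w)).
      by apply: pair_continuous; exact: id_cont.
    exact: (closed_preimage cf2 (@closed_closure _ _)).
  apply: (closed_cvg_mem PF0 cw _ F0w).
  by apply: sF0; exists (U, V).
(* [ap] speaks of points of [M], so the pairs and their translates are lifted there along one
   ultrafilter. *)
pose K := (T * (M * M))%type.
pose K' := {k : K | f k.2.1 = f k.2.2}.
pose h (k : K') := (qpi R (sval k).2.1, (qpi R (sval k).2.2,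
  (qpi R (act (sval k).1 (sval k).2.1), qpi R (act (sval k).1 (sval k).2.2)))).
have FG : Filter (filter_prod (nbhs x) (filter_prod (nbhs x') (filter_prod (nbhs w) (nbhs w)))).
  by do 2 (apply: filter_prod_filter).
have [|F [UF sF]] := @ultra_lift _ _ h _ FG.
  move=> A [[U A1] /= [nU [[V A2] /= [nV [[W W'] /= [nW nW'] sA2]] sA1]] sA].
  have nWW : nbhs (w, w) (W `*` W') by exists (W, W').
  have [[a b] [[t [[p p'] [[[/= Up Vp'] fp] [-> ->]]]] [/= Wa Wb]]] := clw U V nU nV _ nWW.
  have fp' : f (qrepr p) = f (qrepr p') by [].
  have kP : f (t, (qrepr p, qrepr p')).2.1 = f (t, (qrepr p, qrepr p')).2.2 by [].
  exists (exist _ (t, (qrepr p, qrepr p')) kP).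
  apply: sA; split => /=; first by rewrite qreprK.
  by apply: sA1; split => /=; [rewrite qreprK|exact: sA2].
have PF' : ProperFilter F by exact: ultra_proper.
have [C1 sF1] := cvg_to_prod _ _ sF.
have [C2 sF2] := cvg_to_prod _ _ sF1.
have [C3 C4] := cvg_to_prod _ _ sF2.
have lim (k : K' -> M) z : (fun x => qpi R (k x)) @ F --> z ->
    exists2 m, k @ F --> m & qpi R m = z.
  move=> kz; have [m km] := ultra_cvg k (uf_compact hM) UF; exists m => //.
  exact: (lim_unique icer_quot_hausdorff PF' (cvg_comp _ _ km (@qpi_cont _ R m)) kz).
have [m Fm <-] := lim _ _ C1.
have [m' Fm' <-] := lim _ _ C2.
have [n Fn nE] := lim _ _ C3.
have [n' Fn' n'E] := lim _ _ C4.
apply/icer_qpiP; apply: (ap _ _ n n').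
  by apply/icer_qpiP; rewrite nE n'E.
move=> U1 W1 U2 W2 nU1 nW1 nU2 nW2.
have H1 : F (fun k => U1 (sval k).2.1 /\ W1 (sval k).2.2).
  by apply: filterI; [exact: (Fm _ nU1)|exact: (Fm' _ nW1)].
have H2 : F (fun k => U2 (act (sval k).1 (sval k).2.1) /\ W2 (act (sval k).1 (sval k).2.2)).
  by apply: filterI; [exact: (Fn _ nU2)|exact: (Fn' _ nW2)].
have [[[t [p p']] /= fp] [/= [U1p W1p] [U2p W2p]]] := filter_meet PF' H1 H2.
by exists p, p', t.
Qed.

End Map.
End One.

Lemma kernel_icer (Z : topologicalType) (actZ : T -> Z -> Z) (f : M -> Z) :
  cflow g actZ -> continuous f -> (forall t m, f (act t m) = actZ t (f m)) ->
  icer g act [set p | f p.1 = f p.2].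
Proof.
move=> [[Z1 [ZM Zc]] [_ hZ]] cf ef; split => //=.
- apply: closed_equalizer => // z; apply: continuous_comp; try exact: cf.
    exact: cvg_fst.
  exact: cvg_snd.
- by move=> m m' m'' -> ->.
- split; first by move=> t m m'; rewrite !ef => ->.
  (* Joint continuity of [actZ] at the unit and [f m] places [rel_J] in the kernel. *)
  move=> [m m'] Jm /=; apply: hZ => A B nA nB.
  have nA' : nbhs (gone g, f m) ((fun p : T * Z => actZ p.1 p.2) @^-1` A).
    by apply: Zc; rewrite /= Z1.
  have [[V U] /= [nV nU] sA] := nA'.
  have nU' : nbhs m (f @^-1` U) by exact: cf.
  have nB' : nbhs m' (f @^-1` B) by exact: cf.
  have [v [u [Vv Uu Bu]]] := Jm _ _ _ nU' nB' nV.
  exists (f (act v u)); split => //; rewrite ef.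
  exact: (sA (v, f u)).
Qed.

End QuotFlow.

(** * The PI tower *)

Section PITower.
Variables (T : topologicalType) (g : group_law T) (M : topologicalType) (act : T -> M -> M).
Hypothesis hT : topgroup g.
Hypothesis hM : universal_flow g act.

Lemma qlift_iso (Z : topologicalType) (actZ : T -> Z -> Z) (f : M -> Z) :
  cflow g actZ -> continuous f -> (forall z, exists m, f m = z) ->
  (forall t m, f (act t m) = actZ t (f m)) ->
  flow_iso (@qact T M act [set p | f p.1 = f p.2]) actZ
    (@qlift M [set p | f p.1 = f p.2] Z f).
Proof.
move=> hZ cf sf ef; set R := [set p | f p.1 = f p.2].
have iR : icer g act R by exact: kernel_icer hZ cf ef.
have Rf m m' : R (m, m') -> f m = f m' by [].
have eq := qlift_ext iR cf sf ef Rf.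
split => //; have [k kE] := choice sf.
exists (fun z => qpi R (k z)).
have K1 : cancel (@qlift M R Z f) (fun z => qpi R (k z)).
  move=> q; rewrite -[RHS]qreprK; apply/(icer_qpiP iR).
  by rewrite /R /= kE.
have K2 : cancel (fun z => qpi R (k z)) (@qlift M R Z f).
  by move=> z; rewrite (qlift_pi iR Rf) kE.
split => //; apply/continuous_closedP => C cC.
have -> : (fun z => qpi R (k z)) @^-1` C = @qlift M R Z f @` C.
  apply/seteqP; split => [z Cz|_ [q Cq <-]]; last by rewrite /preimage /= K1.
  by exists (qpi R (k z)).
have [_ [_ hauZ]] := hZ; case: eq => cq _.
exact: compact_to_hausdorff_closed (@quot_compact _ _ (uf_compact hM)) hauZ cq cC.
Qed.

Lemma icer_bigcap (Fam : set (set (M * M))) : Fam !=set0 ->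
  (forall R, Fam R -> icer g act R) -> icer g act (\bigcap_(R in Fam) R).
Proof.
move=> [R0 F0] iF; split.
- by apply: closed_bigI => R /iF [].
- by move=> m R /iF [_ + _ _ _]; apply.
- by move=> m m' Rm R FR; have [_ _ + _ _] := iF _ FR; apply; exact: Rm.
- move=> m m' m'' R1 R2 R FR; have [_ _ _ tR _] := iF _ FR.
  by apply: tR (R1 _ FR) (R2 _ FR).
- split; last by move=> p Jp R FR; have [_ _ _ _ [_ JR]] := iF _ FR; exact: JR.
  move=> t m m' Rm R FR; have [_ _ _ _ [aR _]] := iF _ FR.
  by apply: aR; exact: Rm.
Qed.

Variables (X Y : topologicalType) (actX : T -> X -> X) (actY : T -> Y -> Y).
Variables (pi : X -> Y) (piX : M -> X).
Hypothesis fX : min_cflow g actX.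
Hypothesis fY : min_cflow g actY.
Hypothesis epi : ext actX actY pi.
Hypothesis eX : ext act actX piX.

Let RX := [set p | piX p.1 = piX p.2].
Let RY := [set p | pi (piX p.1) = pi (piX p.2)].

Hypothesis perfX : forall S : set (Aut act), subgroup S -> closed S ->
  S `<=` grp RY -> S `<=` der S -> S `<=` grp RX.

Let H : set (Aut act) := grp RX.
Let KH := rel_K g H.

Let stepP (R R' : set (M * M)) := [/\ icer g act R', KH `<=` R', R' `<=` R, R' <> R &
    prox_rel act R' R \/ ap_rel act R' R].
(** When no admissible smaller relation exists, [xget] returns its default [R], so the iteration
    stops there. *)
Let step (R : set (M * M)) := xget R (stepP R).

(** The flows of the tower are the quotients by the stages of [step] started at [RY], and X' is the
    quotient by [KH], proximal over X by [rel_K_prox]. *)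
Lemma is_PI_of_perfect : is_PI g actX actY pi.
Proof.
have [[flX minX] [flY minY]] := (fX, fY).
have [cpi [spi epi']] := epi; have [cX [sX eX']] := eX.
pose piY := pi \o piX.
have cY : continuous piY by exact: comp_cont.
have sY y : exists m, piY m = y.
  by have [x <-] := spi y; have [m <-] := sX x; exists m.
have eY t m : piY (act t m) = actY t (piY m) by rewrite /piY /= eX' epi'.
have iX : icer g act RX by exact: kernel_icer flX cX eX'.
have iY : icer g act RY by exact: kernel_icer flY cY eY.
have XY : RX `<=` RY by move=> p; rewrite /RX /RY /= => ->.
have sH : subgroup H by exact: (grp_subgroup iX).
have cH : closed H by exact: (grp_closed hM iX).
have iK : icer g act KH by exact: rel_K_icer.
have KX : KH `<=` RX by apply: rel_K_sub.
have KY : KH `<=` RY by exact: subset_trans KX XY.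
have step_sub R : step R `<=` R.
  rewrite /step; case: xgetP => [R' _ sP|_]; last exact: subset_refl.
  by have [] := sP.
have tow R : tower step RY R -> [/\ icer g act R, KH `<=` R & R `<=` RY].
  move=> tR; split; last exact: tower_top tR.
    elim: tR => // [B _ iB|Fam nF _ iF]; last exact: icer_bigcap.
    by rewrite /step; case: xgetP => // R' _ sP; have [] := sP.
  elim: tR => // [B _ iB|Fam nF _ iF]; last exact: sub_bigcap.
  by rewrite /step; case: xgetP => // R' _ sP; have [] := sP.
have stepE R : tower step RY R -> R <> KH -> stepP R (step R).
  move=> /tow [iR KR RRY] RK; apply: xgetPex.
  exact: (icer_step hT hM iX perfX iR KR RRY RK).
pose O := {B | tower step RY B}.
have [th [fth leth]] := tower_least RY step_sub.
(* The last stage is fixed by [step], while [icer_step] makes [step] strict at every stage other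
   than [KH]. *)
have thE : sval th = KH.
  by apply: contrapT => nE; have [_ _ _ + _] := stepE _ (svalP th) nE; apply.
pose o0 : O := exist _ RY (@tower0 _ step RY).
have iO (a : O) : icer g act (sval a) by have [] := tow _ (svalP a).
have KO (a : O) : KH `<=` sval a by have [] := tow _ (svalP a).
have qK R (iR : icer g act R) : forall m m', R (m, m') -> qpi R m = qpi R m'.
  by move=> m m' Rm; apply/(icer_qpiP iR).
have qs (R : set (M * M)) : forall z : quot R, exists m, qpi R m = z.
  by move=> z; exists (qrepr z); exact: qreprK.
have ker R : icer g act R -> [set p | qpi R p.1 = qpi R p.2] = R.
  move=> iR; apply/seteqP; split => -[a b] /=; last exact: qK.
  by move/(icer_qpiP iR).
pose lift R R' : quot R -> quot R' := @qlift M R (quot R') (@qpi M R').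
have lift_ext R R' : icer g act R -> icer g act R' -> R `<=` R' ->
    ext (@qact T M act R) (@qact T M act R') (lift R R').
  move=> iR iR' RR'; apply: (qlift_ext iR (@qpi_cont _ R') (qs R')).
    by move=> t m; rewrite (qact_pi iR').
  by move=> m m' /RR'; exact: qK.
have liftE R R' m : icer g act R -> icer g act R' -> R `<=` R' ->
    lift R R' (qpi R m) = qpi R' m.
  by move=> iR iR' RR'; apply: (qlift_pi iR) => a b /RR'; exact: qK.
exists (quot KH), (@qact T M act KH), (@qlift M KH X piX).
have KXf m m' : KH (m, m') -> piX m = piX m' by move=> /KX.
split; first exact: quot_min_cflow.
split; first exact: (qlift_ext iK cX sX eX' KXf).
split.
  apply: (qlift_proximal iK KXf).
  exact: rel_K_prox.
exists O, (@tower_lt _ step RY), o0, th.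
split; first exact: tower_wf.
split.
  move=> a [oa noa]; apply: noa; apply/seteqP; split => //.
  by have [] := tow _ (svalP a).
split; first exact: leth.
exists (fun a : O => quot (sval a)), (fun a : O => @qact T M act (sval a)),
  (fun a : O => lift KH (sval a)), (fun a b : O => lift (sval b) (sval a)),
  (@qlift M RY Y piY).
split.
  by move=> a; split; [exact: quot_min_cflow|apply: lift_ext].
split.
  move=> a b [ba _]; split; first exact: lift_ext.
  by move=> q; rewrite -[q]qreprK !liftE.
split; first exact: (qlift_iso flY cY sY eY).
split.
  move=> q; rewrite -[q]qreprK liftE //= (qlift_pi iK KXf).
  by rewrite (qlift_pi iY).
split.
  move=> a b ab; have [ba _] := ab.
  have [aK|naK] := pselect (sval a = KH).
    case: ba => ba []; apply/seteqP; split => //.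
    by rewrite aK; exact: KO.
  have [_ _ _ nf pa] := stepE _ (svalP a) naK.
  have bE := tower_succ step_sub nf ab.
  have sab : sval b `<=` sval a by case: ba.
  have qba m m' : sval b (m, m') -> qpi (sval a) m = qpi (sval a) m'.
    by move=> /sab; exact: qK.
  case: pa => pa; [left|right].
    apply: (qlift_proximal (iO b) qba).
    by rewrite ker // bE.
  apply: (qlift_ap hM (iO b)).
  by rewrite ker // bE.
split.
  move=> l ll; have lE := tower_limit step_sub (erefl : sval o0 = RY) ll.
  have lI p : (forall a, tower_lt a l -> sval a p) -> sval l p.
    by move=> ap; rewrite lE => _ [a al <-]; exact: ap.
  split.
    move=> y y' eyy; rewrite -[y]qreprK -[y']qreprK; apply/(icer_qpiP (iO l)).
    apply: lI => a al; apply/(icer_qpiP (iO a)).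
    have := eyy a al; rewrite -[y]qreprK -[y']qreprK !liftE //; try by case: al.
    by rewrite !qreprK.
  (* A compatible family is realised by compactness of [M]: the classes [Cl a] are nonempty, closed
     and nested. *)
  move=> th' comp.
  pose Cl (a : O) := [set m | qpi (sval a) m = th' a].
  pose Lt := [set a : O | tower_lt a l].
  have o0l : Lt o0.
    case: ll => lo _; split; first by have [] := tow _ (svalP l).
    by move=> lE'; apply: lo; exact: eq_exist_val lE'.
  have sCl (a b : O) : Lt b -> sval b `<=` sval a -> Cl b `<=` Cl a.
    move=> lb ba m /= mb.
    have [ab|nab] := pselect (sval b = sval a).
      by have <- : b = a by exact: eq_exist_val ab.
    have ab : tower_lt a b by [].
    by rewrite /Cl /= -(comp a b ab lb) -mb liftE.
  have PF : ProperFilter (filter_from Lt Cl).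
    apply: filter_from_proper; last by move=> a _; exact: qs.
    apply: filter_from_filter; first by exists o0.
    move=> a b la lb.
    case: (tower_total step_sub (svalP a) (svalP b)) => ab.
      by exists a => // m am; split => //; exact: sCl am.
    by exists b => // m bm; split => //; exact: sCl bm.
  have [F [UF sF]] := ultraFilterLemma PF.
  have PF' : ProperFilter F by exact: ultra_proper.
  have [m Fm] := ultra_cvg id (uf_compact hM) UF.
  exists (qpi (sval l) m) => a al; rewrite liftE //; last by case: al.
  apply: (closed_cvg_mem (A := Cl a) PF' _ _ Fm).
    apply: closed_equalizer; first exact: (icer_quot_hausdorff hM (iO a)).
      exact: qpi_cont.
    exact: cst_cont.
  by apply: sF; exists a.
split; first by apply: lift_ext.
have thK : sval th `<=` KH by rewrite thE.
exists (lift (sval th) KH); split.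
  by case: (lift_ext _ _ (iO th) iK thK).
by split => q; rewrite -[q]qreprK !liftE.
Qed.

End PITower.

(** * Minimal left ideals of beta T *)

(** The Ellis-Numakura argument: a minimal closed subsemigroup [S] satisfies [S v = S] for [v] in
    [S], so the solutions of [x v = v] in [S] form a closed subsemigroup, which is all of [S]. *)
Lemma ellis_idempotent (Z : topologicalType) (mul : Z -> Z -> Z) :
  (exists z : Z, True) -> compact [set: Z] -> hausdorff_space Z ->
  (forall x y z, mul x (mul y z) = mul (mul x y) z) ->
  (forall y, continuous (fun x => mul x y)) ->
  exists e, mul e e = e.
Proof.
move=> [z0 _] cZ hZ mulA cmul.
pose P (S : set Z) := [/\ closed S, S !=set0 & forall x y, S x -> S y -> S (mul x y)].
have PT : P setT by split => //; exists z0.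
pose R (A B : {S | P S}) := `[< sval B `<=` sval A >].
have [||||[S PS] maxS] := @Zorn {S | P S} R.
- by move=> A; apply/asboolP.
- by move=> A B C /asboolP AB /asboolP BC; apply/asboolP => x /BC /AB.
- move=> [A PA] [B PB] /asboolP /= AB /asboolP /= BA.
  by apply: eq_exist_val; apply/seteqP.
- move=> C totC; have [[S0 CS0]|nC] := pselect (C !=set0); last first.
    by exists (exist _ setT PT) => S CS; case: nC; exists S.
  have FC : ProperFilter (filter_from C (fun S => sval S)).
    apply: filter_from_proper; last by move=> S _; case: (svalP S).
    apply: filter_from_filter; first by exists S0.
    move=> A B CA CB; case: (totC A B CA CB) => /asboolP AB.
      by exists B => // x Bx; split => //; exact: AB.
    by exists A => // x Ax; split => //; exact: AB.
  have [F [UF sF]] := ultraFilterLemma FC.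
  have PF : ProperFilter F by exact: ultra_proper.
  have [z Fz] := ultra_cvg id cZ UF.
  pose I := [set a | forall S, C S -> sval S a].
  suff PI : P I.
    by exists (exist _ I PI) => S CS; apply/asboolP => a; apply.
  split.
  + by move=> a cla S CS; have [cS _ _] := svalP S; apply: cS; apply: closureS cla => b; apply.
  + exists z => S CS; have [cS _ _] := svalP S.
    by apply: (closed_cvg_mem PF cS _ Fz); apply: sF; exists S.
  + move=> x y Ix Iy S CS; have [_ _ mS] := svalP S.
    by apply: mS; [exact: Ix|exact: Iy].
have minS S' : P S' -> S' `<=` S -> S' = S.
  move=> PS' S'S; have RS : R (exist _ S PS) (exist _ S' PS') by apply/asboolP.
  by have /(congr1 sval) := maxS _ RS.
have [cS [v Sv] mS] := PS.
have SvS : (fun x => mul x v) @` S = S.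
  apply: minS; last by move=> _ [x Sx <-]; exact: mS.
  split.
  - exact: compact_to_hausdorff_closed.
  - by exists (mul v v), v.
  - move=> _ _ [x Sx <-] [y Sy <-]; exists (mul (mul x v) y).
      by apply: (mS _ _ (mS _ _ Sx Sv)).
    by rewrite !mulA.
have vS : S `&` [set x | mul x v = v] = S.
  apply: minS; last by move=> x [].
  split.
  - by apply: closedI => //; apply: closed_equalizer => //; exact: cst_cont.
  - by have : S v by []; rewrite -{1}SvS => -[x Sx xv]; exists x.
  - move=> x y [Sx /= xv] [Sy /= yv]; split; first exact: mS.
    by rewrite /= -mulA yv xv.
have : S v by [].
by rewrite -vS => -[_ vv]; exists v.
Qed.

Section BetaT.
Variables (T : Type) (g : group_law T).
Implicit Types p q r : betaT T.

Definition bpr (t : T) : betaT T := [set A | A t].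

Lemma ultra_filter p : is_ultra p -> ProperFilter (p : set_system T).
Proof.
move=> [pT [p0 [pI [pS pC]]]]; split; first exact: p0.
by split => // A B AB; exact: pS.
Qed.

Lemma is_ultra_bpr t : is_ultra (bpr t).
Proof.
split; [|split; [|split; [|split]]] => //.
- by move=> A B AB; exact: AB.
- by move=> A; case: (pselect (A t)); [left|right].
Qed.

Lemma is_ultra_bmul p q : is_ultra p -> is_ultra q -> is_ultra (bmul g p q).
Proof.
move=> [pT [p0 [pI [pS pC]]]] [qT [q0 [qI [qS qC]]]]; split; [|split; [|split; [|split]]].
- by apply: pS pT => t _; exact: qT.
- by move=> H; apply: p0; apply: pS H => t /= /q0.
- by move=> A B pA pB; apply: pS (pI _ _ pA pB) => t [/= qA qB]; exact: qI.
- by move=> A B AB; apply: pS => t /=; apply: qS => s /=; exact: AB.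
- move=> A; have [H|H] := pC [set t | q [set s | A (gmul g t s)]]; first by left.
  right; apply: pS H => t /= nq.
  by have [//|] := qC [set s | A (gmul g t s)].
Qed.

Lemma bmulA p q r : bmul g p (bmul g q r) = bmul g (bmul g p q) r.
Proof.
apply/funext => A; rewrite /bmul /=; congr (p _); apply/funext => t /=.
congr (q _); apply/funext => s /=; congr (r _); apply/funext => u /=.
by rewrite gmulA.
Qed.

Lemma betaT_open (A : set T) : open [set p : betaT T | p A].
Proof. exact: (subbase_open (betaT_openE T) (i := A)). Qed.

Lemma betaT_cvg (F : set_system (betaT T)) p : Filter F ->
  (forall A, p A -> F [set q : betaT T | q A]) -> F --> p.
Proof.
by move=> FF H; apply: (subbase_cvg (betaT_openE T)) => // A _; exact: H.
Qed.

Lemma bmulR_cont q : continuous (fun p => bmul g p q).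
Proof.
move=> p; have FF : Filter (fmap (fun p => bmul g p q) (nbhs (p : betaT T))).
  by apply: fmap_filter; exact: nbhs_filter.
apply: (betaT_cvg FF) => A pA.
exact: (open_nbhs_nbhs (conj (betaT_open [set t | q [set s | A (gmul g t s)]]) pA)).
Qed.

Lemma bact_cont t : continuous (bact g t).
Proof.
move=> p; have FF : Filter (fmap (bact g t) (nbhs (p : betaT T))).
  by apply: fmap_filter; exact: nbhs_filter.
apply: (betaT_cvg FF) => A pA.
exact: (open_nbhs_nbhs (conj (betaT_open [set s | A (gmul g t s)]) pA)).
Qed.

Lemma compact_ultras : compact (@is_ultra T).
Proof.
rewrite compact_ultra => F UF FU.
have PF : ProperFilter F by exact: ultra_proper.
pose p : betaT T := [set A | F [set q : betaT T | q A]].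
exists p; split; last by apply: betaT_cvg => A.
have Fup P : (forall q, is_ultra q -> P q) -> F P.
  by move=> H; apply: filterS FU => q; exact: H.
have pE A : p A = F [set q : betaT T | q A] by [].
split; [|split; [|split; [|split]]].
- by rewrite pE; apply: Fup => q [].
- move=> F0; have [q [/= q0 [_ [nq0 _]]]] := filter_meet PF F0 FU.
  exact: nq0.
- move=> A B; rewrite !pE => pA pB.
  have FI : F [set q : betaT T | q A -> q B -> q (A `&` B)].
    by apply: Fup => q [_ [_ [qI _]]] qA qB; exact: qI.
  by move: pA pB FI; apply: filterS3 => q qA qB; apply.
- move=> A B AB; rewrite !pE => pA.
  have FI : F [set q : betaT T | q A -> q B].
    by apply: Fup => q [_ [_ [_ [qS _]]]]; exact: qS.
  by move: pA FI; apply: filterS2 => q qA; apply.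
- move=> A; have [pA|npA] := in_ultra_setVsetC [set q : betaT T | q A] UF; first by left.
  right; rewrite pE; have FI : F [set q : betaT T | ~ q A -> q (~` A)].
    by apply: Fup => q [_ [_ [_ [_ qC]]]] nq; have [] := qC A.
  by move: npA FI; apply: filterS2 => q /= nq; apply.
Qed.

Lemma bact_cvg p q : is_ultra p ->
  (fun t => bact g t q) @ (p : set_system T) --> bmul g p q.
Proof.
move=> up; have PF := ultra_filter up.
have FF : Filter ((fun t => bact g t q) @ (p : set_system T)) by exact: fmap_filter.
exact: betaT_cvg.
Qed.

End BetaT.

(** The ideal as a space of its own. The statement uses functions on all of [betaT T] that are
    continuous within [I]; [within_BI_cont] and [BI_cont_within] translate. *)
Definition BI (T : Type) (I : set (betaT T)) := {p : betaT T | I p}.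

Section BIdef.
Variables (T : Type) (I : set (betaT T)).
HB.instance Definition _ := gen_eqMixin (BI I).
HB.instance Definition _ := gen_choiceMixin (BI I).
HB.instance Definition _ := Topological.copy (BI I)
  (initial_topology (fun x : BI I => sval x)).

Lemma BI_val_cont : continuous (fun x : BI I => sval x).
Proof. exact: initial_continuous. Qed.

Lemma BI_cont (Z : topologicalType) (f : Z -> BI I) :
  continuous (fun z => sval (f z)) -> continuous f.
Proof. exact: (@continuous_comp_initial (BI I) Z (betaT T) (fun x => sval x)). Qed.

Lemma BI_cvg K (F : set_system K) (f : K -> BI I) (x : BI I) : Filter F ->
  (fun k => sval (f k)) @ F --> sval x -> f @ F --> x.
Proof.
move=> FF fx U [_ [[W oW <-] Wx] sU].
have FW : F ((fun k => sval (f k)) @^-1` W) by apply: fx; exact: open_nbhs_nbhs.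
suff : F (f @^-1` U) by [].
by apply: filterS FW => k Wk; apply: sU.
Qed.

End BIdef.

(** * A minimal left ideal as a universal flow *)

Section MinLeftIdeal.
Variables (T : Type) (g : group_law T) (I : set (betaT T)).
Hypothesis hI : min_left_ideal g I.
Local Notation M := (BI I).

Lemma I_ultra p : I p -> is_ultra p.
Proof. by case: hI => -[+ _] _ => /[apply]. Qed.

Lemma I_mul p q : is_ultra p -> I q -> I (bmul g p q).
Proof. by case: hI => -[_ +] _; apply. Qed.

Lemma I_principal p q : I p -> I q -> exists2 r, is_ultra r & bmul g r q = p.
Proof.
move=> Ip Iq; have [_ [_ mI]] := hI.
pose L : set (betaT T) := [set x | exists2 r, is_ultra r & bmul g r q = x].
have LI : L = I.
  apply: mI.
  - split; first by move=> _ [r ur <-]; exact: (is_ultra_bmul g ur (I_ultra Iq)).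
    move=> s _ us [r ur <-]; exists (bmul g s r); first exact: is_ultra_bmul.
    by rewrite bmulA.
  - by exists (bmul g q q), q => //; exact: I_ultra.
  - by move=> _ [r ur <-]; exact: I_mul.
by have : L p by rewrite LI.
Qed.

Lemma I_principal_I p q : I p -> I q -> exists2 r, I r & bmul g r q = p.
Proof.
move=> Ip Iq; have [_ [_ mI]] := hI.
pose L : set (betaT T) := [set x | exists2 r, I r & bmul g r q = x].
have LI : L = I.
  apply: mI.
  - split; first by move=> _ [r Ir <-]; apply: is_ultra_bmul; exact: I_ultra.
    move=> s _ us [r Ir <-]; exists (bmul g s r); first exact: I_mul.
    by rewrite bmulA.
  - by exists (bmul g q q), q.
  - by move=> _ [r Ir <-]; apply: I_mul => //; exact: I_ultra.
by have : L p by rewrite LI.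
Qed.

Lemma I_compact : compact I.
Proof.
have [_ [[q Iq] _]] := hI.
have -> : I = (fun p => bmul g p q) @` (@is_ultra T).
  apply/seteqP; split => [p Ip|_ [p up <-]]; last exact: I_mul.
  by have [r ur <-] := I_principal Ip Iq; exists r.
apply: continuous_compact; last exact: compact_ultras.
by apply: continuous_subspaceT; exact: bmulR_cont.
Qed.

Definition mmul (x y : M) : M :=
  exist _ _ (I_mul (I_ultra (svalP x)) (svalP y)).
Definition mact (t : T) (x : M) : M :=
  exist _ _ (I_mul (is_ultra_bpr t) (svalP x)).

Lemma mmulA x y z : mmul x (mmul y z) = mmul (mmul x y) z.
Proof. by apply: eq_exist_val => /=; rewrite bmulA. Qed.

Lemma mmul_act t x y : mmul (mact t x) y = mact t (mmul x y).
Proof. by apply: eq_exist_val => /=; rewrite bmulA. Qed.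

Lemma mmulR_cont y : continuous (fun x => mmul x y).
Proof.
apply: BI_cont => /=.
exact: (comp_cont (@BI_val_cont _ I) (@bmulR_cont _ g (sval y))).
Qed.

Lemma mact_cont t : continuous (mact t).
Proof.
apply: BI_cont => /=.
exact: (comp_cont (@BI_val_cont _ I) (@bact_cont _ g t)).
Qed.

Lemma M_compact : compact [set: M].
Proof.
rewrite compact_ultra => F UF _.
have PF : ProperFilter F by exact: ultra_proper.
have UF' := ultra_fmap (fun x : M => sval x) UF.
have := I_compact; rewrite compact_ultra => /(_ _ UF') [].
  suff : F [set x : M | I (sval x)] by [].
  by apply: filterE => x; exact: svalP.
move=> p [Ip Fp]; exists (exist _ p Ip); split => //.
by apply: (BI_cvg (f := fun x : M => x) (x := exist _ p Ip)) => //; exact: filter_filter.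
Qed.

Lemma M_hausdorff : hausdorff_space M.
Proof.
move=> x y cl; apply: eq_exist_val; apply/funext => A; apply: propext.
have nb (z : M) (B : set T) : sval z B -> nbhs z [set w : M | sval w B].
  move=> zB; exact: (BI_val_cont (open_nbhs_nbhs (conj (betaT_open B) zB))).
have [_ [x0 [xI [_ xC]]]] := I_ultra (svalP x).
have [_ [y0 [yI [_ yC]]]] := I_ultra (svalP y).
have no (z : M) B : sval z B -> sval z (~` B) -> False.
  move=> zB znB; have [_ [z0' [zI _]]] := I_ultra (svalP z).
  by apply: z0'; rewrite -(setICr B); exact: zI.
split => H.
  have [//|nH] := yC A.
  by have [z [/= zA zB]] := cl _ _ (nb _ _ H) (nb _ _ nH); case: (no z A).
have [//|nH] := xC A.
by have [z [/= zA zB]] := cl _ _ (nb _ _ nH) (nb _ _ H); case: (no z A).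
Qed.

Lemma mact_cvg (x y : M) :
  (fun t => mact t y) @ (sval x : set_system T) --> mmul x y.
Proof.
have PF := ultra_filter (I_ultra (svalP x)).
have FF : Filter (sval x : set_system T) by exact: filter_filter.
apply: (BI_cvg (f := fun t => mact t y) FF).
exact: (bact_cvg (g := g) (q := sval y) (I_ultra (svalP x))).
Qed.

Lemma M_min : minimal_act mact.
Proof.
move=> A cA [a Aa] iA; apply/seteqP; split => // x _.
have [r Ir ra] := I_principal_I (svalP x) (svalP a).
have -> : x = mmul (exist _ r Ir) a by apply: eq_exist_val.
have PF := ultra_filter (I_ultra Ir).
apply: (closed_cvg_mem PF cA _ (@mact_cvg (exist _ r Ir) a)).
by apply: filterE => t; exact: iA.
Qed.

Lemma M_idem : exists e : M, mmul e e = e.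
Proof.
have [_ [[q Iq] _]] := hI.
apply: ellis_idempotent.
- by exists (exist _ q Iq).
- exact: M_compact.
- exact: M_hausdorff.
- exact: mmulA.
- exact: mmulR_cont.
Qed.

Lemma mmul_idem e x : mmul e e = e -> mmul x e = x.
Proof.
move=> ee; have [r Ir rx] := I_principal_I (svalP x) (svalP e).
have -> : x = mmul (exist _ r Ir) e by apply: eq_exist_val.
by rewrite -mmulA ee.
Qed.

(** Left inverses exist because [I b] is a left ideal and so equals [I]. Hence the elements fixed by
    left multiplication with [e] form a group with unit [e]. *)
Lemma mmul_inv e a : mmul e e = e -> mmul e a = a ->
  exists y, [/\ mmul e y = y, mmul y a = e & mmul a y = e].
Proof.
move=> ee ea.
have linv b : exists y, mmul e y = y /\ mmul y b = e.
  have [r Ir re] := I_principal_I (svalP e) (svalP b).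
  exists (mmul e (exist _ r Ir)); split; first by rewrite mmulA ee.
  by rewrite -mmulA -[RHS]ee; congr mmul; apply: eq_exist_val.
have [y [ey ya]] := linv a; have [z [ez zy]] := linv y.
exists y; split => //.
suff <- : z = a by [].
by rewrite -(mmul_idem z ee) -ya mmulA zy.
Qed.

(** Moving along [e] takes the pair to [(e n, e n')]. Both points lie in the group with unit [e],
    and right multiplication by their quotient [q] is an automorphism carrying one to the other. *)
Lemma M_pair (n n' : M) : exists x (r : Aut mact),
  closure (orbit2 mact (n, n')) (x, r x).
Proof.
have [e ee] := M_idem.
have en x : mmul e (mmul e x) = mmul e x by rewrite mmulA ee.
have [y [ey ya ay]] := mmul_inv ee (en n).
pose q := mmul y (mmul e n').
have eq : mmul e q = q by rewrite /q mmulA ey.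
have [q' [eq' q'q qq']] := mmul_inv ee eq.
have ca (z : M) : continuous (fun m => mmul m z) by exact: mmulR_cont.
have ar : is_autM mact (fun m => mmul m q).
  split; first exact: ca.
  split; first by move=> t m; rewrite mmul_act.
  exists (fun m => mmul m q'); split; first exact: ca.
  split; first by move=> t m; rewrite mmul_act.
  by split => m; rewrite -mmulA ?qq' ?q'q mmul_idem.
exists (mmul e n), (exist _ _ ar) => /=.
have -> : mmul (mmul e n) q = mmul e n' by rewrite /q mmulA ay mmulA ee.
have PF := ultra_filter (I_ultra (svalP e)).
apply: (closure_near PF (cvg_pair2 _ (@mact_cvg e n) (@mact_cvg e n'))).
by apply: filterE => t; exists t.
Qed.

(** Each [x] is the limit of [mact t e] along the ultrafilter [x] itself. So every point of the
    closure of an open [C] contains the set of [t] with [mact t e] in [C], and disjoint open sets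
    give disjoint sets of [t]. *)
Lemma M_ed (A B : set M) : open A -> open B -> A `&` B = set0 ->
  closure A `&` closure B = set0.
Proof.
move=> oA oB AB0; have [e ee] := M_idem.
have key (C : set M) m : open C -> closure C m -> sval m [set t | C (mact t e)].
  move=> oC clC; have [_ [_ [_ [_ mC]]]] := I_ultra (svalP m).
  have [//|nE] := mC [set t | C (mact t e)].
  have nm : nbhs m [set x : M | sval x (~` [set t | C (mact t e)])].
    exact: (BI_val_cont (open_nbhs_nbhs (conj (betaT_open _) nE))).
  have [x [Cx /= nx]] := clC _ nm.
  have PF := ultra_filter (I_ultra (svalP x)).
  have /(_ Cx) [] : ~ C x.
  have := @mact_cvg x e; rewrite (mmul_idem x ee) => cvx.
  exact: (closed_cvg_mem PF (open_closedC oC) nx cvx).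
apply/seteqP; split => // m [/(key _ _ oA) mA /(key _ _ oB) mB].
have [_ [m0 [mI _]]] := I_ultra (svalP m).
apply: m0; have := mI _ _ mA mB; congr (sval m _).
apply/seteqP; split => // t [At Bt].
by have : (A `&` B) (mact t e) by []; rewrite AB0.
Qed.

Lemma ideal_universal_flow : universal_flow g mact.
Proof.
have [_ [[q Iq] _]] := hI.
split.
- by exists (exist _ q Iq).
- exact: M_compact.
- exact: M_hausdorff.
- move=> m; apply: eq_exist_val; apply/funext => A /=.
  rewrite /bmul /bpr /=; congr (sval m _); apply/funext => s /=.
  by rewrite gmul1.
- move=> s t m; apply: eq_exist_val; apply/funext => A /=.
  rewrite /bmul /bpr /=; congr (sval m _); apply/funext => u /=.
  by rewrite gmulA.
- exact: mact_cont.
- exact: M_min.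
- exact: M_ed.
- exact: M_pair.
Qed.

End MinLeftIdeal.

(** * Nets of automorphisms and the stages F_o *)

Section NetFilter.
Variables (D : Type) (le : D -> D -> Prop).
Hypothesis dle : directed le.

Definition net_filter : set_system D := filter_from setT (fun i => [set j | le i j]).

Lemma net_filter_proper : ProperFilter net_filter.
Proof.
have [[i0 _] [lexx [letr leub]]] := dle.
apply: filter_from_proper; last by move=> i _; exists i; exact: lexx.
apply: filter_from_filter; first by exists i0.
move=> i j _ _; have [k [ik jk]] := leub i j; exists k => // l kl.
by split; [exact: letr ik kl|exact: letr jk kl].
Qed.

Lemma net_cvgP (Z : topologicalType) (z : D -> Z) l :
  net_cvg le z l -> z @ net_filter --> l.
Proof.
move=> zl U nU; have [i0 H] := zl U nU.
suff : net_filter (z @^-1` U) by [].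
by exists i0 => // i /H.
Qed.

End NetFilter.

Section IdealAut.
Variables (T : Type) (g : group_law T) (I : set (betaT T)).
Hypothesis hI : min_left_ideal g I.
Local Notation M := (BI I).
Local Notation act := (mact hI).
Local Notation Aut := (Aut act).

Definition agree (a : betaT T -> betaT T) (r : Aut) : Prop :=
  forall m : M, sval (r m) = a (sval m).

Lemma within_BI_cont (Z : topologicalType) (f : betaT T -> Z) :
  {within I, continuous f} -> continuous (fun x : M => f (sval x)).
Proof.
move=> /subspace_continuousP cf x U nU.
have := cf (sval x) (svalP x) U nU => nW.
have nW' : nbhs (sval x) [set p | I p -> U (f p)] by [].
have := @BI_val_cont _ I x _ nW'.
suff : forall A B : set M, A `<=` B -> nbhs x A -> nbhs x B.
  by apply => y /=; apply; exact: svalP.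
by move=> A B AB; exact: filterS.
Qed.

Lemma BI_cont_within (Z : topologicalType) (f : betaT T -> Z) :
  continuous (fun x : M => f (sval x)) -> {within I, continuous f}.
Proof.
move=> cf; apply/subspace_continuousP => p Ip U nU.
have [_ [[W oW <-] Wp] sU] := cf (exist _ p Ip) U nU.
have nW : nbhs p W by exact: open_nbhs_nbhs.
suff : nbhs p [set q | I q -> U (f q)] by [].
by apply: filterS nW => q Wq Iq; exact: (sU (exist _ q Iq) Wq).
Qed.

Lemma agree_of_aut a : is_aut g I a -> exists r : Aut, agree a r.
Proof.
move=> [Ia [ca [ea [b [Ib [cb abK]]]]]].
pose mk (c : betaT T -> betaT T) (Ic : forall m, I m -> I (c m)) (m : M) : M :=
  exist _ _ (Ic _ (svalP m)).
have cmk c Ic : {within I, continuous c} -> continuous (@mk c Ic).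
  by move=> cc; apply: BI_cont => /=; exact: within_BI_cont.
have K1 : cancel (mk a Ia) (mk b Ib).
  by move=> m; apply: eq_exist_val => /=; have [] := abK _ (svalP m).
have K2 : cancel (mk b Ib) (mk a Ia).
  by move=> m; apply: eq_exist_val => /=; have [] := abK _ (svalP m).
have emk t m : mk a Ia (act t m) = act t (mk a Ia m).
  by apply: eq_exist_val => /=; apply: ea; exact: svalP.
have ar : is_autM act (mk a Ia).
  split; first exact: cmk.
  split => //; exists (mk b Ib); split; first exact: cmk.
  by split => // t m; rewrite -{1}[m]K2 -emk K1.
by exists (exist _ _ ar).
Qed.

(** The members of F_o are functions on all of [betaT T], of which only the restriction to [I]
    matters; this representative is the identity off [I]. *)
Definition extend (r : Aut) (p : betaT T) : betaT T :=
  if pselect (I p) is left Ip then sval (r (exist _ p Ip)) else p.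

Lemma extendE (r : Aut) (m : M) : extend r (sval m) = sval (r m).
Proof.
rewrite /extend; case: pselect => [Im|nIm]; last by case: nIm; exact: svalP.
by congr (sval (r _)); apply: eq_exist_val.
Qed.

Lemma extend_agree (r : Aut) : agree (extend r) r.
Proof. by move=> m; rewrite extendE. Qed.

Lemma extend_in (r : Aut) p : I p -> exists m : M, p = sval m /\ extend r p = sval (r m).
Proof. by move=> Ip; exists (exist _ p Ip); rewrite -extendE. Qed.

Lemma extend_aut (r : Aut) : is_aut g I (extend r).
Proof.
have Iext (s : Aut) m : I m -> I (extend s m).
  by move=> /(extend_in s) [x [_ ->]]; exact: svalP.
have cext (s : Aut) : {within I, continuous (extend s)}.
  apply: BI_cont_within.
  have -> : (fun x : M => extend s (sval x)) = (fun x : M => sval (s x)).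
    by apply: funext => x; rewrite extendE.
  exact: (comp_cont (@aut_cont _ _ _ s) (@BI_val_cont _ I)).
split; first exact: Iext.
split; first exact: cext.
split.
  move=> t _ /(extend_in r) [x [-> ->]].
  have -> : bact g t (sval x) = sval (act t x) by [].
  by rewrite extendE aut_act.
exists (extend (ainv r)); split; first exact: Iext.
split; first exact: cext.
move=> p Ip; have pE : p = sval (exist _ p Ip : M) by [].
by rewrite pE !extendE ainvK ainvKV.
Qed.

Definition traceG (S : set (betaT T -> betaT T)) : set Aut := [set r | S (extend r)].

(** Membership depends only on the restriction to [I], so that such a set is recovered from its
    [traceG]. *)
Definition saturated (S : set (betaT T -> betaT T)) : Prop :=
  S `<=` is_aut g I /\
  forall a b, S a -> is_aut g I b -> (forall m, I m -> a m = b m) -> S b.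

Lemma traceG_agree S a r : saturated S -> S a -> agree a r -> traceG S r.
Proof.
move=> [_ satS] Sa ar; apply: satS Sa (extend_aut r) _ => m Im.
have mE : m = sval (exist _ m Im : M) by [].
by rewrite mE extendE ar.
Qed.

Lemma derived_saturated S : saturated S -> saturated (derived I S).
Proof.
move=> [Saut satS]; split; first by move=> a [/Saut].
move=> a b [Sa [D [le [d [dle [Sd [da d1]]]]]]] autb ab; split.
  exact: satS Sa autb ab.
exists D, le, d; split => //; split => //; split => // m Im.
by rewrite -ab //; exact: da.
Qed.

Lemma traceG_derived_sub S : saturated S -> traceG (derived I S) `<=` der (traceG S).
Proof.
move=> satS r [Sr [D [le [d [dle [Sd [da d1]]]]]]]; split => //.
have [Saut _] := satS.
have [c cE] := choice (fun i => agree_of_aut (Saut _ (Sd i))).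
have PF := net_filter_proper dle.
have FF : Filter (net_filter le) by exact: filter_filter.
have Gc i : traceG S (c i) by exact: traceG_agree satS (Sd i) (cE i).
have cvg (s : Aut) (b : betaT T -> betaT T) : agree b s -> tau_cvg I le d b ->
    c @ net_filter le --> s.
  move=> bs db; have FcF : Filter (c @ net_filter le) by exact: fmap_filter.
  apply: (tau_cvgP (FF := FcF)) => U W oU oW [u [Uu Wu]].
  have [mn [Imn [mnu dmn]]] := db (sval u) (svalP u).
  pose x i : M := exist _ _ (Imn i).
  have xu : x @ net_filter le --> u.
    by apply: (BI_cvg FF); exact: (net_cvgP mnu).
  have cxu : (fun i => c i (x i)) @ net_filter le --> s u.
    apply: (BI_cvg FF); rewrite bs.
    have -> : (fun i => sval (c i (x i))) = (fun i => d i (mn i)).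
      by apply: funext => i; rewrite cE.
    exact: (net_cvgP dmn).
  have n1 : net_filter le (x @^-1` U) by apply: xu; exact: open_nbhs_nbhs.
  have n2 : net_filter le ((fun i => c i (x i)) @^-1` W).
    by apply: cxu; exact: open_nbhs_nbhs.
  suff : net_filter le (c @^-1` (box U W)) by [].
  by move: n1 n2; apply: filterS2 => i Ui Wi; exists (x i).
have cr := cvg _ _ (@extend_agree r) da.
have c1 := cvg aone id (fun m => erefl) d1.
move=> A B nA nB.
have [i [Ai Bi]] := filter_meet PF (cr _ nA) (c1 _ nB).
by exists (c i); split.
Qed.

(** One net of automorphisms has to serve all points [m], with auxiliary points depending on [m]. An
    index is a finite list of points together with neighbourhoods of every [m] and [r m]; its
    automorphism is controlled only at the listed points. *)
Lemma der_traceG_sub S : der (traceG S) `<=` traceG (derived I S).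
Proof.
move=> r Dr; have [Sr _] := Dr; split => //.
have [F [UF Fr F1]] := der_cvg Dr.
have PF : ProperFilter F by exact: ultra_proper.
pose idx := (seq M * ((M -> set M) * (M -> set M)))%type.
pose ok (i : idx) := forall m, nbhs m (i.2.1 m) /\ nbhs (r m) (i.2.2 m).
pose D := {i : idx | ok i}.
pose le (i j : D) := (forall m, m \in (sval i).1 -> m \in (sval j).1) /\
  (forall m, (sval j).2.1 m `<=` (sval i).2.1 m) /\
  (forall m, (sval j).2.2 m `<=` (sval i).2.2 m).
pose good (i : D) (d : Aut) m :=
  box ((sval i).2.1 m) ((sval i).2.2 m) d /\
  box ((sval i).2.1 m) ((sval i).2.1 m) d.
have boxS U W U' W' (d : Aut) : U `<=` U' -> W `<=` W' -> box U W d -> box U' W' d.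
  by move=> UU WW [u [Uu Wu]]; exists u; split; [exact: UU|exact: WW].
have ex (i : D) : exists d : Aut, traceG S d /\
    forall m, m \in (sval i).1 -> good i d m.
  suff : F [set k | forall m, m \in (sval i).1 -> good i (sval k) m].
    by move=> /filter_ex [k Hk]; exists (sval k); split => //; exact: (svalP k).
  elim: (sval i).1 => [|m P IH]; first by apply: filterE.
  have [nN nW] := svalP i m.
  have b1 : F [set k | box ((sval i).2.1 m)° ((sval i).2.2 m)° (sval k)].
    apply: (tau_cvg_box Fr (open_interior _) (open_interior _)).
    by exists m; split.
  have b2 : F [set k | box ((sval i).2.1 m)° ((sval i).2.1 m)° (sval k)].
    apply: (tau_cvg_box F1 (open_interior _) (open_interior _)).
    by exists m; split.
  move: b1 b2 IH; apply: filterS3 => k k1 k2 kP x; rewrite inE => /orP[/eqP ->|/kP//].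
  split; [apply: boxS k1|apply: boxS k2]; exact: interior_subset.
have [d dE] := choice ex.
have leT : directed le.
  split; [|split; [|split]].
  - have okT : ok ([::], (fun=> setT, fun=> setT)) by move=> m; split; exact: filterT.
    by exists (exist ok _ okT).
  - by move=> i; split => //; split => m; exact: subset_refl.
  - move=> i j k [ij [ij1 ij2]] [jk [jk1 jk2]]; split; first by move=> m /ij /jk.
    by split => m x; [move=> /jk1 /ij1|move=> /jk2 /ij2].
  - move=> i j.
    pose k : idx := ((sval i).1 ++ (sval j).1,
      (fun m => (sval i).2.1 m `&` (sval j).2.1 m,
       fun m => (sval i).2.2 m `&` (sval j).2.2 m)).
    have okk : ok k.
      move=> m; have [i1 i2] := svalP i m; have [j1 j2] := svalP j m.
      by split; exact: filterI.
    exists (exist _ _ okk); split.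
      by split; [move=> m mi; rewrite mem_cat mi|split => m x []].
    by split; [move=> m mi; rewrite mem_cat mi orbT|split => m x []].
have main (b : betaT T -> betaT T) (s : Aut) (V : D -> M -> set M) : agree b s ->
    (forall i m, m \in (sval i).1 -> box ((sval i).2.1 m) (V i m) (d i)) ->
    (forall m W, nbhs (s m) W -> exists i, [/\ m \in (sval i).1 &
       forall j, le i j -> V j m `<=` W]) ->
    tau_cvg I le (fun i => extend (d i)) b.
  move=> bs boxV smallV p Ip; pose m : M := exist _ p Ip.
  have exu (i : D) : exists u : M, m \in (sval i).1 -> (sval i).2.1 m u /\ V i m (d i u).
    have [mi|nmi] := pselect (is_true (m \in (sval i).1)); last by exists m.
    by have [u Hu] := boxV i m mi; exists u.
  have [u uE] := choice exu.
  exists (fun i => sval (u i)); split; first by move=> i; exact: svalP.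
  have pE : p = sval m by [].
  split.
    move=> U nU; have nU' : nbhs m [set x : M | U (sval x)].
      exact: (BI_val_cont (x := m) nU).
    (* The implication encodes the assignment that is [U] at [m] and the whole space elsewhere. *)
    pose i0 : idx := ([:: m], (fun x => [set y : M | x = m -> U (sval y)], fun=> setT)).
    have ok0 : ok i0.
      move=> x; split; last exact: filterT.
      have [->|xm] := pselect (x = m); first by apply: filterS nU' => y Uy _.
      by apply: filterE => y /xm.
    exists (exist _ _ ok0) => i [i1 [i2 i3]].
    have mi : m \in (sval i).1 by apply: i1; rewrite /= inE.
    have [Nu _] := uE i mi.
    exact: (i2 m _ Nu erefl).
  rewrite pE -bs => U nU; have nU' : nbhs (s m) [set x : M | U (sval x)].
    exact: (BI_val_cont (x := s m) nU).
  have [i0 [mi0 Hi0]] := smallV m _ nU'.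
  exists i0 => i i0i; rewrite extendE.
  have [i1 _] := i0i.
  have [_ Vu] := uE i (i1 _ mi0).
  exact: (Hi0 i i0i _ Vu).
exists D, le, (fun i => extend (d i)).
split => //; split; first by move=> i; have [] := dE i.
split.
  apply: (main _ r (fun i => (sval i).2.2) (@extend_agree r)).
    by move=> i m mi; have [_ /(_ m mi) []] := dE i.
  move=> m W nW.
  pose i0 : idx := ([:: m], (fun=> setT, fun x => [set y : M | x = m -> W y])).
  have ok0 : ok i0.
    move=> x; split; first exact: filterT.
    have [->|xm] := pselect (x = m); first by apply: filterS nW => y Wy _.
    by apply: filterE => y /xm.
  exists (exist _ _ ok0); split; first by rewrite /= inE.
  by move=> j [_ [_ j2]] y /j2; apply.
apply: (main _ aone (fun i => (sval i).2.1) (fun m => erefl)).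
  by move=> i m mi; have [_ /(_ m mi) []] := dE i.
move=> m W nW.
pose i0 : idx := ([:: m], (fun x => [set y : M | x = m -> W y], fun=> setT)).
have ok0 : ok i0.
  move=> x; split; last exact: filterT.
  have [->|xm] := pselect (x = m); first by apply: filterS nW => y Wy _.
  by apply: filterE => y /xm.
exists (exist _ _ ok0); split; first by rewrite /= inE.
by move=> j [_ [j1 _]] y /j1; apply.
Qed.

Section Stages.
Variables (Y : Type) (piY : betaT T -> Y).
Local Notation F0 := (FY g I piY).

Lemma FY_saturated : saturated F0.
Proof.
split; first by move=> a [].
move=> a b [auta aY] autb ab; split => // m Im.
by rewrite -ab //; exact: aY.
Qed.

Lemma stage_sub S : stage I F0 S -> S `<=` F0.
Proof.
elim=> [//|S' _ IH a [/IH]//|Fam [S' FS'] _ IH a Fa].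
by apply: (IH _ FS'); exact: Fa.
Qed.

Lemma stage_saturated S : stage I F0 S -> saturated S.
Proof.
move=> stS; split; first by move=> a /(stage_sub stS) [].
elim: stS => [|S' stS' IH|Fam nF stF IH] a b.
- exact: (FY_saturated.2).
- have satS' : saturated S' by split; [move=> c /(stage_sub stS') []|exact: IH].
  exact: (derived_saturated satS').2.
- move=> Fa autb ab S' FS'; exact: (IH _ FS' _ _ (Fa _ FS') autb ab).
Qed.

Lemma stage_subgroup S : stage I F0 S -> subgroup (traceG S).
Proof.
elim=> [|S' stS' IH|Fam nF stF IH].
- have FE (r : Aut) : traceG F0 r <-> forall m : M, piY (sval (r m)) = piY (sval m).
    split => [[_ H] m|H]; first by rewrite -extendE H //; exact: svalP.
    split; first exact: extend_aut.
    by move=> _ /(extend_in r) [m [-> ->]].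
  split; [|split].
  + by apply/FE.
  + by move=> a b /FE ha /FE hb; apply/FE => m /=; rewrite ha hb.
  + by move=> a /FE ha; apply/FE => m; rewrite -{2}[m](ainvKV a) ha.
- have -> : traceG (derived I S') = der (traceG S').
    apply/seteqP; split; last exact: der_traceG_sub.
    exact: (traceG_derived_sub (stage_saturated stS')).
  exact: der_subgroup.
- split; [|split].
  + by move=> S' FS'; have [] := IH _ FS'.
  + move=> a b Ga Gb S' FS'; have [_ [GM _]] := IH _ FS'.
    have Sab : S' (extend (amul a b)) by apply: (GM a b); [exact: Ga|exact: Gb].
    exact: Sab.
  + move=> a Ga S' FS'; have [_ [_ GV]] := IH _ FS'.
    have Sa : S' (extend (ainv a)) by apply: (GV a); exact: Ga.
    exact: Sa.
Qed.

Lemma stage_Finf : stage I F0 (Finf I F0).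
Proof.
apply: stageI => //; exists F0; exact: stage0.
Qed.

(** The derived set of the least stage is a stage again, so it contains the least one. *)
Lemma Finf_perfect : traceG (Finf I F0) `<=` der (traceG (Finf I F0)).
Proof.
move=> r Fr; apply: (traceG_derived_sub (stage_saturated stage_Finf)).
by apply: Fr; apply: stageS; exact: stage_Finf.
Qed.

(** By monotonicity of [der], a set contained in its own derived set passes through every derived
    stage. *)
Lemma perfect_sub_Finf (S : set Aut) : S `<=` traceG F0 -> S `<=` der S ->
  S `<=` traceG (Finf I F0).
Proof.
move=> SF SD r Sr S' stS'; move: r Sr.
change (S `<=` traceG S').
elim: stS' => [//|S'' _ IH|Fam _ _ IH] r Sr.
  by apply: der_traceG_sub; apply: der_mono IH _ _; exact: SD.
by move=> S'' FS''; exact: (IH _ FS'' _ Sr).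
Qed.

End Stages.
End IdealAut.

(** * Semi-open maps and residual fibres *)

Definition base_seq (Z : topologicalType) (B : nat -> set Z) : Prop :=
  (forall n, open (B n)) /\
  forall z U, nbhs z U -> exists n, B n z /\ B n `<=` U.

Lemma compact_base_seq (R : realType) (Z : pseudoMetricType R) (z0 : Z) :
  compact [set: Z] -> exists B : nat -> set Z, base_seq B.
Proof.
move=> cZ.
pose P : pseudoPMetricType R := HB.pack (Z : Type)
  (isPointed.Build (Z : Type) z0) (PseudoMetric.class Z).
have [B /countable_injP [f injf] [oB bB]] := @compact_second_countable R P cZ.
(* The basic set with code [n], or the empty set if there is none. *)
pose b n : set Z := [set z | exists U, [/\ B U, f U = n & U z]].
exists b; split.
  move=> n; rewrite openE => z [U [BU fU Uz]].
  apply: (@filterS _ (nbhs z) _ U); last first.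
    by apply: open_nbhs_nbhs; split => //; exact: oB.
  by move=> x Ux; exists U.
move=> z U nU; have [V [BV Vz] VU] := bB z U nU.
exists (f V); split; first by exists V.
move=> x [W [BW fW Wx]]; apply: VU.
by rewrite -(injf W V) // inE.
Qed.

Section Semiopen.
Variables (T : topologicalType) (g : group_law T) (Z W : topologicalType).
Variables (actZ : T -> Z -> Z) (actW : T -> W -> W) (q : Z -> W).
Hypothesis cZ : compact [set: Z].
Hypothesis hZ : hausdorff_space Z.
Hypothesis aZ1 : forall z, actZ (gone g) z = z.
Hypothesis aZM : forall s t z, actZ (gmul g s t) z = actZ s (actZ t z).
Hypothesis aZc : forall t, continuous (actZ t).
Hypothesis minZ : minimal_act actZ.
Hypothesis hW : hausdorff_space W.
Hypothesis aW1 : forall z, actW (gone g) z = z.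
Hypothesis aWM : forall s t z, actW (gmul g s t) z = actW s (actW t z).
Hypothesis aWc : forall t, continuous (actW t).
Hypothesis cq : continuous q.
Hypothesis sq : forall w, exists z, q z = w.
Hypothesis eq : forall t z, q (actZ t z) = actW t (q z).

Lemma finitely_many_translates (O : set Z) : open O -> O !=set0 ->
  exists ts : seq T, forall z, exists2 t, t \in ts & O (actZ t z).
Proof.
move=> oO O0; apply: contrapT => nts.
have nts' (ts : seq T) : exists z, forall t, t \in ts -> ~ O (actZ t z).
  apply: contrapT => nz; apply: nts; exists ts => z.
  apply: contrapT => nt; apply: nz; exists z => t tin Ot.
  by apply: nt; exists t.
pose Q (ts : seq T) := [set z | forall t, t \in ts -> ~ O (actZ t z)].
have PF : ProperFilter (filter_from setT Q).
  apply: filter_from_proper; last by move=> ts _; exact: nts'.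
  apply: filter_from_filter; first by exists [::].
  move=> s t _ _; exists (s ++ t) => // z Qz.
  by split => r rin; apply: Qz; rewrite mem_cat rin ?orbT.
have [F [UF sF]] := ultraFilterLemma PF.
have PF' : ProperFilter F by exact: ultra_proper.
have [z Fz] := ultra_cvg id cZ UF.
have [t Ot] := dense_orbit aZ1 aZM aZc minZ z oO O0.
have n1 : nbhs z (actZ t @^-1` O) by exact: (aZc (open_nbhs_nbhs (conj oO Ot))).
have F1 : F (actZ t @^-1` O) by exact: (Fz _ n1).
have F2 : F (Q [:: t]) by apply: sF; exists [:: t].
have [x [Ox Qx]] := filter_meet PF' F1 F2.
by apply: (Qx t); rewrite ?inE.
Qed.

(** If the image of a smaller closed neighbourhood were nowhere dense, finitely many translates of
    that image would miss some point of [W]; but by minimality of [Z] they cover [W]. *)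
Lemma minimal_semiopen (O : set Z) : open O -> O !=set0 -> (q @` O)° !=set0.
Proof.
move=> oO [o Oo].
have [B nB BO] := compact_closed_nbhs hZ cZ (open_nbhs_nbhs (conj oO Oo)).
have [|ts tsP] := finitely_many_translates (open_interior B).
  by exists o.
pose C := q @` closure B.
have cC : closed C by apply: compact_to_hausdorff_closed => //; exact: closed_closure.
suff [w Cw] : C° !=set0.
  exists w; apply: filterS Cw => x [b /BO Ob <-]; by exists b.
apply: contrapT => nC.
have key (s : seq T) (V : set W) : open V -> V !=set0 ->
    exists2 w, V w & forall t, t \in s -> ~ C (actW t w).
  elim: s V => [|t s IH] V oV [v Vv]; first by exists v.
  have [w [Vw nCw]] : exists w, V w /\ ~ C (actW t w).
    apply: contrapT => nw; apply: nC; exists (actW t v).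
    have n1 : nbhs (actW t v) (actW (ginv g t) @^-1` V).
      by apply: aWc; rewrite (actVK aW1 aWM); exact: open_nbhs_nbhs.
    apply: filterS n1 => x Vx; apply: contrapT => nCx; apply: nw.
    by exists (actW (ginv g t) x); rewrite (actKV aW1 aWM).
  have oV' : open (V `&` (actW t @^-1` (~` C))).
    apply: openI => //; apply: open_comp; last exact: closed_openC.
    by move=> x _; exact: aWc.
  have [|w' [Vw' nCw'] H] := IH _ oV'; first by exists w.
  exists w' => // r; rewrite inE => /orP [/eqP ->//|]; exact: H.
have [w _ Hw] := key ts setT openT (ex_intro _ (q o) Logic.I).
have [z zw] := sq w; have [t tin Bt] := tsP z.
apply: (Hw t tin); exists (actZ t z); last by rewrite eq zw.
by apply: subset_closure; exact: interior_subset.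
Qed.

End Semiopen.

(* A Kuratowski-Ulam argument: a fibre is bad only if it lies in one of the
   nowhere dense closed sets [p (closure (B n)) \ interior (p (B m & D j))]. *)
Lemma residual_fibers (Z W : topologicalType) (p : Z -> W) (A : set Z)
    (B D : nat -> set Z) :
  compact [set: Z] -> hausdorff_space Z -> hausdorff_space W -> continuous p ->
  base_seq B -> closed A -> (forall j, open (D j)) ->
  (forall j, A `<=` closure (D j `&` A)) ->
  (forall O, open O -> (O `&` A) !=set0 -> (p @` (O `&` A))° !=set0) ->
  exists V : nat -> set W, [/\ forall n, open (V n),
    forall n, setT `<=` closure (V n `&` setT) &
    forall w, (forall n, V n w) -> forall j,
      A `&` (p @^-1` [set w]) `<=` closure (D j `&` (A `&` (p @^-1` [set w])))].
Proof.
move=> cZ hZ hW cp [oB bB] cA oD dD semi.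
pose bad (k : nat * nat * nat) : set W :=
  p @` (closure (B k.1.1) `&` A) `&` ~` (p @` (B k.1.2 `&` D k.2 `&` A))°.
(* Only triples with [closure (B n)] inside [B m] matter; all other codes contribute the whole
   space. *)
pose V n : set W := if unpickle n is Some k then
  if pselect (closure (B k.1.1) `<=` B k.1.2) is left _ then ~` bad k else setT
  else setT.
exists V; split.
- move=> n; rewrite /V; case: unpickle => [k|]; last exact: openT.
  case: pselect => [_|_]; last exact: openT.
  apply: closed_openC; apply: closedI; last first.
    by apply: open_closedC; exact: open_interior.
  apply: compact_to_hausdorff_closed => //; apply: closedI => //.
  exact: closed_closure.
- move=> n w _ O nO; rewrite /V; case: unpickle => [k|]; last first.
    by exists w; split => //; exact: nbhs_singleton.
  case: pselect => [BB|_]; last by exists w; split => //; exact: nbhs_singleton.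
  apply: contrapT => nO'.
  (* A neighbourhood missed by [V n] would be bad throughout. Density of [D j] in [A] over it, with
     [semi], yields an interior point of the image, which is not bad. *)
  have Obad : O° `<=` bad k.
    move=> x Ox; apply: contrapT => nb; apply: nO'.
    by exists x; split => //; exact: interior_subset.
  have Ow : O° w by exact: nO.
  have [[z [Bz Az] zw] _] := Obad _ Ow.
  have oP : open (p @^-1` O°) by apply: open_comp => [x _|]; [exact: cp|exact: open_interior].
  have oE : open (B k.1.2 `&` (p @^-1` O°)) by exact: openI.
  have nz : nbhs z (B k.1.2 `&` (p @^-1` O°)).
    by apply: open_nbhs_nbhs; split => //; split; [exact: BB|rewrite /preimage /= zw].
  have [z' [[Dz' Az'] [Bz' Oz']]] := dD k.2 _ Az _ nz.
  have oE' : open ((B k.1.2 `&` (p @^-1` O°)) `&` D k.2) by exact: openI.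
  have [|x Ex] := semi _ oE'; first by exists z'.
  have [y [[[By Oy] Dy] Ay] yx] := interior_subset Ex.
  have Ox : O° x by rewrite -yx.
  have [_] := Obad _ Ox; apply.
  apply: interiorS Ex => _ [u [[[Bu _] Du] Au] <-].
  by exists u.
- move=> w Vw j z [Az zw] O nO.
  have [m [Bmz BmO]] := bB z O nO.
  have [B' nB' B'B] := compact_closed_nbhs hZ cZ (open_nbhs_nbhs (conj (oB m) Bmz)).
  have [n [Bnz BnB']] := bB z B' nB'.
  have BB : closure (B n) `<=` B m by apply: subset_trans B'B; exact: closureS.
  have := Vw (pickle (n, m, j)); rewrite /V pickleK; case: pselect => // _ nbad.
  have [y [[Bmy Djy] Ay] yw] : (p @` (B m `&` D j `&` A)) w.
    apply: interior_subset; apply: contrapT => ni; apply: nbad; split => //.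
    by exists z => //; split => //; exact: subset_closure.
  by exists y; split => //; exact: BmO.
Qed.

(** * The set M_infinity *)

Section Minf.
Variables (T : topologicalType) (g : group_law T).
Variables (X Y : topologicalType) (actX : T -> X -> X) (actY : T -> Y -> Y).
Variables (pi : X -> Y) (I : set (betaT T)) (piX : betaT T -> X).
Hypothesis hT : topgroup g.
Hypothesis fX : min_cflow g actX.
Hypothesis fY : min_cflow g actY.
Hypothesis epi : ext actX actY pi.
Hypothesis hI : min_left_ideal g I.
Hypothesis eI : ext_I g I actX piX.
Local Notation M := (BI I).
Local Notation act := (mact hI).
Local Notation Aut := (Aut act).

Let f (m : M) : X := piX (sval m).
Let G : set Aut := traceG (Finf I (FY g I (pi \o piX))).
Let L := Minf g I piX pi.
Let hM : universal_flow g act := ideal_universal_flow hI.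

Lemma piX_ext : ext act actX f.
Proof.
have [cp [sp ep]] := eI; split; first exact: within_BI_cont.
split; last by move=> t m; apply: ep; exact: svalP.
by move=> x; have [m [Im <-]] := sp x; exists (exist _ m Im).
Qed.

Lemma Finf_agree a : Finf I (FY g I (pi \o piX)) a ->
  exists r : Aut, G r /\ agree a r.
Proof.
move=> Fa; have sat := stage_saturated (@stage_Finf _ g I _ (pi \o piX)).
have [r ar] := agree_of_aut hI (sat.1 _ Fa).
by exists r; split => //; exact: traceG_agree sat Fa ar.
Qed.

Lemma Minf_graph (r : Aut) m : G r -> L (f m, f (r m)).
Proof.
move=> Gr; exists (sval m), (sval (r m)).
split; first exact: svalP.
split; first exact: svalP.
split => //; apply: subset_closure; exists (extend r) => //.
by exists (sval m); [exact: svalP|rewrite extendE].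
Qed.

Lemma Minf_approx (O : set (X * X)) : open O -> O `&` L !=set0 ->
  exists m (r : Aut), G r /\ O (f m, f (r m)).
Proof.
move=> oO [q [Oq [p [p' [Ip [Ip' [clp qE]]]]]]]; move: Oq; rewrite qE => Oq.
have [cf _] := piX_ext.
pose m : M := exist _ p Ip; pose m' : M := exist _ p' Ip'.
have nO : nbhs (f m, f m') O by apply: open_nbhs_nbhs.
have [[U U'] /= [nU nU'] sO] := nO.
have [_ [[W oW <-] Wm] sW] := cf m _ nU.
have [_ [[W' oW' <-] Wm'] sW'] := cf m' _ nU'.
have nW : nbhs (p, p') (W `*` W').
  by exists (W, W') => //; split; exact: open_nbhs_nbhs.
have [_ [[a Fa [n In <-]] [/= Wn Wan]]] := clp _ nW.
have [r [Gr ar]] := Finf_agree Fa.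
exists (exist _ n In), r; split => //; apply: sO; split.
  exact: (sW (exist _ n In)).
by apply: sW'; rewrite /= ar.
Qed.

Lemma Minf_closed : closed L.
Proof.
have [cf _] := piX_ext; have [[_ [_ hX]] _] := fX.
pose Gam := \bigcup_(a in Finf I (FY g I (pi \o piX))) Gamma I a.
pose C : set (M * M) := (fun z => (sval z.1, sval z.2)) @^-1` closure Gam.
have -> : L = (fun z => (f z.1, f z.2)) @` C.
  apply/seteqP; split => [_ [p [p' [Ip [Ip' [clp ->]]]]]|_ [[m m'] Cm <-]].
    by exists (exist _ p Ip, exist _ p' Ip').
  exists (sval m), (sval m'); split; first exact: svalP.
  by split; first exact: svalP.
apply: compact_to_hausdorff_closed.
- by rewrite -setXTT; apply: compact_setX; exact: uf_compact hM.
- exact: hausdorff_prod.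
- apply: pair_continuous; apply: comp_cont cf; [exact: fst_cont|exact: snd_cont].
- apply: closed_preimage; last exact: closed_closure.
  by apply: pair_continuous; apply: (comp_cont _ (@BI_val_cont _ I));
    [exact: fst_cont|exact: snd_cont].
Qed.

Lemma Minf_sub (C : set (X * X)) : closed C ->
  (forall m (r : Aut), G r -> C (f m, f (r m))) -> L `<=` C.
Proof.
move=> cC CG q Lq; apply: contrapT => nC.
have [|m [r [Gr]]] := Minf_approx (closed_openC cC); first by exists q.
by apply; exact: CG.
Qed.

Lemma G_subgroup : subgroup G.
Proof. by apply: stage_subgroup; exact: stage_Finf. Qed.

Lemma Minf_diag : @Defs.diagonal X `<=` L.
Proof.
move=> [x y] xy; have {}xy : x = y by []; have [_ [sf _]] := piX_ext.
have [m mx] := sf x; have [G1 _] := G_subgroup.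
by have := Minf_graph m G1; rewrite /= mx {2}xy.
Qed.

Lemma Minf_Rpi : L `<=` Rpi pi.
Proof.
have [_ [_ hY]] := fY.1; have [cpi _] := epi.
apply: Minf_sub.
  by apply: closed_equalizer => //; apply: (comp_cont _ cpi); [exact: fst_cont|exact: snd_cont].
move=> m r Gr; have [_ H] := stage_sub (@stage_Finf _ g I _ (pi \o piX)) Gr.
have := H _ (svalP m); rewrite extendE /= => H'.
by rewrite /Rpi /= /f H'.
Qed.

(** If [L] were the diagonal, all of F_infinity would fix piX; every perfect subgroup for Y lies in
    F_infinity, so [is_PI_of_perfect] would apply. *)
Lemma Minf_neq_diag : ~ is_PI g actX actY pi -> L <> @Defs.diagonal X.
Proof.
move=> nPI LD; apply: nPI.
apply: (is_PI_of_perfect hT hM fX fY epi piX_ext) => S sS cS SY SD r Sr m /=.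
have Gr : G r.
  apply: (perfect_sub_Finf (S := S)) Sr => // s Ss; split; first exact: extend_aut.
  move=> p /(extend_in s) [x [-> ->]]; have := SY s Ss x => /= H.
  by rewrite -[LHS]/(pi (f (s x))) -[RHS]/(pi (f x)) H.
by have := Minf_graph m Gr; rewrite LD.
Qed.

(** Since [amul a (ainv b)] lies in the derived group of [G], some [e] in [G] is near both it and
    the unit. Then [amul e b] is near both [a] and [b], and minimality moves a point of its graph
    from one box to the other. *)
Lemma Minf_transitive (U V : set (X * X)) : open U -> open V ->
  U `&` L !=set0 -> V `&` L !=set0 ->
  exists z t, [/\ U z, L z & V (act2 actX t z)].
Proof.
move=> oU oV UL VL; have [cf [_ ef]] := piX_ext.
have [n [a [Ga Ua]]] := Minf_approx oU UL.
have [n' [b [Gb Vb]]] := Minf_approx oV VL.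
have rect (O : set (X * X)) m (c : Aut) : open O -> O (f m, f (c m)) ->
    exists A B, [/\ open A, open B, A m, B (c m) &
      forall x y, A x -> B y -> O (f x, f y)].
  move=> oO Om.
  have nO : nbhs (f m, f (c m)) O by apply: open_nbhs_nbhs.
  have [[A B] /= [nA nB] sO] := nO.
  have nA' : nbhs m (f @^-1` A) by exact: cf.
  have nB' : nbhs (c m) (f @^-1` B) by exact: cf.
  exists (f @^-1` A)°, (f @^-1` B)°; split;
    try exact: open_interior; try exact: nA'; try exact: nB'.
  by move=> x y /interior_subset Ax /interior_subset By; apply: sO.
have [A [B [oA oB An Ban AB]]] := rect _ _ _ oU Ua.
have [A' [B' [oA' oB' A'n B'bn AB']]] := rect _ _ _ oV Vb.
have [_ [GM GV]] := G_subgroup.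
have Gab : G (amul a (ainv b)) by apply: GM => //; exact: GV.
have [_ H] := Finf_perfect Gab.
have nb (c : Aut) P Q x : open P -> open Q -> P x -> Q (amul c b x) ->
    nbhs c ((fun e => amul e b) @^-1` box P Q).
  move=> oP oQ Px Qx; apply: amulR_continuous; apply: open_nbhs_nbhs.
  by split; [exact: box_open|exists x].
have [|| e [[/= eAB eAB'] Ge]] 
  := H ((fun e => amul e b) @^-1` box A B)
       ((fun e => amul e b) @^-1` box A' B').
- by apply: nb An _ => //; rewrite /= ainvK.
- exact: nb A'n _.
have [u [Au Bu]] := eAB; have [v [Av Bv]] := eAB'.
have Geb : G (amul e b) by exact: GM.
have oAB : open (A' `&` ((amul e b : Aut) @^-1` B')).
  by apply: openI => //; exact: open_aut_preimage.
have [t [A't B't]] : exists t, (A' `&` ((amul e b : Aut) @^-1` B')) (act t u).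
  apply: (dense_orbit (uf_act1 hM) (uf_actM hM) (uf_cont hM) (uf_min hM) u oAB).
  by exists v.
exists (f u, f (amul e b u)), t; split; first exact: AB.
  exact: Minf_graph.
by rewrite /act2 /= -!ef -!aut_act; exact: AB'.
Qed.

Lemma flow_cont (Z : topologicalType) (actZ : T -> Z -> Z) t :
  is_flow g actZ -> continuous (actZ t).
Proof.
move=> [_ [_ cZ]]; have c2 := pair_continuous (@cst_cont Z T t) (@id_cont Z).
exact: (comp_cont c2 cZ).
Qed.

(** The graph of one automorphism meeting [O] suffices: pulled back to the ideal it is an open set,
    and [f] is semi-open. *)
Lemma Minf_semiopen (O : set (X * X)) : open O -> (O `&` L) !=set0 ->
  ((fun z => z.1) @` (O `&` L))° !=set0.
Proof.
move=> oO OL; have [m [r [Gr Or]]] := Minf_approx oO OL.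
have [cf [sf ef]] := piX_ext; have [[flX [cX hX]] minX] := fX.
pose O' := [set x : M | O (f x, f (r x))].
have oO' : open O'.
  apply: open_comp => // x _; apply: pair_continuous => //.
  exact: (comp_cont (@aut_cont _ _ _ r) cf).
have [|w Hw] := minimal_semiopen (uf_compact hM) (uf_hausdorff hM) (uf_act1 hM) (uf_actM hM)
  (uf_cont hM) (uf_min hM) hX flX.1 flX.2.1 (fun t => flow_cont (t := t) flX) cf sf ef oO' _.
  by exists m.
exists w; apply: interiorS Hw => _ [x Ox <-].
by exists (f x, f (r x)) => //; split => //; exact: Minf_graph.
Qed.

End Minf.

(** * Distribution of the transitive points over the fibres *)

Theorem theorem5p1 (R : realType) (T : topologicalType) (g : group_law T)
    (X Y : pseudoMetricType R) (actX : T -> X -> X) (actY : T -> Y -> Y)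
    (pi : X -> Y) :
  topgroup g ->
  min_cflow g actX -> min_cflow g actY -> ext actX actY pi ->
  ~ is_PI g actX actY pi ->
  forall (I : set (betaT T)) (piX : betaT T -> X),
    min_left_ideal g I -> ext_I g I actX piX ->
    exists YLY : set Y, residual_in setT YLY /\
      forall y, YLY y ->
        exists Gy : set X, residual_in (pi @^-1` [set y]) Gy /\
          forall x, Gy x ->
            exists Sx : set X,
              residual_in [set x' | Minf g I piX pi (x, x')] Sx /\
              forall x', Sx x' -> LY_pair actX pi (Minf g I piX pi) x x'.
Proof.
move=> hT fX fY epi nPI I piX hI eI.
have [[flX [cX hX]] minX] := fX; have [[flY [cY hY]] minY] := fY.
have [cpi [spi epi']] := epi.
have [m0 _] := uf_inh (ideal_universal_flow hI).
pose x0 : X := piX (sval m0).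
set L := Minf g I piX pi.
have cXX : compact [set: X * X] by rewrite -setXTT; exact: compact_setX.
have hXX : hausdorff_space (X * X)%type by exact: hausdorff_prod.
have [B2 [oB2 bB2]] := @compact_base_seq R (X * X)%type (x0, x0) cXX.
have [B1 [oB1 bB1]] := @compact_base_seq R X x0 cX.
(* The points of [L] lying in all [D n] are those whose orbit closure contains [L]. When [B2 n]
   misses [L] the condition is void and [D n] is everything. *)
pose D n : set (X * X) := [set z | B2 n `&` L !=set0 ->
  exists t, B2 n (act2 actX t z)].
have cact2 t : continuous (act2 actX t).
  by apply: pair_continuous; apply: (comp_cont _ (flow_cont (t := t) flX));
    [exact: fst_cont|exact: snd_cont].
have oD n : open (D n).
  have [BL|nBL] := pselect (B2 n `&` L !=set0); last first.
    have -> : D n = setT by apply/seteqP; split => // z _ /nBL.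
    exact: openT.
  have -> : D n = \bigcup_t (act2 actX t @^-1` (B2 n)).
    apply/seteqP; split => [z /(_ BL) [t Bt]|z [t _ Bt] _]; first by exists t.
    by exists t.
  by apply: bigcup_open => t _; apply: open_comp => // z _; exact: cact2.
have dD n : L `<=` closure (D n `&` L).
  move=> q Lq O; rewrite nbhsE => -[O' [oO' O'q] sO].
  have [BL|nBL] := pselect (B2 n `&` L !=set0); last first.
    exists q; split; last exact: sO.
    by split => // /nBL.
  have [|z [t [Oz Lz Bz]]] := Minf_transitive hI eI oO' (oB2 n) _ BL; first by exists q.
  by exists z; split; [split => // _; exists t|exact: sO].
have cL : closed L by exact: Minf_closed hI eI.
have [VX [oVX dVX VXP]] := residual_fibers cXX hXX hX (@fst_cont X X)
  (conj oB2 bB2) cL oD dD (Minf_semiopen fX hI eI).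
have dVX' j : [set: X] `<=` closure (VX j `&` setT) by exact: dVX.
have semiY O : open O -> (O `&` [set: X]) !=set0 -> (pi @` (O `&` setT))° !=set0.
  move=> oO; rewrite setIT => O0.
  exact: (minimal_semiopen cX hX flX.1 flX.2.1 (fun t => flow_cont (t := t) flX) minX
    hY flY.1 flY.2.1 (fun t => flow_cont (t := t) flY) cpi spi epi' oO O0).
(* The second application of [residual_fibers], to [pi] with [A] all of X, distributes the dense
   open sets [VX] obtained from the first. *)
have [VY [oVY dVY VYP]] := residual_fibers cX hX hY cpi (conj oB1 bB1)
  closedT oVX dVX' semiY.
exists (\bigcap_n VY n); split.
  split; first exact: subsetT.
  exists VY; split; first exact: oVY.
  by split; [exact: dVY|rewrite setTI; exact: subset_refl].
move=> y Yy; exists ((pi @^-1` [set y]) `&` \bigcap_n VX n); split.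
  split; first by move=> x [].
  exists VX; split; first exact: oVX.
  split; last exact: subset_refl.
  move=> n x xy.
  have := VYP y (fun n => Yy n Logic.I) n x.
  by rewrite setTI => /(_ xy).
move=> x [xy Vx].
exists [set x' | L (x, x') /\ forall n, D n (x, x')]; split.
  split; first by move=> x' [].
  exists (fun n => [set x' | D n (x, x')]); split; [|split].
  - move=> n; have cp : continuous (fun x' : X => (x, x')).
      by apply: pair_continuous; [exact: cst_cont|exact: id_cont].
    by apply: (@open_comp _ _ (fun x' : X => (x, x')) (D n)) => // z _; exact: cp.
  - move=> n x' Lx.
    have cl := VXP x (fun n => Vx n Logic.I) n (x, x') (conj Lx erefl).
    apply: (closure_map (@snd_cont X X) _ cl).
    by move=> [a b] [Da [La /= ax]]; move: Da La; rewrite /= ax.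
  - by move=> x' [Lx Dx]; split => // n; exact: Dx.
move=> x' [Lx Dx].
have LR := Minf_Rpi fY epi hI eI.
split => //; split; first exact: (Minf_diag pi hI eI).
split; first exact: (Minf_neq_diag hT fX fY epi hI eI nPI).
split => //; split; first exact: LR.
move=> q Lq O nO; have [n [Bq BO]] := bB2 q O nO.
have [|t Bt] := Dx n; first by exists q.
by exists (act2 actX t (x, x')); split; [exists t|exact: BO].
Qed.
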